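(* Let $k$ be an algebraically closed field, $K$ a field, $n\in\mathbb{N}$, and let $G$ denote the semidirect product $SL_2(\mathbb{Z})\ltimes_\rho(k^*\times k^* )$, where $SL_2(\mathbb{Z})$ acts on $k^*\times k^*$ by $$\rho\begin{pmatrix} a & b\\ c& d\end{pmatrix}(z,w)=(z^aw^b,\,z^cw^d).$$ Then there does not exist any injective group homomorphism from $G$ into the group $\mathrm{Diff}(\mathbb{R}^n)$ of diffeomorphisms of $\mathbb{R}^n$, and there does not exist any injective group homomorphism from $G$ into the group $\mathrm{Aut}_K(\mathbb{A}^n)$ of $K$-automorphisms of the affine space $\mathbb{A}^n$.
   Context: Group homomorphisms here are homomorphisms of abstract groups. $\mathrm{Aut}_K(\mathbb{A}^n)$ is the group of polynomial automorphisms of affine $n$-space defined over $K$. *)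

(* Defs.v *)
From HB Require Import structures.
From mathcomp Require Import all_boot all_order all_algebra.
From mathcomp Require Import all_classical all_reals all_analysis.
(* The notations of mpoly clash with those of mathcomp-analysis. *)
From mathcomp Require Import(canonicals,coercions) mpoly.

Set Implicit Arguments.
Unset Strict Implicit.
Unset Printing Implicit Defensive.

Import Order.TTheory GRing.Theory Num.Theory.
Import numFieldNormedType.Exports.

Local Open Scope ring_scope.

Section Kstar.
Variable F : fieldType.

Definition kstar := {x : F | x != 0}.
HB.instance Definition _ := Choice.on kstar.
Implicit Types x y z : kstar.

Definition kstar_one : kstar := exist _ 1 (oner_neq0 F).
Definition kstar_mul x y : kstar :=
  exist _ (val x * val y) (mulf_neq0 (valP x) (valP y)).
Definition kstar_inv x : kstar :=
  exist _ (val x)^-1 (invr_neq0 (valP x)).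

Fact kstar_mulA : associative kstar_mul.
Proof. by move=> x y z; apply: val_inj; rewrite /= mulrA. Qed.
Fact kstar_mul1 : left_id kstar_one kstar_mul.
Proof. by move=> x; apply: val_inj; rewrite /= mul1r. Qed.
Fact kstar_mulr1 : right_id kstar_one kstar_mul.
Proof. by move=> x; apply: val_inj; rewrite /= mulr1. Qed.
Fact kstar_mulV : left_inverse kstar_one kstar_inv kstar_mul.
Proof. by move=> x; apply: val_inj; rewrite /= mulVf ?(valP x). Qed.
Fact kstar_mulrV : right_inverse kstar_one kstar_inv kstar_mul.
Proof. by move=> x; apply: val_inj; rewrite /= mulfV ?(valP x). Qed.
HB.instance Definition _ := isGroup.Build kstar
  kstar_mulA kstar_mul1 kstar_mulr1 kstar_mulV kstar_mulrV.

Definition kstar_exp x (a : int) : kstar :=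
  exist _ (val x ^ a) (expfz_neq0 a (valP x)).

Definition torus := (kstar * kstar)%type.
HB.instance Definition _ := Choice.on torus.
Implicit Types s t u : torus.

Definition torus_one : torus := (1%g, 1%g).
Definition torus_mul s t : torus := (s.1 * t.1, s.2 * t.2)%g.
Definition torus_inv t : torus := (t.1^-1, t.2^-1)%g.

Fact torus_mulA : associative torus_mul.
Proof. by move=> x y z; rewrite /torus_mul /= !mulgA. Qed.
Fact torus_mul1 : left_id torus_one torus_mul.
Proof. by move=> [x y]; rewrite /torus_mul /= !mul1g. Qed.
Fact torus_mulr1 : right_id torus_one torus_mul.
Proof. by move=> [x y]; rewrite /torus_mul /= !mulg1. Qed.
Fact torus_mulV : left_inverse torus_one torus_inv torus_mul.
Proof. by move=> [x y]; rewrite /torus_mul /= !mulVg. Qed.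
Fact torus_mulrV : right_inverse torus_one torus_inv torus_mul.
Proof. by move=> [x y]; rewrite /torus_mul /= !mulgV. Qed.
HB.instance Definition _ := isGroup.Build torus
  torus_mulA torus_mul1 torus_mulr1 torus_mulV torus_mulrV.

End Kstar.

Definition SL2Z := {M : 'M[int]_2 | \det M == 1}.
HB.instance Definition _ := Choice.on SL2Z.

Section SL2Z.
Implicit Types M N P : SL2Z.

Fact SL2Z_det M : \det (val M) = 1.
Proof. exact/eqP/(valP M). Qed.
Fact SL2Z_unit M : val M \in unitmx.
Proof. by rewrite unitmxE SL2Z_det unitr1. Qed.
Fact SL2Z_one_subproof : \det (1%:M : 'M[int]_2) == 1.
Proof. by rewrite det1. Qed.
Fact SL2Z_mul_subproof M N : \det (val M *m val N) == 1.
Proof. by rewrite det_mulmx !SL2Z_det mulr1. Qed.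
Fact SL2Z_inv_subproof M : \det (invmx (val M)) == 1.
Proof. by rewrite det_inv SL2Z_det invr1. Qed.

Definition SL2Z_one : SL2Z := exist _ 1%:M SL2Z_one_subproof.
Definition SL2Z_mul M N : SL2Z := exist _ (val M *m val N) (SL2Z_mul_subproof M N).
Definition SL2Z_inv M : SL2Z := exist _ (invmx (val M)) (SL2Z_inv_subproof M).

Fact SL2Z_mulA : associative SL2Z_mul.
Proof. by move=> M N P; apply: val_inj; rewrite /= mulmxA. Qed.
Fact SL2Z_mul1 : left_id SL2Z_one SL2Z_mul.
Proof. by move=> M; apply: val_inj; rewrite /= mul1mx. Qed.
Fact SL2Z_mulr1 : right_id SL2Z_one SL2Z_mul.
Proof. by move=> M; apply: val_inj; rewrite /= mulmx1. Qed.
Fact SL2Z_mulV : left_inverse SL2Z_one SL2Z_inv SL2Z_mul.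
Proof. by move=> M; apply: val_inj; rewrite /= mulVmx ?SL2Z_unit. Qed.
Fact SL2Z_mulrV : right_inverse SL2Z_one SL2Z_inv SL2Z_mul.
Proof. by move=> M; apply: val_inj; rewrite /= mulmxV ?SL2Z_unit. Qed.
HB.instance Definition _ := isGroup.Build SL2Z
  SL2Z_mulA SL2Z_mul1 SL2Z_mulr1 SL2Z_mulV SL2Z_mulrV.

End SL2Z.

Section SemidirectProduct.
Variable F : fieldType.
Implicit Types (M N : SL2Z) (s t u : torus F).

(* The exponents are bound outside of the group scope, where 1 : 'I_2 would
   denote the neutral element of the additive group 'I_2, i.e. the index 0. *)
Definition rho M t : torus F :=
  let: (z, w) := t in
  let a := val M 0 0 in let b := val M 0 1 in
  let c := val M 1 0 in let d := val M 1 1 in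
  (kstar_exp z a * kstar_exp w b, kstar_exp z c * kstar_exp w d)%g.

Arguments rho : simpl never.

Fact rho1 t : rho 1%g t = t.
Proof.
rewrite /rho; case: t => z w; congr (_, _); apply: val_inj; rewrite /= !mxE /=.
  by rewrite expr1z expr0z mulr1.
by rewrite expr1z expr0z mul1r.
Qed.

Fact rhoM M N t : rho (M * N)%g t = rho M (rho N t).
Proof.
have l1 : lift ord0 ord0 = 1 :> 'I_2 by exact: val_inj.
have h (a b c d e f : int) (z w : kstar F) :
    val z ^ (e * a + f * c) * val w ^ (e * b + f * d) =
    (val z ^ a * val w ^ b) ^ e * (val z ^ c * val w ^ d) ^ f.
  rewrite !expfzMl !exprz_exp !expfzDr ?(valP z) ?(valP w) //.
  by rewrite mulrACA ![e * _]mulrC ![f * _]mulrC.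
rewrite /rho; case: t => z w; congr (_, _); apply: val_inj;
  by rewrite /= !mxE !big_ord_recl !big_ord0 !addr0 !l1 h.
Qed.

Fact rho_mul M s t : rho M (s * t)%g = (rho M s * rho M t)%g.
Proof.
rewrite /rho; case: s t => [z w] [z' w']; congr (_, _); apply: val_inj;
  by rewrite /= !expfzMl mulrACA.
Qed.

(* The pair (M, t) stands for the product t M, where M t M^-1 = rho M t. *)
Definition SL2Z_torus := (SL2Z * torus F)%type.
HB.instance Definition _ := Choice.on SL2Z_torus.
Implicit Types g h : SL2Z_torus.

Definition SL2Z_torus_one : SL2Z_torus := (1%g, 1%g).
Definition SL2Z_torus_mul g h : SL2Z_torus := (g.1 * h.1, g.2 * rho g.1 h.2)%g.
Definition SL2Z_torus_inv g : SL2Z_torus := (g.1^-1, rho g.1^-1 g.2^-1)%g.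

Fact rho_one M : rho M 1%g = 1%g.
Proof. by apply: (@mulgI _ (rho M 1%g)); rewrite -rho_mul !mulg1. Qed.
Fact SL2Z_torus_mulA : associative SL2Z_torus_mul.
Proof. by move=> g h l; rewrite /SL2Z_torus_mul /= rhoM rho_mul !mulgA. Qed.
Fact SL2Z_torus_mul1 : left_id SL2Z_torus_one SL2Z_torus_mul.
Proof. by move=> [M t]; rewrite /SL2Z_torus_mul /= rho1 !mul1g. Qed.
Fact SL2Z_torus_mulr1 : right_id SL2Z_torus_one SL2Z_torus_mul.
Proof. by move=> [M t]; rewrite /SL2Z_torus_mul /= rho_one !mulg1. Qed.
Fact SL2Z_torus_mulV : left_inverse SL2Z_torus_one SL2Z_torus_inv SL2Z_torus_mul.
Proof.
by move=> [M t]; rewrite /SL2Z_torus_mul /= -rho_mul !mulVg rho_one.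
Qed.
Fact SL2Z_torus_mulrV : right_inverse SL2Z_torus_one SL2Z_torus_inv SL2Z_torus_mul.
Proof.
by move=> [M t]; rewrite /SL2Z_torus_mul /= -rhoM !mulgV rho1 mulgV.
Qed.
HB.instance Definition _ := isGroup.Build SL2Z_torus
  SL2Z_torus_mulA SL2Z_torus_mul1 SL2Z_torus_mulr1 SL2Z_torus_mulV SL2Z_torus_mulrV.

End SemidirectProduct.

Section Smooth.
Variable R : realType.

(* f is C^(m+1) when it is differentiable everywhere and its partial
   derivatives are C^m; 'e_i is the i-th vector of the standard basis. *)
Fixpoint Ck n (W : normedModType R) (m : nat) (f : 'rV[R]_n -> W) : Prop :=
  match m with
  | 0 => continuous f
  | m'.+1 => (forall x, differentiable f x) /\
             (forall i : 'I_n, Ck m' (fun x => 'D_'e_i f x))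
  end.

Definition smooth n (W : normedModType R) (f : 'rV[R]_n -> W) :=
  forall m, Ck m f.

Section CkTheory.
Variable n : nat.
Implicit Types (W : normedModType R) (m : nat).

Lemma CkS W m (f : 'rV[R]_n -> W) : Ck m.+1 f -> Ck m f.
Proof.
elim: m f => [|m IH] f [df Df]; first by move=> x; exact/differentiable_continuous/df.
by split=> // i; exact/IH/Df.
Qed.

Lemma Ck_cst W m (w : W) : Ck m (fun _ : 'rV[R]_n => w).
Proof.
elim: m w => [|m IH] w; first exact: cst_continuous.
split=> [x|i]; first exact: differentiable_cst.
by under eq_fun do rewrite derive_cst; exact: IH.
Qed.

Lemma CkD W m (f g : 'rV[R]_n -> W) :
  Ck m f -> Ck m g -> Ck m (fun x => f x + g x).
Proof.
elim: m f g => [|m IH] f g; first by move=> cf cg x; exact: (cvgD (cf x) (cg x)).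
move=> [df Df] [dg Dg]; split=> [x|i]; first exact: differentiableD.
rewrite (_ : (fun x => _) = fun x => 'D_'e_i f x + 'D_'e_i g x);
  first exact: IH (Df i) (Dg i).
by apply/funext => x; rewrite -deriveD //; exact: diff_derivable.
Qed.

Lemma Ck_sum W m p (f : 'I_p -> 'rV[R]_n -> W) :
  (forall j, Ck m (f j)) -> Ck m (fun x => \sum_(j < p) f j x).
Proof.
elim: p f => [|p IH] f Cf.
  by under eq_fun do rewrite big_ord0; exact: Ck_cst.
by under eq_fun do rewrite big_ord_recr /=; apply: CkD => //; exact: IH.
Qed.

Lemma CkM m (f g : 'rV[R]_n -> R) :
  Ck m f -> Ck m g -> Ck m (fun x => f x * g x).
Proof.
elim: m f g => [|m IH] f g; first by move=> cf cg x; exact: (cvgM (cf x) (cg x)).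
move=> Cf Cg; have [df Df] := Cf; have [dg Dg] := Cg.
split=> [x|i]; first exact: differentiableM.
rewrite (_ : (fun x => _) = fun x => f x * 'D_'e_i g x + g x * 'D_'e_i f x).
  by apply: CkD; [exact: IH (CkS Cf) (Dg i)|exact: IH (CkS Cg) (Df i)].
by apply/funext => x; rewrite -!/(_ *: _) -deriveM //; exact: diff_derivable.
Qed.

Lemma CkZl W m (f : 'rV[R]_n -> R) (w : W) : Ck m f -> Ck m (fun x => f x *: w).
Proof.
elim: m f => [|m IH] f; first by move=> cf x; exact: (cvgZr_tmp (cf x)).
move=> [df Df]; split=> [x|i]; first exact: differentiableZl.
rewrite (_ : (fun x => _) = fun x => 'D_'e_i f x *: w); first exact: IH (Df i).
apply/funext => x; rewrite !deriveE //; last exact: differentiableZl.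
by rewrite diffZl.
Qed.

Lemma Ck_coord p m (f : 'rV[R]_n -> 'rV[R]_p) j : Ck m f -> Ck m (fun x => f x 0 j).
Proof.
elim: m f => [|m IH] f.
  by move=> cf x; exact: (continuous_comp (cf x) (@coord_continuous R 1 p 0 j (f x))).
move=> [df Df].
have dc x : differentiable (fun x => f x 0 j) x.
  by apply: (@differentiable_comp _ _ _ _ f (fun M => M 0 j)) => //; exact: differentiable_coord.
split=> [x|i]; first exact: dc.
rewrite (_ : (fun x => _) = fun x => ('D_'e_i f x) 0 j); first exact: (IH _ (Df i)).
apply/funext => x; rewrite derive_mx ?mxE //; exact: diff_derivable.
Qed.
End CkTheory.

Lemma Ck_comp_scalar n p m (f : 'rV[R]_p -> R) (g : 'rV[R]_n -> 'rV[R]_p) :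
  Ck m f -> Ck m g -> Ck m (f \o g).
Proof.
elim: m f => [|m IH] f.
  by move=> cf cg x; exact: (continuous_comp (cg x) (cf (g x))).
move=> [df Df] Cg; have [dg Dg] := Cg; split=> [x|i]; first exact: differentiable_comp.
rewrite (_ : (fun x => _) = fun x => \sum_(j < p)
   'D_'e_j f (g x) * 'D_'e_i g x 0 j).
  apply: Ck_sum => j; apply: CkM; last exact/Ck_coord/Dg.
  exact: (IH _ (Df j) (CkS Cg)).
apply/funext => x; rewrite deriveE; last exact: differentiable_comp.
rewrite diff_comp //=.
have -> : 'd g x 'e_i =
    \sum_(j < p) 'D_'e_i g x 0 j *: 'e_j.
  by rewrite -row_sum_delta deriveE.
rewrite linear_sum; apply: eq_bigr => j _.
by rewrite linearZ /= mulrC [X in _ = _ * X]deriveE.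
Qed.

Lemma Ck_comp n p q m (f : 'rV[R]_p -> 'rV[R]_q) (g : 'rV[R]_n -> 'rV[R]_p) :
  Ck m f -> Ck m g -> Ck m (f \o g).
Proof.
move=> Cf Cg.
rewrite (_ : f \o g = fun x => \sum_(j < q) f (g x) 0 j *: 'e_j).
  apply: Ck_sum => j; apply: CkZl.
  exact: (Ck_comp_scalar (Ck_coord j Cf) Cg).
by apply/funext => x; rewrite -row_sum_delta.
Qed.

Lemma smooth_id n : smooth (@id 'rV[R]_n).
Proof.
case=> [x|m]; first exact: cvg_id.
split=> [x|i]; first exact: (@ex_diff _ _ _ _ _ _ _ (is_diff_id x)).
by under eq_fun do rewrite derive_id; exact: Ck_cst.
Qed.

Lemma smooth_comp n p q (f : 'rV[R]_p -> 'rV[R]_q) (g : 'rV[R]_n -> 'rV[R]_p) :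
  smooth f -> smooth g -> smooth (f \o g).
Proof. by move=> sf sg m; exact: Ck_comp. Qed.

End Smooth.

Section Diffeomorphisms.
Variables (R : realType) (n : nat).

Record Diff := MkDiff {
  diff_fun :> 'rV[R]_n -> 'rV[R]_n;
  diff_inv : 'rV[R]_n -> 'rV[R]_n;
  diff_funK : cancel diff_fun diff_inv;
  diff_invK : cancel diff_inv diff_fun;
  diff_fun_smooth : smooth diff_fun;
  diff_inv_smooth : smooth diff_inv }.
HB.instance Definition _ := gen_eqMixin Diff.
HB.instance Definition _ := gen_choiceMixin Diff.
Implicit Types f g h : Diff.

Lemma Diff_inj f g : f =1 g -> f = g.
Proof.
case: f g => [f f' fK f'K sf sf'] [g g' gK g'K sg sg'] /= /funext fg.
subst g; have fg' : f' = g' by apply/funext => x; rewrite -[in RHS](f'K x) gK.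
by subst g'; congr MkDiff; exact: Prop_irrelevance.
Qed.

Definition Diff_one : Diff :=
  @MkDiff id id (fun=> erefl) (fun=> erefl) (@smooth_id R n) (@smooth_id R n).
Definition Diff_mul f g : Diff :=
  @MkDiff (f \o g) (diff_inv g \o diff_inv f)
    (can_comp (@diff_funK f) (@diff_funK g)) (can_comp (@diff_invK g) (@diff_invK f))
    (smooth_comp (@diff_fun_smooth f) (@diff_fun_smooth g))
    (smooth_comp (@diff_inv_smooth g) (@diff_inv_smooth f)).
Definition Diff_inv f : Diff :=
  MkDiff (@diff_invK f) (@diff_funK f) (@diff_inv_smooth f) (@diff_fun_smooth f).

Fact Diff_mulA : associative Diff_mul.
Proof. by move=> f g h; exact: Diff_inj. Qed.
Fact Diff_mul1 : left_id Diff_one Diff_mul.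
Proof. by move=> f; exact: Diff_inj. Qed.
Fact Diff_mulr1 : right_id Diff_one Diff_mul.
Proof. by move=> f; exact: Diff_inj. Qed.
Fact Diff_mulV : left_inverse Diff_one Diff_inv Diff_mul.
Proof. by move=> f; apply: Diff_inj; exact: diff_funK. Qed.
Fact Diff_mulrV : right_inverse Diff_one Diff_inv Diff_mul.
Proof. by move=> f; apply: Diff_inj; exact: diff_invK. Qed.
HB.instance Definition _ := isGroup.Build Diff
  Diff_mulA Diff_mul1 Diff_mulr1 Diff_mulV Diff_mulrV.

End Diffeomorphisms.

Section PolynomialAutomorphisms.
Variables (K : fieldType) (n : nat).

(* Endomorphisms of affine n-space are tuples of polynomials rather than
   polynomial functions: the two notions differ when K is finite. *)
Definition polymap := n.-tuple (mpoly.mpoly n K).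
HB.instance Definition _ := Choice.on polymap.
Implicit Types f g h : polymap.

Definition polymap_id : polymap := [tuple mpoly.mpolyX K (mpoly.mnm1 i) | i < n].
Definition polymap_comp f g : polymap :=
  [tuple mpoly.comp_mpoly g (tnth f i) | i < n].

Fact polymap_id_comp : left_id polymap_id polymap_comp.
Proof.
move=> f; apply: eq_from_tnth => i.
by rewrite !tnth_mktuple mpoly.comp_mpolyXU -tnth_nth.
Qed.
Fact polymap_comp_id : right_id polymap_id polymap_comp.
Proof.
move=> f; apply: eq_from_tnth => i; rewrite tnth_mktuple.
exact: mpoly.comp_mpoly_id.
Qed.
Fact polymap_compA : associative polymap_comp.
Proof.
move=> f g h; apply: eq_from_tnth => i; rewrite !tnth_mktuple.
rewrite [in LHS]mpoly.comp_mpolyEX.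
rewrite [X in mpoly.comp_mpoly _ X]mpoly.comp_mpolyEX.
rewrite raddf_sum /=.
apply: eq_bigr => m _; rewrite /= mpoly.comp_mpolyZ; congr (_ *: _).
rewrite !mpoly.comp_mpolyX rmorph_prod; apply: eq_bigr => j _.
by rewrite rmorphXn tnth_mktuple.
Qed.

(* An automorphism is paired with its inverse, which it determines. *)
Definition Aut_affine := {fg : polymap * polymap |
  (polymap_comp fg.1 fg.2 == polymap_id) && (polymap_comp fg.2 fg.1 == polymap_id)}.
HB.instance Definition _ := Choice.on Aut_affine.
Implicit Types a b c : Aut_affine.

Fact Aut_affine_inj a b : (val a).1 = (val b).1 -> a = b.
Proof.
move: a b => [[f f'] ff'] [[g g'] gg'] /= fg.
move: ff' gg'; rewrite fg => ff' gg'; apply: val_inj; congr pair => /=.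
case/andP: ff' => /= _ /eqP f'g; case/andP: gg' => /= /eqP gg' _.
by rewrite -[f']polymap_comp_id -gg' polymap_compA f'g polymap_id_comp.
Qed.

Fact Aut_affine_one_subproof : 
  (polymap_comp polymap_id polymap_id == polymap_id) && 
  (polymap_comp polymap_id polymap_id == polymap_id).
Proof. by rewrite polymap_comp_id eqxx. Qed.
Fact Aut_affine_mul_subproof a b :
  let f := polymap_comp (val a).1 (val b).1 in
  let g := polymap_comp (val b).2 (val a).2 in
  (polymap_comp f g == polymap_id) && (polymap_comp g f == polymap_id).
Proof.
case/andP: (valP a) => /eqP a1 /eqP a2; case/andP: (valP b) => /eqP b1 /eqP b2 /=.
rewrite -!polymap_compA [polymap_comp (val b).1 _]polymap_compA b1.
rewrite [polymap_comp (val a).2 _]polymap_compA a2.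
by rewrite !polymap_id_comp a1 b2 eqxx.
Qed.
Fact Aut_affine_inv_subproof a :
  (polymap_comp (val a).2 (val a).1 == polymap_id) &&
  (polymap_comp (val a).1 (val a).2 == polymap_id).
Proof. by rewrite andbC (valP a). Qed.

Definition Aut_affine_one : Aut_affine :=
  exist _ (polymap_id, polymap_id) Aut_affine_one_subproof.
Definition Aut_affine_mul a b : Aut_affine :=
  exist _ (polymap_comp (val a).1 (val b).1, polymap_comp (val b).2 (val a).2)
    (Aut_affine_mul_subproof a b).
Definition Aut_affine_inv a : Aut_affine :=
  exist _ ((val a).2, (val a).1) (Aut_affine_inv_subproof a).

Fact Aut_affine_mulA : associative Aut_affine_mul.
Proof. by move=> a b c; apply: Aut_affine_inj; rewrite /= polymap_compA. Qed.
Fact Aut_affine_mul1 : left_id Aut_affine_one Aut_affine_mul.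
Proof. by move=> a; apply: Aut_affine_inj; rewrite /= polymap_id_comp. Qed.
Fact Aut_affine_mulr1 : right_id Aut_affine_one Aut_affine_mul.
Proof. by move=> a; apply: Aut_affine_inj; rewrite /= polymap_comp_id. Qed.
Fact Aut_affine_mulV : left_inverse Aut_affine_one Aut_affine_inv Aut_affine_mul.
Proof. by move=> a; apply: Aut_affine_inj; case/andP: (valP a) => _ /eqP. Qed.
Fact Aut_affine_mulrV : right_inverse Aut_affine_one Aut_affine_inv Aut_affine_mul.
Proof. by move=> a; apply: Aut_affine_inj; case/andP: (valP a) => /eqP. Qed.
HB.instance Definition _ := isGroup.Build Aut_affine
  Aut_affine_mulA Aut_affine_mul1 Aut_affine_mulr1 Aut_affine_mulV Aut_affine_mulrV.

End PolynomialAutomorphisms.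

(* Main.v *)
(* For a prime p > n, p odd and invertible in k and K, the group G contains
   u, v, c with v^p = c^p = 1, c <> 1, c central in <u, v> and u v = v c u: take
   u = [[1, 1], [0, 1]], v = (1, zeta) and c = (zeta, 1) with zeta a primitive
   p-th root of unity.  Such a Heisenberg triple has c = 1 in both targets.

   Diff(R^n).  By Smith theory, Fix v and Fix <v, c> are acyclic mod p.  The trace
   of the projector onto the fixed space of the derivative of v is continuous and
   integral on Fix v, hence constant.  As v c^j = u^j v u^-j, at a point of
   Fix <v, c> all the derivatives of v c^j have fixed spaces of the same dimension;
   a character count mod p > n then forces the derivative of c to be 1, so that c
   is the identity near that point, hence everywhere.

   Aut(A^n).  Specializing the coefficients of u, v, c and of their inverses, one
   may replace K by a finite field F of characteristic other than p.  A power
   w = u^m with m prime to p acts on F^n with p-power order, so counting mod p gives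
   a common fixed point of w, v, c.  On an eigenspace of the derivative of c there,
   w v = v c^m w gives by taking determinants an eigenvalue z with z^(m d) = 1 for
   some d <= n < p; so z = 1, the derivative of c is 1, and c = 1 because c^p = 1. *)

Require Import Defs.
From mathcomp Require Import all_boot all_order all_algebra all_fingroup all_solvable all_field.
From mathcomp Require Import ring lra zify.
From mathcomp Require Import all_classical all_reals all_analysis.
From mathcomp Require Import(canonicals,coercions) mpoly.

Set Implicit Arguments.
Unset Strict Implicit.
Unset Printing Implicit Defensive.

Import Order.TTheory GRing.Theory Num.Theory.
Import numFieldNormedType.Exports.

Local Open Scope ring_scope.

(** * Augmented cochains *)

(** The fixed sets are handled merely as closed sets, so acyclicity refers to cochains on tuples of
    nearby points (Alexander-Spanier), at all small scales. It is required in every degree because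
    Smith theory is applied twice, the second time to c acting on Fix v; in the end it yields a
    point of Fix <v, c> and the constancy on Fix v of continuous functions with integral values.
    Away from its fixed points, a map sigma of period p is compared with the free action of Z/p on a
    finite join of copies of Z/p. This join carries cochains e_0, e_1, ..., where e_0 is the
    augmentation and d e_k is in turn N e_(k+1) and (sigma - 1) e_(k+1), N being the norm; they
    vanish beyond its dimension. Multiplied by a cocycle of the fixed set, they show that this
    cocycle is a norm up to a coboundary, and at fixed points a norm is p times a value, that is 0
    mod p. As u has infinite order, Smith theory does not apply to it: on R^n it only conjugates,
    carrying points of Fix <v, c> into Fix v, while over a finite field it permutes finitely many
    points. *)

Section Cochains.
Variables (X : eqType) (A : comNzRingType).
Implicit Types (f g : seq X -> A) (s t : seq X) (h : X -> X).

(* A sequence of m points is a simplex of dimension m - 1; the empty sequence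
   accounts for the augmentation. *)
Fixpoint cobound f s : A :=
  if s is x :: s' then f s' - cobound (fun t => f (x :: t)) s' else 0.

Lemma eq_cobound f g s :
  (forall t, (size t).+1 = size s -> {subset t <= s} -> f t = g t) ->
  cobound f s = cobound g s.
Proof.
elim: s f g => //= x s IH f g fg; congr (_ - _).
  by apply: fg => // y ys; rewrite in_cons ys orbT.
apply: IH => t st ts; apply: fg => /=; first by rewrite st.
by move=> y; rewrite !in_cons => /orP[->//|/ts->]; rewrite orbT.
Qed.

Lemma coboundB f g s :
  cobound (fun t => f t - g t) s = cobound f s - cobound g s.
Proof.
elim: s f g => [|x s IH] f g /=; first by rewrite subr0.
by rewrite IH !opprD !opprK addrACA.
Qed.

Lemma cobound0 s : cobound (fun=> 0) s = 0.
Proof. by elim: s => //= x s ->; rewrite subr0. Qed.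

Lemma coboundN f s : cobound (fun t => - f t) s = - cobound f s.
Proof.
rewrite -[RHS]sub0r -[X in X - _](cobound0 s) -coboundB.
by apply: eq_cobound => t _ _; rewrite sub0r.
Qed.

Lemma coboundD f g s :
  cobound (fun t => f t + g t) s = cobound f s + cobound g s.
Proof.
rewrite -[cobound g s]opprK -coboundN -coboundB.
by apply: eq_cobound => t _ _; rewrite opprK.
Qed.

Lemma cobound_sum (I : Type) (r : seq I) (F : I -> seq X -> A) s :
  cobound (fun t => \sum_(i <- r) F i t) s = \sum_(i <- r) cobound (F i) s.
Proof.
elim: r => [|i r IH].
  by rewrite big_nil -[RHS](cobound0 s); apply: eq_cobound => t _ _; rewrite big_nil.
rewrite big_cons -IH -coboundD; apply: eq_cobound => t _ _.
by rewrite big_cons.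
Qed.

Lemma cobound_cobound f s : cobound (cobound f) s = 0.
Proof.
elim: s f => //= x s IH f.
by rewrite [X in _ - X]coboundB IH subr0 subrr.
Qed.

End Cochains.

Lemma cobound_map (X Y : eqType) (A : comNzRingType) (h : X -> Y) (f : seq Y -> A) s :
  cobound (fun t => f (map h t)) s = cobound f (map h s).
Proof. by elim: s f => //= x s IH f; rewrite (IH (fun t => f (h x :: t))). Qed.

Section Prism.
Variables (X : eqType) (A : comNzRingType).
Implicit Types (f g : seq X -> A) (s t : seq X) (h : X -> X).

(** The alternating sum over i of [f] at (h x_0, ..., h x_i, h' x_i, ..., h' x_m), which is the
    usual triangulation of the prism between [h] and [h']. *)
Fixpoint prism h h' f s : A :=
  if s is x :: s' then
    f (h x :: h' x :: map h' s') - prism h h' (fun t => f (h x :: t)) s'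
  else 0.

Lemma eq_prism h h' f g s :
  (forall t, size t = (size s).+1 -> {subset t <= map h s ++ map h' s} -> f t = g t) ->
  prism h h' f s = prism h h' g s.
Proof.
elim: s f g => //= x s IH f g fg; congr (_ - _).
  apply: fg => [|y]; first by rewrite /= size_map.
  rewrite !(in_cons, mem_cat).
  by case: (y == h x); case: (y == h' x); case: (y \in map h' s); rewrite ?orbT.
apply: IH => t st ts; apply: fg => /=; first by rewrite st.
move=> y; rewrite !(in_cons, mem_cat) => /orP[->//|/ts].
by rewrite mem_cat => /orP[] ->; rewrite ?orbT.
Qed.

Lemma prism0 h h' s : prism h h' (fun=> 0) s = 0.
Proof. by elim: s => //= x s ->; rewrite subr0. Qed.

Lemma prismB h h' f g s :
  prism h h' (fun t => f t - g t) s = prism h h' f s - prism h h' g s.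
Proof.
elim: s f g => [|x s IH] f g /=; first by rewrite subr0.
by rewrite IH !opprD !opprK addrACA.
Qed.

Lemma prism_homotopy h h' f s :
  cobound (prism h h' f) s + prism h h' (cobound f) s =
  f (map h' s) - f (map h s).
Proof.
elim: s f => [|x s IH] f /=; first by rewrite subrr addr0.
rewrite coboundB (cobound_map h' (fun t => f (h x :: h' x :: t))) prismB.
have /= IHx := IH (fun t => f (h x :: t)).
move/(canRL (addKr _)): IHx => ->; ring.
Qed.

(** This sign anticommutes with [cobound], as the Leibniz rule for [star] requires. *)
Definition twist f s : A := if odd (size s) then - f s else f s.

Lemma cobound_twist f s : cobound (twist f) s = - twist (cobound f) s.
Proof.
elim: s f => [|x s IH] f; first by rewrite /= /twist /= oppr0.
rewrite /twist /=.
have -> : cobound (fun t => if ~~ odd (size t) then - f (x :: t) else f (x :: t)) s =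
  - cobound (twist (fun t => f (x :: t))) s.
  rewrite -coboundN; apply: eq_cobound => t _ _; rewrite /twist /=.
  by case: odd; rewrite ?opprK.
rewrite IH /twist; case: odd => /=; ring.
Qed.
End Prism.

Section Star.
Variables (X : eqType) (A : comNzRingType) (inner : pred X).
Implicit Types (f a : seq X -> A) (s t : seq X).

(* The product of f on the inner vertices by a on the outer ones, with the sign of
   the shuffle that moves the inner vertices to the front. *)
Fixpoint star f a s : A :=
  if s is x :: s' then
    if inner x then star (fun t => f (x :: t)) a s'
    else star (twist f) (fun t => a (x :: t)) s'
  else f [::] * a [::].

Fixpoint star_sign s : A :=
  if s is x :: s' then
    star_sign s' * (if inner x then 1 else (-1) ^+ count inner s') else 1.

Lemma starE f a s :
  star f a s = star_sign s * (f (seq.filter inner s) * a (seq.filter (predC inner) s)).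
Proof.
elim: s f a => [|x s IH] f a /=; first by rewrite mul1r.
case nx: (inner x); first by rewrite IH mulr1.
rewrite IH /twist size_filter -mulrA; congr (_ * _).
by rewrite -signr_odd; case: odd; rewrite ?mul1r // ?expr1 !mulNr ?mul1r.
Qed.

Lemma twistK f s : twist (twist f) s = f s.
Proof. by rewrite /twist; case: odd; rewrite ?opprK. Qed.

Lemma starBl f g a s : star (fun t => f t - g t) a s = star f a s - star g a s.
Proof. by rewrite !starE mulrBl mulrBr. Qed.

Lemma starBr f a b s : star f (fun t => a t - b t) s = star f a s - star f b s.
Proof. by rewrite !starE !mulrBr. Qed.

Lemma eq_star f g a b s :
  f (seq.filter inner s) = g (seq.filter inner s) ->
  a (seq.filter (predC inner) s) = b (seq.filter (predC inner) s) ->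
  star f a s = star g b s.
Proof. by move=> fg ab; rewrite !starE fg ab. Qed.

(** Leibniz rule: a face omits either an inner or an outer vertex, and in the second case its sign
    also counts inner vertices, whence [twist]. *)
Lemma cobound_star f a s :
  cobound (star f a) s = star (cobound f) a s + star (twist f) (cobound a) s.
Proof.
elim: s f a => [|x s IH] f a /=; first by rewrite mul0r mulr0 addr0.
case nx: (inner x).
  rewrite IH opprD addrA starBl; congr (_ + _).
  rewrite !starE /twist /=; case: odd => /=; rewrite ?mulNr ?mulrN ?opprK //.
rewrite IH [star (twist (twist f)) _ s in RHS]starBr.
have -> : star (cobound (twist f)) (fun t => a (x :: t)) s =
    - star (twist (cobound f)) (fun t => a (x :: t)) s.
  by rewrite !starE cobound_twist mulNr mulrN.
have -> : star (twist (twist f)) a s = star f a s by apply: eq_star; rewrite ?twistK.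
ring.
Qed.

End Star.

Section NormDiff.
Variables (X : eqType) (A : comNzRingType) (p : nat) (h : X -> X).
Implicit Types (f g : seq X -> A) (s t : seq X).

(** The two elements 1 + h + ... + h^(p-1) and h - 1 of the group ring of Z/p. Their product is h^p
    - 1, so they annihilate each other; a boolean index lets them alternate. *)
Definition norm_diff (b : bool) f s : A :=
  if b then \sum_(i < p) f (map (iter i h) s) else f (map h s) - f s.

Lemma cobound_norm_diff b f s :
  cobound (norm_diff b f) s = norm_diff b (cobound f) s.
Proof.
case: b; rewrite /norm_diff; last by rewrite coboundB cobound_map.
by rewrite cobound_sum; apply: eq_bigr => i _; rewrite cobound_map.
Qed.

Lemma eq_norm_diff b f g s : (forall i, f (map (iter i h) s) = g (map (iter i h) s)) ->
  norm_diff b f s = norm_diff b g s.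
Proof.
move=> fg; case: b; rewrite /norm_diff; first by apply: eq_bigr => i _.
by have /= := fg 1%N; have := fg 0%N; rewrite map_id => -> ->.
Qed.

Lemma norm_diffB b f g s :
  norm_diff b (fun t => f t - g t) s = norm_diff b f s - norm_diff b g s.
Proof. by case: b; rewrite /norm_diff ?sumrB //; ring. Qed.

Lemma map_iterS i s : map (iter i h) (map h s) = map (iter i.+1 h) s.
Proof. by rewrite -map_comp; apply: eq_map => x; rewrite /= -iterS iterSr. Qed.

Lemma norm_diff_comp b f s : iter p h =1 id ->
  norm_diff b (norm_diff (~~ b) f) s = 0.
Proof.
move=> hp.
have telescope : \sum_(i < p) (f (map (iter i.+1 h) s) - f (map (iter i h) s)) = 0.
  rewrite -(big_mkord predT (fun i => f (map (iter i.+1 h) s) - f (map (iter i h) s))).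
  by rewrite (telescope_sumr (fun i => f (map (iter i h) s))) // (eq_map hp) subrr.
case: b; rewrite /norm_diff /=; rewrite -[RHS]telescope.
  by apply: eq_bigr => i _; rewrite -map_comp.
by rewrite -sumrB; apply: eq_bigr => i _; rewrite map_iterS.
Qed.
End NormDiff.

Section Alternating.
Variables (X : eqType) (A : comNzRingType).
Implicit Types (f g : seq X -> A) (s t : seq X).

Definition alternating f := forall s x y t,
  f (s ++ x :: y :: t) = - f (s ++ y :: x :: t).

Lemma alternating_cobound f : alternating f -> alternating (cobound f).
Proof.
move=> altf s x y t; elim: s f altf => [|z s IH] f altf /=.
  have -> : cobound (fun t => f [:: x, y & t]) t = - cobound (fun t => f [:: y, x & t]) t.
    by rewrite -coboundN; apply: eq_cobound => u _ _; exact: (altf [::]).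
  ring.
by rewrite altf IH ?opprD // => s' x' y' t'; exact: (altf (z :: s')).
Qed.

(** Transpositions bring two equal entries side by side, where exchanging them gives f = - f; the
    hypothesis on [A] then yields 0. *)
Lemma alternating_dup f s : (forall x : A, x + x = 0 -> x = 0) ->
  alternating f -> ~~ uniq s -> f s = 0.
Proof.
move=> A2 altf.
have dup s1 x s2 s3 : f (s1 ++ x :: s2 ++ x :: s3) = 0.
  elim: s2 s1 => [|y s2 IH] s1 /=.
    by apply: A2; rewrite {1}altf addNr.
  by rewrite altf -cat_rcons IH oppr0.
move=> su; suff [s1 [x [s2 [s3 ->]]]] : exists s1 x s2 s3, s = s1 ++ x :: s2 ++ x :: s3.
  exact: dup.
elim: s su => //= x s IH; rewrite negb_and negbK => /orP[xs|/IH[s1 [y [s2 [s3 ->]]]]].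
  by case/splitPr: xs => s2 s3; exists [::], x, s2, s3.
by exists (x :: s1), y, s2, s3.
Qed.
End Alternating.

Lemma big_Fp (A : nmodType) (p : nat) (F : nat -> A) : prime p ->
  \sum_(i < p) F i = \sum_(x : 'F_p) F x.
Proof.
move=> p_pr; rewrite -(big_mkord predT F) -[X in index_iota _ X](Fp_cast p_pr).
by rewrite big_mkord.
Qed.

(** * A periodic resolution on a join of copies of Z/p *)

Section Colours.
Variables (p : nat) (C : finType).
Hypotheses (p_pr : prime p) (p_odd : odd p).
Let Y := (C * 'F_p)%type.
Implicit Types (s t : seq Y) (y z : Y) (psi : seq Y -> 'F_p).

Definition rotate y : Y := (y.1, y.2 + 1).

(* Two vertices of the same colour but with different labels never span an
   edge: the complex of admissible tuples is the join of #|C| copies of Z/p. *)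
Definition admissible s := all (fun y => all (fun z => (y.1 == z.1) ==> (y.2 == z.2)) s) s.

Lemma admissibleP s :
  reflect {in s &, forall y z, y.1 = z.1 -> y = z} (admissible s).
Proof.
apply: (iffP allP) => [h [c l] [d m] ys zs /= cd|h y ys].
  by have /allP/(_ _ zs) := h _ ys; rewrite /= cd eqxx => /eqP ->.
by apply/allP => z zs; apply/implyP => /eqP/(h _ _ ys zs) ->.
Qed.

Lemma sub_admissible s t : {subset t <= s} -> admissible s -> admissible t.
Proof. by move=> ts /admissibleP h; apply/admissibleP => y z /ts ys /ts; exact: h. Qed.

Lemma iter_rotate i y : iter i rotate y = (y.1, y.2 + i%:R).
Proof.
elim: i => [|i IH] /=; first by rewrite addr0; case: y.
by rewrite IH /rotate /= -addrA -natr1.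
Qed.

Definition translate (l : 'F_p) y : Y := (y.1, y.2 - l).

Lemma admissible_map s h : (forall y, (h y).1 = y.1) ->
  (forall y z, y.2 = z.2 -> (h y).2 = (h z).2) -> admissible s -> admissible (map h s).
Proof.
move=> h1 h2 /admissibleP ads.
apply/admissibleP => _ _ /mapP[y ys ->] /mapP[z zs ->]; rewrite !h1 => yz.
by rewrite (ads _ _ ys zs yz).
Qed.

(** The colour is picked from the set of colours present, which [rotate] preserves, so that the
    label is equivariant. The default 0 is reached only on the empty sequence. *)
Definition label s : 'F_p :=
  if [pick c | has (fun y => y.1 == c) s] is Some c then
    if [pick l | (c, l) \in s] is Some l then l else 0
  else 0.

Lemma eq_label s t : s =i t -> label s = label t.
Proof.
move=> st; rewrite /label (eq_pick (fun c => eq_has_r st (fun y => y.1 == c))).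
by case: pickP => // c _; rewrite (eq_pick (fun l => st (c, l))).
Qed.

Lemma label_rotate s : s != [::] -> admissible s ->
  label (map rotate s) = label s + 1.
Proof.
move=> s0 /admissibleP ads.
have lab t c l : {in t &, forall y z, y.1 = z.1 -> y = z} -> (c, l) \in t ->
    [pick l | (c, l) \in t] = Some l.
  move=> adt clt; case: pickP => [m cmt|/(_ l)]; last by rewrite clt.
  by have [->] := adt _ _ cmt clt erefl.
have -> : label (map rotate s) =
    if [pick c | has (fun y => y.1 == c) s] is Some c then
    if [pick l | (c, l) \in map rotate s] is Some l then l else 0 else 0.
  rewrite /label; congr (if _ is Some c then _ else _).
  by apply: eq_pick => c; rewrite has_map.
rewrite /label; case: pickP => [c /hasP[[c' l] cls /= /eqP cc]|none]; last first.
  by case: s s0 none {ads} => // y s _ /(_ y.1) /=; rewrite eqxx.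
rewrite {c'}cc in cls.
have adsh : admissible (map rotate s).
  by apply: admissible_map => //; [move=> y z /= ->|apply/admissibleP].
rewrite (lab s c l) // (lab _ c (l + 1)) //; first exact/admissibleP.
by apply/mapP; exists (c, l).
Qed.

(* The label trivializes the action of Z/p on the non-empty admissible sequences,
   whence an explicit preimage of psi under the norm or the difference. *)
Definition solve (b : bool) psi n s : 'F_p :=
  if (size s == n) && admissible s then
    if b then (label s == 0)%:R * psi s
    else \sum_(j < label s) psi (map (iter j rotate) (map (translate (label s)) s))
  else 0.

Lemma alternating_solve b psi n : alternating psi -> alternating (solve b psi n).
Proof.
move=> altpsi s x y t; rewrite /solve !size_cat /=.
have st : s ++ x :: y :: t =i s ++ y :: x :: t.
  by move=> z; rewrite !(mem_cat, in_cons); case: (z == x); case: (z == y).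
have -> : admissible (s ++ y :: x :: t) = admissible (s ++ x :: y :: t).
  by apply/idP/idP; apply: sub_admissible => z; rewrite st.
case: ifP => _; last by rewrite oppr0.
rewrite (eq_label st); case: b; first by rewrite altpsi mulrN.
rewrite -sumrN; apply: eq_bigr => j _.
by rewrite !map_cat /= altpsi.
Qed.

Lemma admissible_iter i s : admissible s -> admissible (map (iter i rotate) s).
Proof.
by apply: admissible_map => [y|y z yz]; rewrite !iter_rotate //= yz.
Qed.

Lemma label_iter i s : s != [::] -> admissible s ->
  label (map (iter i rotate) s) = label s + i%:R.
Proof.
move=> s0 ads; elim: i => [|i IH]; first by rewrite map_id addr0.
rewrite -natr1 addrA -IH -label_rotate ?admissible_iter //; last first.
  by rewrite -size_eq0 size_map size_eq0.
by rewrite -map_comp.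
Qed.

(** For the norm, [psi] is invariant and exactly one rotate of [s] has label 0. For the difference,
    the partial sums of [psi] along the orbit, begun at the rotate of label 0, have [psi] as
    successive differences; the passage from label p - 1 back to 0 is consistent because the sum
    over the whole orbit vanishes. *)
Lemma solveE b psi n s : (0 < n)%N -> size s = n -> admissible s ->
  (forall t, size t = n -> admissible t -> norm_diff p rotate (~~ b) psi t = 0) ->
  norm_diff p rotate b (solve b psi n) s = psi s.
Proof.
move=> n0 sn ads h.
have s0 : s != [::] by rewrite -size_eq0 sn -lt0n.
have solve_iter i : solve b psi n (map (iter i rotate) s) =
    if b then (label s + i%:R == 0)%:R * psi (map (iter i rotate) s) else
    \sum_(j < (label s + i%:R)%R)
      psi (map (iter j rotate) (map (translate (label s)) s)).
  rewrite /solve size_map sn eqxx admissible_iter //= label_iter //.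
  case: b {h} => //; apply: eq_bigr => j _; congr (psi (map _ _)).
  rewrite -map_comp; apply: eq_map => y; rewrite /= iter_rotate /translate /=.
  by congr pair; ring.
case: b h solve_iter => h solve_iter; rewrite {1}/norm_diff.
  have inv i : psi (map (iter i rotate) s) = psi s.
    elim: i => [|i IH]; first by rewrite map_id.
    rewrite -IH; apply/eqP; rewrite -subr_eq0.
    have /= := h (map (iter i rotate) s).
    by rewrite size_map admissible_iter // /norm_diff -map_comp => ->.
  under eq_bigr do rewrite solve_iter inv.
  rewrite -big_distrl /= (big_Fp (fun i => (label s + i%:R == 0)%:R)) //.
  rewrite (eq_bigr (fun x => (label s + x == 0)%:R)) => [|x _]; last first.
    by congr ((label s + _ == 0)%:R); exact: natr_Zp.
  rewrite (bigD1 (- label s)) //= subrr eqxx big1 ?addr0 ?mul1r // => x.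
  by rewrite eq_sym eqr_oppLR -addr_eq0 => /negPf ->.
have := solve_iter 0%N; rewrite map_id mulr0n addr0 => ->.
have -> : solve false psi n (map rotate s) = \sum_(j < (label s + 1)%R)
    psi (map (iter j rotate) (map (translate (label s)) s)) by exact: (solve_iter 1%N).
set s' := map _ s; set r := label s.
have rE : ((label s)%:R : 'F_p) = label s by exact: natr_Zp.
have last : psi (map (iter r rotate) s') = psi s.
  rewrite /s' -map_comp; congr psi; rewrite -[RHS]map_id; apply: eq_map => y /=.
  by rewrite iter_rotate /= rE subrK; case: y.
have sums : \sum_(j < p) psi (map (iter j rotate) s') = 0.
  have /= := h s'; rewrite /norm_diff; apply; first by rewrite size_map.
  by apply: admissible_map ads => // y z /= ->.
have rp : (r < p)%N by rewrite -[X in (_ < X)%N](Fp_cast p_pr).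
have r1 : (r + 1 : 'F_p) = (r.+1 %% p)%N :> nat.
  by rewrite -(val_Fp_nat p_pr) -natr1 rE.
rewrite r1; move: rp; rewrite leq_eqVlt => /orP[/eqP rp|rp].
  have recr q m (F : nat -> 'F_p) : m.+1 = q ->
    \sum_(j < q) F j = \sum_(j < m) F j + F m by move=> <-; rewrite big_ord_recr.
  rewrite rp modnn big_ord0 sub0r -last; apply/eqP; rewrite eq_sym -addr_eq0 addrC.
  by rewrite -(recr _ _ (fun j => psi (map (iter j rotate) s')) rp) sums.
by rewrite modn_small // big_ord_recr /= last addrAC subrr add0r.
Qed.

(** From the augmentation on, each coboundary is divided alternately by the norm and by the
    difference. *)
Fixpoint colour_cochain k : seq Y -> 'F_p :=
  if k is k'.+1 then solve (~~ odd k') (cobound (colour_cochain k')) k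
  else fun s => (s == [::])%:R.

Lemma alternating_colour_cochain k : alternating (colour_cochain k).
Proof.
elim: k => [|k IH] /=; first by case=> [|z s] x y t /=; rewrite oppr0.
exact/alternating_solve/alternating_cobound.
Qed.

Lemma colour_cochain_size k s : size s != k -> colour_cochain k s = 0.
Proof.
case: k => [|k] sk /=; first by rewrite -size_eq0 (negPf sk).
by rewrite /solve (negPf sk).
Qed.

(** [solveE] asks that the opposite operator kill the coboundary. It commutes with [cobound], so by
    induction it produces the coboundary of a coboundary. *)
Lemma cobound_colour_cochain k s : size s = k.+1 -> admissible s ->
  cobound (colour_cochain k) s =
  norm_diff p rotate (~~ odd k) (colour_cochain k.+1) s.
Proof.
elim: k s => [|k IH] s sk ads; symmetry; apply: solveE => // t st adt.
  case: t st {adt} => [//|x [|y t]] //= _; rewrite /norm_diff /=; ring.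
rewrite negbK -cobound_norm_diff -[RHS](cobound_cobound (colour_cochain k) t).
apply: eq_cobound => u su ut; rewrite IH //; last exact: sub_admissible adt.
by move: su; rewrite st => -[].
Qed.

(** An admissible sequence longer than the number of colours repeats a vertex, where an alternating
    cochain vanishes: 2 is invertible mod the odd prime [p]. *)
Lemma colour_cochain_eq0 k s : (#|C| < k)%N -> admissible s ->
  colour_cochain k s = 0.
Proof.
move=> Ck /admissibleP ads; have [sk|/colour_cochain_size//] := eqVneq (size s) k.
have two x : x + x = 0 -> x = 0 :> 'F_p.
  move/eqP; rewrite -mulr2n -mulr_natl mulf_eq0 => /orP[|/eqP//].
  rewrite -(dvdn_pcharf (pchar_Fp p_pr)) dvdn_prime2 // => /eqP pE.
  by have : odd 2 by rewrite -pE.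
apply: (alternating_dup two (@alternating_colour_cochain k)).
apply: contraTN Ck => us; rewrite -leqNgt -sk -(size_map fst).
rewrite -(card_uniqP _) ?max_card // map_inj_in_uniq // => y z ys zs; exact: ads.
Qed.
End Colours.

(** * Uniform estimates on bounded closed sets *)

Section Compactness.
Local Open Scope classical_set_scope.
Variables (R : realType) (n : nat).
Let V := 'rV[R]_n.

Lemma compact_closed_ball (X : set V) (r : R) : closed X ->
  compact [set x | X x /\ `|x| <= r].
Proof.
move=> cX; apply: bounded_closed_compact.
  by exists r; split; [exact: num_real | move=> y ry x [_ xr]; exact: le_trans xr (ltW ry)].
rewrite (_ : mkset _ = X `&` (fun x : V => `|x|) @^-1` [set y | y <= r]) //.
apply: closedI => //; apply: closed_comp; last exact: closed_le.
by move=> x _; exact: norm_continuous.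
Qed.

Lemma uniform_continuity (W : normedModType R) (f : V -> W) r : continuous f ->
  forall e, 0 < e -> exists2 d, 0 < d &
    forall x y, `|x| <= r -> `|x - y| < d -> `|f x - f y| < e.
Proof.
move=> cf e e0.
(* Covers are indexed by the filter of small [d] > 0: what holds near each point for all small [d]
   holds on the whole compact set for all small [d]. *)
have /compact_near_coveringP/(_ _ (0^'+ : set_system R)) := @compact_closed_ball setT r closedT.
move=> /(_ (fun d x => forall y, `|x - y| < d -> `|f x - f y| < e)) [].
  move=> x _.
  have /cvgrPdist_lt/(_ (e / 2)) := cf x.
  rewrite divr_gt0 // => /(_ isT)/nbhs_ballP[d /= d0 hd].
  exists (ball x (d / 2), [set t | 0 < t < d / 2]).
    split; first by apply: nbhsx_ballx; rewrite divr_gt0.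
    near=> t; apply/andP; split => //=.
    by near: t; apply: nbhs_right_lt; rewrite divr_gt0.
  move=> [x' t] /= [xx' /andP[t0 td]] y x'y.
  move: xx'; rewrite -ball_normE /= => xx'.
  have h1 : `|f x - f x'| < e / 2.
    by apply: hd; rewrite -ball_normE /=; apply: lt_trans xx' _; lra.
  have h2 : `|f x - f y| < e / 2.
    apply: hd; rewrite -ball_normE /= (_ : x - y = (x - x') + (x' - y)); last first.
      by rewrite addrA subrK.
    apply: le_lt_trans (ler_normD _ _) _; lra.
  rewrite (_ : f x' - f y = - (f x - f x') + (f x - f y)); last first.
    by rewrite opprB addrA subrK.
  apply: le_lt_trans (ler_normD _ _) _; rewrite normrN; lra.
move=> d /= d0 hd.
exists (d / 2); first by rewrite divr_gt0.
move=> x y xr xy.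
apply: (hd (d / 2)) => //=.
- rewrite sub0r normrN gtr0_norm ?divr_gt0 //; lra.
- by rewrite divr_gt0.
Unshelve. all: by end_near.
Qed.

Lemma bounded_on_ball (f : V -> V) r : continuous f ->
  exists r', forall x, `|x| <= r -> `|f x| <= r'.
Proof.
move=> cf.
have [M [_ hM]] : bounded_set (f @` [set x | setT x /\ `|x| <= r]).
  apply: compact_bounded; apply: continuous_compact; last exact: compact_closed_ball closedT.
  exact: continuous_subspaceT.
exists (M + 1) => x xr; apply: (hM (M + 1)); first by rewrite ltrDl.
by exists x.
Qed.

End Compactness.

(** * Acyclicity at small scales *)

Section ProAcyclic.
Local Open Scope classical_set_scope.
Variables (R : realType) (n : nat) (A : comNzRingType).
Let V := 'rV[R]_n.
Implicit Types (X : set V) (s t : seq V) (f g : seq V -> A).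

Definition small X r e s :=
  (forall x, x \in s -> X x /\ `|x| <= r) /\
  (forall x y, x \in s -> y \in s -> `|x - y| < e).

(* Vanishing of the reduced Alexander-Spanier cohomology in degree m - 1, as a
   statement on the inverse system of bounded parts and small scales. *)
Definition pro_acyclic X := forall m r, exists r', forall e, 0 < e ->
  exists2 d, 0 < d & forall f,
    (forall s, size s = m.+1 -> small X r' e s -> cobound f s = 0) ->
    exists g, forall s, size s = m -> small X r d s -> f s = cobound g s.

Lemma sub_small X r e r' e' s t : r <= r' -> e <= e' -> {subset t <= s} ->
  small X r e s -> small X r' e' t.
Proof.
move=> rr' ee' ts [sX se]; split=> [x /ts/sX[Xx xr]|x y /ts xs /ts ys].
  by split => //; exact: le_trans xr rr'.
exact: lt_le_trans (se _ _ xs ys) ee'.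
Qed.

(** The ball is shrunk to 0 in N + 1 steps that move points by less than e / 2, so every prism stays
    at scale [e] and each step changes [f] by a coboundary. The last map is constant, and the cone
    with apex 0 finishes. *)
Lemma pro_acyclic_setT : pro_acyclic setT.
Proof.
(* The absolute value keeps the apex 0 within the radius even when [r] is negative, a case in which
   the empty sequence is still small. *)
move=> m r; exists `|r| => e e0; exists (e / 2); first by rewrite divr_gt0.
move=> f fc.
have [N rN] : exists N, `|r| < (e / 2) * N.+1%:R.
  exists (Num.bound (`|r| / (e / 2))); rewrite mulrC -ltr_pdivrMr ?divr_gt0 //.
  apply: lt_le_trans (archi_boundP _) _; first by rewrite divr_ge0 // divr_ge0 // ltW.
  by rewrite ler_nat.
pose h i (x : V) := (1 - i%:R / N.+1%:R) *: x.
have hr i x : (i <= N.+1)%N -> `|x| <= r -> `|h i x| <= `|r|.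
  move=> iN xr; rewrite normrZ; apply: le_trans (_ : 1 * `|x| <= _).
    apply: ler_wpM2r => //; rewrite ger0_norm ?subr_ge0 ?gerBl ?divr_ge0 //.
    by rewrite ler_pdivrMr ?ltr0n // mul1r ler_nat.
  by rewrite mul1r; apply: le_trans xr (ler_norm _).
have hh i x y : (i <= N)%N -> `|x| <= r -> `|y| <= r -> `|x - y| < e / 2 ->
    [/\ `|h i x - h i y| < e, `|h i.+1 x - h i.+1 y| < e & `|h i x - h i.+1 y| < e].
  move=> iN xr yr xy.
  have coef j : (j <= N.+1)%N -> `|1 - j%:R / N.+1%:R : R| <= 1.
    move=> jN; rewrite ger0_norm ?subr_ge0 ?gerBl ?divr_ge0 //.
    by rewrite ler_pdivrMr ?ltr0n // mul1r ler_nat.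
  have contracts j : (j <= N.+1)%N -> `|h j x - h j y| < e / 2.
    move=> jN; rewrite -scalerBr normrZ; apply: le_lt_trans xy.
    by rewrite -[leRHS]mul1r ler_wpM2r // coef.
  have step : `|h i y - h i.+1 y| < e / 2.
    rewrite -scalerBl (_ : _ - _ = N.+1%:R^-1); last first.
      have F (a u : R) : u != 0 -> 1 - a / u - (1 - (a + 1) / u) = u^-1 by move=> u0; field.
      by rewrite -[i.+1%:R]natr1 F // pnatr_eq0.
    rewrite normrZ gtr0_norm ?invr_gt0 // mulrC ltr_pdivrMr //.
    by apply: le_lt_trans rN; exact: le_trans yr (ler_norm _).
  have e2 : e / 2 < e by lra.
  split; [exact: lt_trans (contracts _ (leqW iN)) e2 | exact: lt_trans (contracts i.+1 iN) e2 |].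
  rewrite -[_ - _](subrKA (h i y)); apply: le_lt_trans (ler_normD _ _) _.
  by have := contracts _ (leqW iN); lra.
suff contr i : (i <= N.+1)%N -> exists g, forall s, size s = m ->
    small setT r (e / 2) s -> f s = f (map (h i) s) + cobound g s.
  have [g hg] := contr N.+1 (leqnn _).
  exists (fun t => f (0 :: map (h N.+1) t) + g t) => s sm ss.
  rewrite coboundD (cobound_map (h N.+1) (fun t => f (0 :: t))) hg //.
  congr (_ + _); apply/eqP; rewrite -subr_eq0; apply/eqP.
  have := fc (0 :: map (h N.+1) s); rewrite /= size_map sm; apply => //.
  have h0 x : h N.+1 x = 0 by rewrite /h divff ?subrr ?scale0r // pnatr_eq0.
  split=> [x|x y]; rewrite !in_cons.
    move=> xs; split => //; case/orP: xs => [/eqP ->|/mapP[y _ ->]]; by rewrite ?h0 normr0.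
  move=> xs ys; have x0 : x = 0 by case/orP: xs => [/eqP ->//|/mapP[z _ ->]].
  have y0 : y = 0 by case/orP: ys => [/eqP ->//|/mapP[z _ ->]].
  by rewrite x0 y0 subrr normr0.
elim: i => [_|i IH iN].
  exists (fun=> 0) => s _ _; rewrite cobound0 addr0; congr f.
  by rewrite -[LHS]map_id; apply: eq_map => x; rewrite /h mul0r subr0 scale1r.
have [g hg] := IH (ltnW iN).
exists (fun t => g t - prism (h i) (h i.+1) f t) => s sm ss.
rewrite coboundB hg //.
have := prism_homotopy (h i) (h i.+1) f s.
have -> : prism (h i) (h i.+1) (cobound f) s = 0.
  rewrite -(prism0 A (h i) (h i.+1) s); apply: eq_prism => t st ts.
  apply: fc; first by rewrite st sm.
  have [ssX sse] := ss.
  split=> [x /ts|x y /ts + /ts].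
    by rewrite mem_cat => /orP[] /mapP[y /ssX[_ yr] ->]; split => //; apply: hr => //; exact: ltnW.
  rewrite !mem_cat => /orP[] /mapP[x' xs ->] /orP[] /mapP[y' ys ->];
    have [] := hh i x' y' iN (ssX _ xs).2 (ssX _ ys).2 (sse _ _ xs ys) => //.
  have [_ _ +] := hh i y' x' iN (ssX _ ys).2 (ssX _ xs).2 (sse _ _ ys xs).
  by rewrite distrC.
rewrite addr0 => ->; ring.
Qed.

End ProAcyclic.

(** * Orbits of a map of period p, and the zigzag argument *)

Section Orbits.
Local Open Scope classical_set_scope.
Variables (R : realType) (n p : nat) (sigma : 'rV[R]_n -> 'rV[R]_n).
Let V := 'rV[R]_n.
Hypotheses (sigma_cont : continuous sigma) (sigma_p : iter p sigma =1 id) (p_gt0 : (0 < p)%N).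

Lemma iter_mod i x : iter (i %% p) sigma x = iter i sigma x.
Proof.
rewrite [in RHS](divn_eq i p) addnC iterD; congr iter.
by elim: (i %/ p)%N => // q IH; rewrite mulSn iterD -IH sigma_p.
Qed.

Lemma iter_cont i : continuous (iter i sigma).
Proof.
elim: i => [|i IH] x; first exact: cvg_id.
have -> : iter i.+1 sigma = sigma \o iter i sigma by [].
by apply: continuous_comp; [exact: IH | exact: sigma_cont].
Qed.

Lemma orbit_bound r : exists r', forall x i, `|x| <= r -> `|iter i sigma x| <= r'.
Proof.
have bound k : exists r', forall x i, (i < k)%N -> `|x| <= r -> `|iter i sigma x| <= r'.
  elim: k => [|k [r1 h1]]; first by exists 0.
  have [r2 h2] := bounded_on_ball r (@iter_cont k).
  exists (Num.max r1 r2) => x i; rewrite ltnS leq_eqVlt le_max => /orP[/eqP ->|ik] xr.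
    by rewrite h2 // orbT.
  by rewrite h1.
have [r' h] := bound p; exists r' => x i xr.
by rewrite -iter_mod h // ltn_mod.
Qed.

Lemma orbit_uniform_continuity r e : 0 < e -> exists2 d, 0 < d &
  forall x y i, `|x| <= r -> `|x - y| < d -> `|iter i sigma x - iter i sigma y| < e.
Proof.
move=> e0.
have bound k : exists2 d, 0 < d & forall x y i, (i < k)%N ->
    `|x| <= r -> `|x - y| < d -> `|iter i sigma x - iter i sigma y| < e.
  elim: k => [|k [d1 d10 h1]]; first by exists 1.
  have [d2 d20 h2] := uniform_continuity r (@iter_cont k) e0.
  exists (Num.min d1 d2); first by rewrite lt_min d10.
  move=> x y i; rewrite ltnS leq_eqVlt lt_min => /orP[/eqP ->|ik] xr /andP[xy1 xy2].
    exact: h2.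
  exact: h1.
have [d d0 h] := bound p; exists d => // x y i xr xy.
by rewrite -!(iter_mod i) h // ltn_mod.
Qed.

Section Descent.
Variables (A : comNzRingType) (X : set V).
Hypotheses (sigmaX : forall x, X x -> X (sigma x)) (acX : pro_acyclic A X).

Lemma iterX i x : X x -> X (iter i sigma x).
Proof. by elim: i => //= i IH /IH/sigmaX. Qed.

(** Zigzag by induction on [j]. Let D and D' be [norm_diff] at [b] and [~~ b]. Once a_1 = D' g1 + d
    h1, the cochain a_0 - D h1 is a cocycle because D D' = 0, hence a coboundary since [X] is
    acyclic. *)
Lemma descent j m r : exists R', forall e, 0 < e -> exists2 d, 0 < d &
  forall b (a : nat -> seq V -> A),
    (forall i s, (i < j)%N -> size s = (m + i).+1 -> small X R' e s ->
      cobound (a i) s = norm_diff p sigma (b (+) odd i) (a i.+1) s) ->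
    (forall s, size s = (m + j)%N -> small X R' e s -> a j s = 0) ->
  exists g h, forall s, size s = m -> small X r d s ->
    a 0%N s = norm_diff p sigma b g s + cobound h s.
Proof.
elim: j m r => [|j IH] m r.
  exists r => e e0; exists e => // b a _ a0; exists (fun=> 0), (fun=> 0) => s sm ss.
  rewrite a0 ?addn0 // cobound0 addr0 /norm_diff.
  by case: b; rewrite ?subrr // big1.
have [r' hr'] := acX m r.
(* [norm_diff] evaluates cochains on whole orbits, so the induction hypothesis is used at a radius
   containing the orbits of the ball of radius [r']; [d2] below does the same for the scale. *)
have [r1 hr1] := orbit_bound r'.
have [R1 hR1] := IH m.+1 r1.
exists (Num.max R1 r') => e e0.
have [d1 d10 hd1] := hR1 e e0.
have [d2 d20 hd2] := orbit_uniform_continuity r' d10.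
have e'0 : 0 < Num.min e d2 by rewrite lt_min e0.
have [d d0 hd] := hr' _ e'0.
exists d => // b a acob aj.
have [||g1 [h1 gh1]] := hd1 (~~ b) (fun i => a i.+1).
- move=> i s ij si ss; rewrite acob ?addnS //=.
    by congr (norm_diff _ _ _ _ _); case: (b); case: (odd i).
  by apply: sub_small ss; rewrite ?le_max ?lexx.
- move=> s sj ss; apply: aj; first by rewrite addnS.
  by apply: sub_small ss; rewrite ?le_max ?lexx.
have [|g hg] := hd (fun t => a 0%N t - norm_diff p sigma b h1 t).
  move=> s sm ss; rewrite coboundB cobound_norm_diff acob ?addn0 //; last first.
    by apply: sub_small ss; rewrite ?le_max ?ge_min ?lexx ?orbT.
  rewrite addbF -norm_diffB -[RHS](norm_diff_comp (p := p) (h := sigma) b g1 s) //.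
  apply: eq_norm_diff => i; apply/eqP; rewrite subr_eq; apply/eqP.
  have [sX se] := ss.
  apply: gh1; first by rewrite size_map.
  split=> [_ /mapP[x xs ->]|_ _ /mapP[x xs ->] /mapP[y ys ->]].
    by have [Xx xr] := sX _ xs; split; [exact: iterX | exact: hr1].
  apply: hd2; first by case: (sX _ xs).
  by have := se _ _ xs ys; rewrite lt_min => /andP[].
exists h1, g => s sm ss.
by rewrite -hg // addrC subrK.
Qed.
End Descent.
End Orbits.

(** * Smith theory *)

(** Pigeonhole: above the minimum [a m] there are p consecutive half-open intervals of length eta /
    p, but at most p - 1 values to fill them, as [a m] lies in none. An empty interval separates the
    values above it from the others. *)
Lemma gap_exists (R : realFieldType) (p : nat) (a : 'F_p -> R) (eta : R) (i0 j0 : 'F_p) :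
  prime p -> 0 < eta -> a j0 + eta <= a i0 ->
  exists S : {set 'F_p}, [/\ i0 \in S, S != [set: 'F_p] &
    forall i j, i \in S -> j \notin S -> a j + eta / p%:R <= a i].
Proof.
move=> p_pr eta0 ij.
have p0 : 0 < p%:R :> R by rewrite ltr0n prime_gt0.
case: (@Order.TotalTheory.arg_minP _ _ _ j0 xpredT a isT) => m _ am.
pose t (j : nat) := a m + j%:R * (eta / p%:R).
have tS j : t j.+1 = t j + eta / p%:R by rewrite /t -natr1 mulrDl mul1r addrA.
have t_mono i j : (i <= j)%N -> t i <= t j.
  by move=> le_ij; rewrite lerD2l ler_wpM2r ?ler_nat // divr_ge0 // ltW.
have [j hj] : exists j : 'F_p, forall i, ~~ (t j < a i <= t j.+1).
  apply: contrapT => /forallNP none.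
  have /choice[g hg] : forall j : 'F_p, exists i, t j < a i <= t j.+1.
    by move=> j; have /existsNP[i /negP/negPn] := none j; exists i.
  have g_inj : injective g.
    move=> j j' gjj'; have := hg j; have := hg j'; rewrite gjj' => /andP[h1 h2] /andP[h3 h4].
    apply/val_inj/eqP; rewrite eqn_leq /=; apply/andP; split; rewrite leqNgt; apply/negP => jj'.
      by have := le_lt_trans (le_trans h2 (t_mono _ _ jj')) h3; rewrite ltxx.
    by have := le_lt_trans (le_trans h4 (t_mono _ _ jj')) h1; rewrite ltxx.
  have [g' _ g'K] := injF_bij g_inj.
  have := hg (g' m); rewrite g'K => /andP[+ _].
  by rewrite ltNge => /negP; apply; have := t_mono 0%N (g' m) isT; rewrite /t mul0r addr0.
have jp : (j < p)%N by rewrite -[X in (_ < X)%N](Fp_cast p_pr).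
have above i : t j < a i -> t j.+1 < a i.
  by move=> h; have := hj i; rewrite h /= -ltNge.
exists [set i | t j.+1 < a i]%SET; split.
- rewrite inE; apply: above; apply: lt_le_trans ij.
  apply: lt_le_trans (_ : a m + eta <= _); last by rewrite lerD2r am.
  rewrite /t ltrD2l mulrCA -[ltRHS]mulr1 ltr_pM2l //.
  by rewrite ltr_pdivrMr // mul1r ltr_nat.
- apply/eqP => /setP/(_ m); rewrite !inE ltNge => /negP; apply.
  by have := t_mono 0%N j.+1 isT; rewrite /t mul0r addr0.
- move=> i i'; rewrite !inE -!leNgt => ai ai'.
  apply: le_trans (ltW ai); rewrite tS lerD2r leNgt.
  by apply/negP => /above; rewrite ltNge ai'.
Qed.

Lemma norm_coord (R : realType) n (x : 'rV[R]_n) l : `|x 0 l| <= `|x|.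
Proof.
by rewrite [leRHS]/Num.norm /= mx_normrE; apply/bigmax_geP; right => /=; exists (0, l).
Qed.

Lemma norm_coord_attained (R : realType) n (x : 'rV[R]_n) : x != 0 -> exists l, `|x| = `|x 0 l|.
Proof.
rewrite -normr_eq0 => /mx_norm_neq0[[i l] /= xl]; exists l.
by rewrite {1}/Num.norm /= xl (ord1 i).
Qed.

(** * Equivariant colours of the points that are moved *)

Section Colouring.
Variables (R : realType) (n p : nat) (sigma : 'rV[R]_n -> 'rV[R]_n) (gamma : R).
Let V := 'rV[R]_n.
Hypotheses (p_pr : prime p) (sigma_p : iter p sigma =1 id) (gamma0 : 0 < gamma).
Implicit Types (x y : V) (S : {set 'F_p}) (l : 'I_n).

Definition orbit_coord x l (i : 'F_p) : R := (iter i sigma x) 0 l.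

Definition gap x l S := forall i j, i \in S -> j \notin S ->
  orbit_coord x l j + gamma <= orbit_coord x l i.

(** The colour records the size of [S] only: the size is constant along the orbit while [S] is
    translated, and yet coordinate and size determine [S], by [gap_near_eq]. There are thus finitely
    many colours, whatever the scale. *)
Definition has_colour x (c : 'I_n * 'I_p) :=
  exists S, [/\ #|S| = c.2, (0 < c.2)%N & gap x c.1 S].

Definition colour x := [pick c | `[< has_colour x c >]].

Definition colour_set x : {set 'F_p} :=
  if colour x is Some c
  then odflt finset.set0 [pick S : {set 'F_p} | `[< #|S| = c.2 /\ gap x c.1 S >]]
  else finset.set0.

(* Moving S by 1 adds #|S| to the sum of its elements, so this label is
   equivariant; #|S| is invertible because S is proper and non-empty. *)
Definition colour_label x : 'F_p := - (\sum_(i in colour_set x) i) / #|colour_set x|%:R.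

Definition vertex x := (colour x, colour_label x).

Lemma orbit_coord_sigma x l i : orbit_coord (sigma x) l i = orbit_coord x l (i + 1).
Proof.
rewrite /orbit_coord -iterSr; congr (fun_of_matrix _ 0 l).
have -> : (i + 1 : 'F_p) = (i.+1)%:R by rewrite -natr1 natr_Zp.
by rewrite val_Fp_nat // iter_mod.
Qed.

Lemma gap_sigma x l S : gap x l S -> gap (sigma x) l [set i | i + 1 \in S].
Proof. by move=> g i j; rewrite !inE !orbit_coord_sigma => iS jS; exact: g. Qed.

Lemma card_translate S : #|[set i | i + 1 \in S]| = #|S|.
Proof.
rewrite (_ : [set i | i + 1 \in S] = [set i - 1 | i in S])%SET.
  by rewrite card_imset //; exact: addIr.
apply/setP => i; rewrite inE; apply/idP/imsetP => [iS|[j jS ->]]; last by rewrite subrK.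
by exists (i + 1); rewrite ?addrK.
Qed.

Lemma has_colour_sigma x c : has_colour (sigma x) c <-> has_colour x c.
Proof.
have dir y : has_colour y c -> has_colour (sigma y) c.
  move=> [S [Sc c0 g]]; exists [set i | i + 1 \in S].
  by rewrite card_translate; split => //; exact: gap_sigma.
split; last exact: dir.
have dirs k y : has_colour y c -> has_colour (iter k sigma y) c.
  by elim: k => //= k IH /IH /dir.
move/(dirs p.-1); rewrite -iterSr prednK ?prime_gt0 //.
by rewrite sigma_p.
Qed.

Lemma colour_sigma x : colour (sigma x) = colour x.
Proof.
apply: eq_pick => c; apply/asboolP/asboolP => /has_colour_sigma //.
Qed.

(** Distinct sets of equal size each contain a time missing from the other. At these two times the
    gaps at [x] and at [y] have opposite directions, which coordinates closer than gamma / 2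
    exclude. *)
Lemma gap_near_eq x y l S (T : {set _}) :
  (forall i : 'F_p, `|orbit_coord x l i - orbit_coord y l i| < gamma / 2) ->
  #|S| = #|T| -> gap x l S -> gap y l T -> S = T.
Proof.
move=> xy cST gS gT; apply/eqP; rewrite eqEcard cST leqnn andbT.
apply/fintype.subsetP => i iS; apply/negPn/negP => iT.
have /subsetPn[j jT jS] : ~~ (T \subset S).
  apply/negP => TS; have TS' : T == S by rewrite eqEcard TS cST leqnn.
  by move: iT; rewrite (eqP TS') iS.
have := gS _ _ iS jS; have := gT _ _ jT iT.
have := xy i; have := xy j; rewrite !ltr_norml; lra.
Qed.

Lemma colour_setP x c : colour x = Some c ->
  [/\ #|colour_set x| = c.2, (0 < c.2)%N & gap x c.1 (colour_set x)].
Proof.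
move=> xc; rewrite /colour_set xc; move: xc; rewrite /colour.
case: pickP => // c' /asboolP[S [Sc c0 g]] [cc]; rewrite -{c}cc.
by case: pickP => [T /asboolP[]|/(_ S)/asboolP[]].
Qed.

Lemma colour_set_sigma x : colour x != None ->
  colour_set (sigma x) = [set i | i + 1 \in colour_set x].
Proof.
case xc: (colour x) => [c|] // _.
have [Sc c0 g] := colour_setP xc.
have [|Sc' _ g'] := @colour_setP (sigma x) c; first by rewrite colour_sigma.
apply: (gap_near_eq _ _ g' (gap_sigma g)).
  by move=> i; rewrite subrr normr0 divr_gt0.
by rewrite card_translate Sc.
Qed.

Lemma vertex_sigma x : colour x != None -> vertex (sigma x) = rotate (vertex x).
Proof.
move=> xc; rewrite /vertex /rotate /= colour_sigma; congr pair.
rewrite /colour_label colour_set_sigma // card_translate.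
set S := colour_set x.
have S0 : #|S|%:R != 0 :> 'F_p.
  case xc': (colour x) xc => [c|] // _.
  have [Sc c0 g] := colour_setP xc'.
  rewrite -(dvdn_pcharf (pchar_Fp p_pr)) Sc; apply/negP => /(dvdn_leq c0).
  by rewrite leqNgt ltn_ord.
have -> : \sum_(i in [set i | i + 1 \in S]) i = \sum_(i in S) i - #|S|%:R.
  rewrite -sum1_card natr_sum -sumrB (reindex (fun i => i - 1)) /=; last first.
    by exists (fun i => i + 1) => i _; rewrite ?subrK ?addrK.
  by apply: eq_bigl => i; rewrite inE subrK.
by rewrite opprB mulrBl divff // mulNr addrC.
Qed.

Lemma vertex_near x y : (forall i, `|iter i sigma x - iter i sigma y| < gamma / 2) ->
  colour x = colour y -> vertex x = vertex y.
Proof.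
move=> xy cxy; rewrite /vertex cxy; congr pair.
case yc: (colour y) => [c|]; last by rewrite /colour_label /colour_set cxy yc.
suff -> : colour_label x = colour_label y by [].
rewrite yc in cxy; rewrite /colour_label.
have [Sx c0 gx] := colour_setP cxy; have [Sy _ gy] := colour_setP yc.
rewrite (gap_near_eq _ _ gx gy) ?Sx ?Sy // => i.
apply: le_lt_trans (xy i).
by rewrite /orbit_coord; have := norm_coord (iter i sigma x - iter i sigma y) c.1; rewrite !mxE.
Qed.

(** In the sup norm, two distant orbit points are equally distant in some coordinate, and p values
    spread over gamma p leave a gap [gamma]. *)
Lemma colour_exists x i j : gamma * p%:R <= `|iter i sigma x - iter j sigma x| ->
  colour x != None.
Proof.
move=> far; have p0 : 0 < p%:R :> R by rewrite ltr0n prime_gt0.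
have [l hl] : exists l, gamma * p%:R <= `|(iter i sigma x) 0 l - (iter j sigma x) 0 l|.
  have [|l hl] := norm_coord_attained (x := iter i sigma x - iter j sigma x).
    by rewrite -normr_gt0; apply: lt_le_trans far; rewrite mulr_gt0.
  by exists l; move: far; rewrite hl !mxE.
have iterE k : (iter k sigma x) 0 l = orbit_coord x l k%:R.
  by rewrite /orbit_coord val_Fp_nat // iter_mod.
have [i0 [j0 ij]] : exists i0 j0, orbit_coord x l j0 + gamma * p%:R <= orbit_coord x l i0.
  move: hl; rewrite !iterE; case: (leP (orbit_coord x l i%:R) (orbit_coord x l j%:R)) => h.
    by rewrite ler0_norm ?subr_le0 // => hl; exists j%:R, i%:R; lra.
  by rewrite gtr0_norm ?subr_gt0 // => hl; exists i%:R, j%:R; lra.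
have [|S [iS ST g]] := gap_exists p_pr _ ij; first by rewrite mulr_gt0.
have Sp : (#|S| < p)%N.
  rewrite -[X in (_ < X)%N](Fp_cast p_pr) -[X in (_ < X)%N]card_ord -cardsT.
  by apply: proper_card; rewrite properT.
rewrite /colour; case: pickP => // /(_ (l, Ordinal Sp))/asboolP[].
exists S; split => //=; first by apply/card_gt0P; exists i0.
by move=> i1 j1 i1S j1S; have := g _ _ i1S j1S; rewrite mulfK // gt_eqF.
Qed.
End Colouring.

Lemma star_near (X : eqType) (A : comNzRingType) (inner : pred X) (f a : seq X -> A) s :
  all inner s -> star inner f a s = f s * a [::].
Proof. by elim: s f => //= x s IH f /andP[-> /IH ->]. Qed.

Lemma star_map (X : eqType) (A : comNzRingType) (inner : pred X) (h : X -> X)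
    (f a : seq X -> A) s : (forall x, inner (h x) = inner x) ->
  star inner f a (map h s) = star_sign A inner s *
    (f (map h (seq.filter inner s)) * a (map h (seq.filter (predC inner) s))).
Proof.
move=> nh; rewrite starE !seq.filter_map.
rewrite (eq_filter (a2 := inner)) ?(eq_filter (a1 := preim h (predC inner)) (a2 := predC inner)) //.
  congr (_ * _); elim: s => //= x s ->.
  by rewrite nh count_map (eq_count (a2 := inner)).
by move=> x /=; rewrite nh.
Qed.

Lemma cobound_iter_twist (X : eqType) (A : comNzRingType) k (f : seq X -> A) s :
  cobound f s = 0 -> cobound (iter k (@twist X A) f) s = 0.
Proof.
by elim: k => //= k IH /IH fs; rewrite cobound_twist /twist fs oppr0 if_same oppr0.
Qed.

Lemma iter_twist_eq0 (X : eqType) (A : comNzRingType) k (f : seq X -> A) s :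
  f s = 0 -> iter k (@twist X A) f s = 0.
Proof. by elim: k => //= k IH /IH fs; rewrite /twist fs oppr0 if_same. Qed.

Lemma lt_sum_thirds (R : realFieldType) (a b c d e : R) :
  a < d -> b < d -> c < d -> d <= e / 3 -> a + (b + c) < e.
Proof. by lra. Qed.

Section Smith.
Local Open Scope classical_set_scope.
Variables (R : realType) (n p : nat) (sigma : 'rV[R]_n -> 'rV[R]_n) (X : set 'rV[R]_n).
Let V := 'rV[R]_n.
Hypotheses (p_pr : prime p) (p_odd : odd p).
Hypotheses (sigma_cont : continuous sigma) (sigma_p : iter p sigma =1 id).
Hypotheses (closedX : closed X) (sigmaX : forall x, X x -> X (sigma x)).
Let F : set V := X `&` [set x | sigma x = x].

(** A fixed point is itself the required point for its neighbours; near a point that moves, the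
    displacement is bounded below. Compactness makes both uniform. *)
Lemma small_displacement r e : 0 < e -> exists2 eta, 0 < eta &
  forall x, X x -> `|x| <= r -> `|sigma x - x| < eta -> exists2 y, F y & `|x - y| < e.
Proof.
move=> e0.
have /compact_near_coveringP/(_ _ (0^'+ : set_system R)) := @compact_closed_ball R n X r closedX.
move=> /(_ (fun d x => X x -> `|sigma x - x| < d -> exists2 y, F y & `|x - y| < e)) [].
  move=> x [Xx xr]; have [sx|sx] := eqVneq (sigma x) x.
    exists (ball x e, setT); first by split; [apply: nbhsx_ballx | exact: filterT].
    move=> [y t] /= [xy _] _ _; exists x => //.
    by move: xy; rewrite -ball_normE /= distrC.
  pose u := `|sigma x - x|; have u0 : 0 < u by rewrite normr_gt0 subr_eq0.
  have cont : {for x, continuous (fun y : V => `|sigma y - y|)}.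
    apply: (@continuous_comp _ _ _ (fun y : V => sigma y - y) (fun z : V => `|z|)).
      by apply: continuousB; [exact: sigma_cont | exact: cvg_id].
    exact: norm_continuous.
  have /cvgrPdist_lt/(_ (u / 2)) := cont; rewrite divr_gt0 // => /(_ isT) near_x.
  exists ([set y | `|u - `|sigma y - y| | < u / 2], [set t | t < u / 2]).
    split; first exact: near_x.
    by near=> t => /=; near: t; apply: nbhs_right_lt; rewrite divr_gt0.
  move=> [y t] /= [uy tu] _ yt; move: uy; rewrite ltr_norml; lra.
move=> d /= d0 hd; exists (d / 2); first by rewrite divr_gt0.
move=> x Xx xr sx; apply: (hd (d / 2)) => //=.
- rewrite sub0r normrN gtr0_norm ?divr_gt0 //; lra.
- by rewrite divr_gt0.
Unshelve. all: by end_near.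
Qed.

Lemma iter_fixed i x : sigma x = x -> iter i sigma x = x.
Proof. by move=> sx; elim: i => //= i ->. Qed.

Definition nearly_fixed eta : pred V :=
  fun x => `[< forall i j, `|iter i sigma x - iter j sigma x| < eta >].

Lemma sigma_inv (P : V -> Prop) : (forall x, P x -> P (sigma x)) -> forall x, P (sigma x) -> P x.
Proof.
move=> PS x Px; have p0 := prime_gt0 p_pr.
rewrite -(sigma_p x) -(prednK p0) iterSr; elim: p.-1 => //= i IH; exact: PS.
Qed.

Lemma nearly_fixed_sigma eta x : nearly_fixed eta (sigma x) = nearly_fixed eta x.
Proof.
have dir y : (forall i j, `|iter i sigma y - iter j sigma y| < eta) ->
    forall i j, `|iter i sigma (sigma y) - iter j sigma (sigma y)| < eta.
  by move=> h i j; rewrite -!iterSr.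
by apply/asboolP/asboolP => [/(sigma_inv dir)|/dir].
Qed.

Lemma fixed_sigma x : F (sigma x) -> F x.
Proof. by apply: sigma_inv => y [Xy sy]; rewrite sy. Qed.

Definition close_fixed e x : set V := [set y | F y /\ forall i, `|iter i sigma x - y| < e].

(** [close_fixed] depends only on the orbit of [x], so the point chosen by [get] is the same along
    the orbit. No continuity is asked of [retr]: the cochains only see distances. *)
Definition retr e x : V := if `[< F x >] then x else get (close_fixed e x).

Lemma close_fixed_sigma e x : close_fixed e (sigma x) = close_fixed e x.
Proof.
apply/seteqP; split=> y [Fy h]; split => // i; last by rewrite -iterSr.
move: i; apply: (sigma_inv (P := fun x => forall i, `|iter i sigma x - y| < e)) h.
by move=> z hz i; rewrite -iterSr.
Qed.

Lemma retr_sigma e x : retr e (sigma x) = retr e x.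
Proof.
rewrite /retr; case: asboolP => [/fixed_sigma Fx|nF].
  by case: asboolP => // -[]; case: Fx.
case: asboolP => [[Xx sx]|_]; last by rewrite close_fixed_sigma.
by exfalso; apply: nF; rewrite sx.
Qed.

Lemma retrP e x : 0 < e -> close_fixed e x !=set0 -> F (retr e x) /\ `|x - retr e x| < e.
Proof.
move=> e0 [y hy]; rewrite /retr; case: asboolP => [Fx|_]; first by rewrite subrr normr0.
by have [Fg /(_ 0%N)] := getI hy.
Qed.

(** In the product a_k the nearly fixed vertices are read by [f] through [retr], the others by the
    k-th colour cochain through [vertex]. The first factor is invariant and the second equivariant,
    so d a_k is the norm or the difference of a_(k+1), and [descent] applies up to the number of
    colours. *)
Theorem smith : pro_acyclic 'F_p X -> pro_acyclic 'F_p F.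
Proof.
move=> acX m r; have p0 := prime_gt0 p_pr.
pose C : finType := option ('I_n * 'I_p).
have [R1 hR1] := descent sigma_cont sigma_p p0 sigmaX acX #|C|.+1 m r.
exists (R1 + 1) => e e0.
(* An edge shorter than [e1] whose ends move by less than [e1] stays shorter than 3 e1 <= e; the
   bound 1 on the motion explains the radius R1 + 1. *)
pose e1 := Num.min (e / 3) 1; have e10 : 0 < e1 by rewrite lt_min divr_gt0 ?ltr01.
have e12 : 0 < e1 / 2 by rewrite divr_gt0.
have e1e : e1 <= e / 3 by rewrite /e1 ge_min lexx.
have e11 : e1 <= 1 by rewrite /e1 ge_min lexx orbT.
have [eta0 eta00 heta] := small_displacement R1 e12.
(* A nearly fixed point is within e1 / 2 of a fixed point, and its orbit within e1 / 2 of itself: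
   the whole orbit is within [e1] of the fixed point. *)
pose eta := Num.min eta0 (e1 / 2); have eta_gt0 : 0 < eta by rewrite lt_min eta00.
have eta_le0 : eta <= eta0 by rewrite ge_min lexx.
have eta_le1 : eta <= e1 / 2 by rewrite ge_min lexx orbT.
pose gamma := eta / p%:R; have gamma0 : 0 < gamma by rewrite divr_gt0 ?ltr0n.
have [d2 d20 hd2] :=
  orbit_uniform_continuity sigma_cont sigma_p p0 R1 (divr_gt0 gamma0 (ltr0n _ 2)).
have e'0 : 0 < Num.min e1 d2 by rewrite lt_min e10.
have [d d0 hd] := hR1 _ e'0.
exists d => // f fc.
(* A simplex may split into inner and outer vertices in any proportion; [f0] retains the splits with
   [m] inner vertices. *)
pose f0 s := if size s == m then f (map (retr e1) s) else 0.
pose a k := star (nearly_fixed eta) (iter k (@twist V 'F_p) f0)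
  (fun s => colour_cochain k (map (vertex p sigma gamma) s)).
have near_iter i x : nearly_fixed eta (iter i sigma x) = nearly_fixed eta x.
  by elim: i => //= i <-; exact: nearly_fixed_sigma.
have far_colour x : ~~ nearly_fixed eta x -> colour p sigma gamma x != None.
  move=> /asboolP/existsNP[i /existsNP[j /negP]]; rewrite -leNgt => far.
  by apply: (@colour_exists _ _ _ _ _ p_pr sigma_p gamma0 x i j); rewrite divfK // pnatr_eq0 -lt0n.
have vertex_iter i x : ~~ nearly_fixed eta x ->
    vertex p sigma gamma (iter i sigma x) = iter i (@rotate p _) (vertex p sigma gamma x).
  move=> nx; elim: i => //= i IH; rewrite vertex_sigma ?IH // far_colour //.
  by rewrite near_iter.
have f0_iter i s : f0 (map (iter i sigma) s) = f0 s.
  rewrite /f0 size_map -map_comp; case: ifP => // _; congr f.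
  by apply: eq_map => x /=; elim: i => //= i <-; exact: retr_sigma.
have twist_iter k i s :
    iter k (@twist V 'F_p) f0 (map (iter i sigma) s) = iter k (@twist V 'F_p) f0 s.
  by elim: k => //= k IH; rewrite /twist size_map IH.
have adm s : small X R1 (Num.min e1 d2) s ->
    admissible (map (vertex p sigma gamma) (seq.filter (predC (nearly_fixed eta)) s)).
  move=> [sX se]; apply/admissibleP => _ _ /mapP[x + ->] /mapP[y + ->] xy.
  rewrite !mem_filter => /andP[_ xs] /andP[_ ys].
  apply: vertex_near => // i; apply: hd2; first by case: (sX _ xs).
  by have := se _ _ xs ys; rewrite lt_min => /andP[].
have a_iter k i s : a k (map (iter i sigma) s) =
    star_sign _ (nearly_fixed eta) s * iter k (@twist V 'F_p) f0 (seq.filter (nearly_fixed eta) s) *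
    colour_cochain k (map (iter i (@rotate p _))
      (map (vertex p sigma gamma) (seq.filter (predC (nearly_fixed eta)) s))).
  rewrite /a star_map // twist_iter mulrA; congr (_ * colour_cochain _ _).
  rewrite -!map_comp; apply/eq_in_map => x; rewrite mem_filter => /andP[nx _].
  exact: vertex_iter.
have aE k s : a k s =
    star_sign _ (nearly_fixed eta) s * iter k (@twist V 'F_p) f0 (seq.filter (nearly_fixed eta) s) *
    colour_cochain k (map (vertex p sigma gamma) (seq.filter (predC (nearly_fixed eta)) s)).
  by have := a_iter k 0%N s; rewrite !map_id.
have sizes s : (size (seq.filter (nearly_fixed eta) s) +
    size (seq.filter (predC (nearly_fixed eta)) s))%N = size s.
  by rewrite !size_filter count_predC.
have [||g [h gh]] := hd true a.
- move=> i s ij si ss; rewrite cobound_star.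
  set t1 := seq.filter (nearly_fixed eta) s; set t2 := seq.filter (predC (nearly_fixed eta)) s.
  (* Either the outer part has the wrong size for the colour cochain, or the inner part has m + 1
     vertices and [retr] maps it to a small simplex of [F], where [f] is closed. *)
  have -> : star (nearly_fixed eta) (cobound (iter i (@twist V 'F_p) f0))
      (fun s => colour_cochain i (map (vertex p sigma gamma) s)) s = 0.
    rewrite starE -/t1 -/t2; have [st2|st2] := eqVneq (size t2) i; last first.
      by rewrite colour_cochain_size ?size_map // !mulr0.
    rewrite cobound_iter_twist ?mul0r ?mulr0 //.
    have st1 : size t1 = m.+1.
      by have := sizes s; rewrite -/t1 -/t2 st2 si -addSn => /addIn.
    rewrite (_ : cobound f0 t1 = cobound (fun s => f (map (retr e1) s)) t1); last first.
      by apply: eq_cobound => t; rewrite st1 /f0 => -[->]; rewrite eqxx.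
    rewrite cobound_map; apply: fc; first by rewrite size_map.
    have [sX se] := ss.
    have close x : x \in t1 -> [/\ x \in s, F (retr e1 x), `|x| <= R1 & `|x - retr e1 x| < e1].
      rewrite mem_filter => /andP[/asboolP nx xs]; have [Xx xr] := sX _ xs.
      have [] := @retrP e1 x e10; last by split.
      have [y Fy xy] := heta x Xx xr (lt_le_trans (nx 1%N 0%N) eta_le0).
      exists y; split => // k; rewrite -(subrKA x).
      apply: le_lt_trans (ler_normD _ _) _.
      by have := nx k 0%N; move: xy => /=; lra.
    split=> [_ /mapP[x /close[_ Fx xr xx] ->]|
      _ _ /mapP[x /close[xs _ _ xx] ->] /mapP[y /close[ys _ _ yy] ->]].
      split=> //; rewrite -(subrK x (retr e1 x)) addrC.
      apply: le_trans (ler_normD _ _) _; rewrite lerD // distrC.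
      by apply: ltW; apply: lt_le_trans xx e11.
    rewrite -(subrKA x) -(subrKA y x).
    apply: le_lt_trans (ler_normD _ _) _; rewrite distrC.
    apply: le_lt_trans (lerD (lexx _) (ler_normD _ _)) _.
    have := se _ _ xs ys; rewrite lt_min => /andP[xy _].
    exact: lt_sum_thirds xx xy yy e1e.
  rewrite add0r starE -/t1 -/t2.
  set c := star_sign 'F_p (nearly_fixed eta) s * iter i.+1 (@twist V 'F_p) f0 t1.
  have -> : norm_diff p sigma (true (+) odd i) (a i.+1) s =
      c * norm_diff p (@rotate p _) (true (+) odd i) (colour_cochain i.+1)
        (map (vertex p sigma gamma) t2).
    rewrite /norm_diff; case: (true (+) odd i).
      by rewrite mulr_sumr; apply: eq_bigr => k _; exact: a_iter.
    by rewrite mulrBr (aE i.+1 s); congr (_ - _); exact: (a_iter i.+1 1%N s).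
  rewrite mulrA -/c; have [st1|st1] := eqVneq (size t1) m; last first.
    by rewrite /c iter_twist_eq0 ?mulr0 ?mul0r // /f0 (negPf st1).
  have st2 : size t2 = i.+1.
    by have := sizes s; rewrite -/t1 -/t2 st1 si -addnS => /addnI.
  rewrite cobound_map cobound_colour_cochain ?size_map //; exact: adm.
- move=> s sj ss; rewrite aE colour_cochain_eq0 ?mulr0 //; exact: adm.
exists h => s sm ss.
have [sF _] := ss.
have fixed i : map (iter i sigma) s = s.
  rewrite -[RHS]map_id; apply/eq_in_map => x /sF[[_ /= sx] _]; exact: iter_fixed.
have := gh s sm; rewrite /norm_diff.
under eq_bigr do rewrite fixed.
rewrite sumr_const card_ord -mulr_natr (pcharf0 (pchar_Fp p_pr)) mulr0 add0r => <-; last first.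
  split=> [x /sF[[Xx _] xr]|]; first by [].
  by have [] := ss.
rewrite /a star_near; last first.
  apply/allP => x /sF[[_ /= sx] _]; apply/asboolP => i j.
  by rewrite !iter_fixed // subrr normr0.
rewrite /= mulr1 /f0 sm eqxx; congr f; rewrite -[LHS]map_id; apply/eq_in_map => x /sF[Fx _].
by rewrite /retr; case: asboolP.
Qed.
End Smith.

(** * Matrices of prime order *)

(** In a full-rank factorization E = A B of an idempotent, B A is the identity of size the rank, and
    it has the same trace as A B. *)
Lemma mxtrace_idempotent (F : fieldType) n (E : 'M[F]_n) :
  E *m E = E -> \tr E = (\rank E)%:R.
Proof.
move=> EE; have E_base := mulmx_base E.
have baseE : row_base E *m col_base E = 1%:M.
  apply: (row_free_inj (row_base_free E)); rewrite mul1mx.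
  apply: (row_full_inj (col_base_full E)).
  by rewrite E_base -(mulmxA (row_base E)) E_base (mulmxA (col_base E)) E_base.
by rewrite -{1}E_base mxtrace_mulC baseE mxtrace1.
Qed.

Section Averages.
Variables (F : fieldType) (n p : nat).
Hypothesis p0 : p%:R != 0 :> F.
Implicit Types C V E : 'M[F]_n.

Definition mx_pow C i := iter i (mulmx C) 1%:M.

Lemma mx_powD C i j : mx_pow C (i + j) = mx_pow C i *m mx_pow C j.
Proof. by elim: i => [|i IH]; rewrite ?mul1mx // addSn /= -mulmxA -IH. Qed.

Lemma mx_powSr C i : mx_pow C i.+1 = mx_pow C i *m C.
Proof. by rewrite -addn1 mx_powD /= mulmx1. Qed.

Lemma mx_pow_mod C i : mx_pow C p = 1%:M -> mx_pow C (i %% p) = mx_pow C i.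
Proof.
move=> Cp; rewrite [in RHS](divn_eq i p) mx_powD.
suff -> : mx_pow C (i %/ p * p) = 1%:M by rewrite mul1mx.
by elim: (i %/ p)%N => // q IH; rewrite mulSn mx_powD Cp IH mul1mx.
Qed.

Lemma mx_pow_comm C V i : C *m V = V *m C -> mx_pow C i *m V = V *m mx_pow C i.
Proof.
move=> CV; elim: i => [|i IH]; first by rewrite mul1mx mulmx1.
by rewrite mx_powSr -mulmxA CV !mulmxA IH.
Qed.

Lemma mx_powM C i j : mx_pow C (i * j) = mx_pow (mx_pow C i) j.
Proof. by elim: j => [|j IH]; rewrite ?muln0 // mulnS mx_powD IH. Qed.

Lemma mx_powMn C V i : C *m V = V *m C -> mx_pow (C *m V) i = mx_pow C i *m mx_pow V i.
Proof.
move=> CV; elim: i => [|i IH]; first by rewrite mul1mx.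
rewrite /= IH -!mulmxA; congr (_ *m _); rewrite !mulmxA; congr (_ *m _).
exact/esym/mx_pow_comm.
Qed.

Definition mx_avg C : 'M[F]_n := p%:R^-1 *: \sum_(i < p) mx_pow C i.

Lemma mx_avg_fixed C : mx_pow C p = 1%:M -> C *m mx_avg C = mx_avg C.
Proof.
move=> Cp; rewrite -scalemxAr; congr (_ *: _); rewrite mulmx_sumr.
apply/eqP; rewrite -subr_eq0 -sumrB.
rewrite -(big_mkord predT (fun i => C *m mx_pow C i - mx_pow C i)).
by rewrite (telescope_sumr (mx_pow C)) // Cp subrr.
Qed.

Lemma mx_avg_absorb C E : C *m E = E -> mx_avg C *m E = E.
Proof.
move=> CE; have CiE i : mx_pow C i *m E = E by elim: i => [|i IH]; rewrite ?mul1mx //= -mulmxA IH.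
rewrite -scalemxAl mulmx_suml (eq_bigr _ (fun (i : 'I_p) _ => CiE i)) sumr_const card_ord.
by rewrite -scaler_nat scalerA mulVf // scale1r.
Qed.

Lemma mx_avg_comm C V : C *m V = V *m C -> mx_avg C *m V = V *m mx_avg C.
Proof.
move=> CV; rewrite -scalemxAl -scalemxAr mulmx_suml mulmx_sumr; congr (_ *: _).
by apply: eq_bigr => i _; rewrite mx_pow_comm.
Qed.

Lemma mxtrace_avg C : mx_pow C p = 1%:M -> \tr (mx_avg C) = (\rank (mx_avg C))%:R.
Proof. by move=> Cp; exact/mxtrace_idempotent/(mx_avg_absorb (mx_avg_fixed Cp)). Qed.

Lemma mx_pow_conj C P Q i : Q *m P = 1%:M -> P *m Q = 1%:M ->
  mx_pow (P *m C *m Q) i = P *m mx_pow C i *m Q.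
Proof.
move=> QP PQ; elim: i => [|i IH]; first by rewrite mulmx1.
by rewrite /= IH !mulmxA -(mulmxA (P *m C)) QP mulmx1.
Qed.

Lemma mxtrace_avg_conj C P Q : P *m Q = 1%:M ->
  \tr (mx_avg (P *m C *m Q)) = \tr (mx_avg C).
Proof.
move=> PQ; have QP := mulmx1C PQ; rewrite !mxtraceZ !raddf_sum; congr (_ * _).
apply: eq_bigr => i _ /=.
by rewrite mx_pow_conj // mxtrace_mulC mulmxA QP mul1mx.
Qed.

End Averages.

(* Summing tr (V^i C^(ij)) over i and j gives
   p tr (avg V) + tr (avg C) = n + p tr (avg V avg C), an identity of integers. *)
Lemma mx_avg_rigid (F : numFieldType) (n p : nat) (C V : 'M[F]_n) :
  prime p -> (n < p)%N -> mx_pow C p = 1%:M -> mx_pow V p = 1%:M ->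
  C *m V = V *m C ->
  (forall j, \tr (mx_avg p (V *m mx_pow C j)) = \tr (mx_avg p V)) -> C = 1%:M.
Proof.
move=> p_pr np Cp Vp CV trj.
have p0 : p%:R != 0 :> F by rewrite pnatr_eq0 -lt0n prime_gt0.
have CVi i : mx_pow C i *m V = V *m mx_pow C i by exact: mx_pow_comm.
pose T i j : F := \tr (mx_pow V i *m mx_pow C j).
have T_avg : \sum_(i < p) \sum_(j < p) T i j = p%:R ^+ 2 * \tr (mx_avg p V *m mx_avg p C).
  rewrite -scalemxAl -scalemxAr scalerA mxtraceZ mulrA -invfM -expr2 divff ?expf_neq0 // mul1r.
  rewrite mulmx_suml raddf_sum; apply: eq_bigr => i _ /=.
  by rewrite mulmx_sumr raddf_sum.
have trj' j : p%:R * \tr (mx_avg p V) = \sum_(i < p) T i (i * j)%N.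
  rewrite -(trj j) mxtraceZ mulrA divff // mul1r raddf_sum /=; apply: eq_bigr => i _.
  by rewrite mx_powMn // -mx_powM mulnC.
have sumT : p%:R ^+ 2 * \tr (mx_avg p V) = \sum_(i < p) \sum_(j < p) T i (i * j)%N.
  rewrite exchange_big /= -(eq_bigr _ (fun (j : 'I_p) _ => trj' j)) sumr_const card_ord.
  by rewrite expr2 -mulrA mulr_natl.
have T0 : \sum_(j < p) T 0%N j = p%:R * \tr (mx_avg p C).
  rewrite mxtraceZ mulrA divff // mul1r raddf_sum; apply: eq_bigr => j _ /=.
  by rewrite /T mul1mx.
have T0' : \sum_(j < p) T 0%N (0 * j)%N = p%:R * n%:R.
  rewrite mulr_natl -[X in _ *+ X]card_ord -sumr_const; apply: eq_bigr => j _.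
  by rewrite /T mul0n mul1mx mxtrace1.
(* Multiplication by i prime to p permutes the exponents mod p. *)
have Ti (i : nat) : (0 < i < p)%N -> \sum_(j < p) T i (i * j)%N = \sum_(j < p) T i j.
  move=> /andP[i0 ip]; rewrite (big_Fp (fun j => T i (i * j)%N)) // (big_Fp (T i)) //.
  have i_unit : (i%:R : 'F_p) != 0.
    by rewrite -(dvdn_pcharf (pchar_Fp p_pr)) gtnNdvd.
  rewrite [RHS](reindex_inj (mulfI i_unit)); apply: eq_bigr => j _.
  rewrite /T; congr (\tr (_ *m _)); rewrite -(mx_pow_mod _ Cp); congr (mx_pow C _).
  rewrite -(val_Fp_nat p_pr).
  by congr nat_of_ord; rewrite natrM natr_Zp.
have idem : (mx_avg p V *m mx_avg p C) *m (mx_avg p V *m mx_avg p C) = mx_avg p V *m mx_avg p C.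
  have VC : mx_avg p V *m mx_avg p C = mx_avg p C *m mx_avg p V.
    apply: mx_avg_comm; exact/esym/mx_avg_comm.
  have EE (W : 'M[F]_n) : mx_pow W p = 1%:M -> mx_avg p W *m mx_avg p W = mx_avg p W.
    by move=> Wp; exact: (mx_avg_absorb p0 (mx_avg_fixed Wp)).
  rewrite -(mulmxA (mx_avg p V)) (mulmxA (mx_avg p C)) -VC -(mulmxA (mx_avg p V)) EE //.
  by rewrite mulmxA EE.
have key : p%:R * \tr (mx_avg p V) + \tr (mx_avg p C) =
    n%:R + p%:R * \tr (mx_avg p V *m mx_avg p C).
  apply: (mulfI p0); rewrite !mulrDr !mulrA -!expr2 sumT -T_avg -T0 -T0'.
  have recl (G : nat -> F) : \sum_(i < p) G i = G 0%N + \sum_(1 <= i < p) G i.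
    by rewrite -(big_mkord predT G) big_ltn ?prime_gt0.
  rewrite (recl (fun i => \sum_(j < p) T i (i * j)%N)) (recl (fun i => \sum_(j < p) T i j)).
  rewrite -!addrA; congr (_ + _); rewrite addrC; congr (_ + _).
  by apply: eq_big_nat => i /Ti.
(* By [key], p divides the difference between n and this rank, which is less than p. *)
have rankC : \rank (mx_avg p C) = n.
  move: key; rewrite !mxtrace_avg // (mxtrace_idempotent idem) -!natrM -!natrD.
  move/eqP; rewrite eqr_nat => /eqP.
  have := rank_leq_row (mx_avg p C).
  set d0 := \rank _; set d := \rank _; set f := \rank _ => d0n E.
  have dv : (p %| n - d0)%N by apply/dvdnP; exists (d - f)%N; rewrite mulnBl ![(_ * p)%N]mulnC; lia.
  apply/eqP; rewrite eqn_leq d0n -subn_eq0 eqn0Ngt; apply/negP => /dvdn_leq/(_ dv).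
  by rewrite leqNgt (leq_ltn_trans (leq_subr _ _) np).
have EC1 : mx_avg p C = 1%:M.
  have := mx_avg_absorb p0 (mx_avg_fixed Cp).
  have full : row_free (mx_avg p C) by rewrite /row_free rankC.
  by move=> EE; apply: (row_free_inj full); rewrite EE mul1mx.
by rewrite -[LHS]mulmx1 -EC1 mx_avg_fixed.
Qed.

(** * Diffeomorphisms of prime order *)

Section Calculus.
Local Open Scope classical_set_scope.
Variables (R : realType) (n : nat).
Let V := 'rV[R]_n.

Lemma is_derive_line (f : V -> R) (b v : V) (t : R) : (forall x, differentiable f x) ->
  is_derive t (1 : R) (fun t : R => f (b + t *: v)) ('D_v f (b + t *: v)).
Proof.
move=> df.
have quot : (fun h : R =>
    h^-1 *: (((fun t : R => f (b + t *: v)) \o shift t) (h *: (1 : R)) - f (b + t *: v))) =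
    (fun h : R => h^-1 *: ((f \o shift (b + t *: v)) (h *: v) - f (b + t *: v))).
  apply/funext => h; rewrite /shift /=; congr (_ *: (f _ - _)).
  by rewrite [h *: 1]mulr1 scalerDl addrCA.
apply: DeriveDef; last by rewrite /derive quot.
by rewrite /derivable quot; exact: diff_derivable.
Qed.

(** Mean value theorem on the segment from [b] to [a], for the one coordinate of [f] in which f a -
    f b attains its sup norm. The n partial derivatives are kept below k / (n + 1), a quotient that
    makes sense also for n = 0. *)
Lemma Ck1_lipschitz (f : V -> V) y : Ck 1 f -> (forall i, 'D_'e_i f y = 0) ->
  forall k, 0 < k -> exists2 d, 0 < d & forall a b,
    `|a - y| < d -> `|b - y| < d -> `|f a - f b| <= k * `|a - b|.
Proof.
move=> [df Df] Dfy k k0.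
pose k' := k / n.+1%:R; have k'0 : 0 < k' by rewrite divr_gt0.
have : \forall z \near y, forall i, `|'D_'e_i f z| < k'.
  apply: (@filter_forall V 'I_n (fun i z => `|'D_'e_i f z| < k') (nbhs y)) => i.
  have /cvgrPdist_lt/(_ k' k'0) := Df i y.
  by rewrite Dfy; apply: filterS => z; rewrite sub0r normrN.
move=> /nbhs_ballP[d /= d0 hd]; exists d => // a b ay yb.
have [->|fab] := eqVneq (f a - f b) 0; first by rewrite normr0 mulr_ge0 // ltW.
have [j ->] := norm_coord_attained fab.
pose g (t : R) : R := f (b + t *: (a - b)) 0 j.
have dfj x : differentiable (fun x => f x 0 j) x.
  by apply: (@differentiable_comp _ _ _ _ f (fun M => M 0 j)) => //; exact: differentiable_coord.
pose dg (t : R) : R := 'D_(a - b) (fun x => f x 0 j) (b + t *: (a - b)).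
have g' (t : R) : is_derive t (1 : R) g (dg t) by exact: (is_derive_line b (a - b) t dfj).
have g_cont : {within `[0, 1], continuous g}.
  apply: derivable_within_continuous => t _; exact: (@ex_derive _ _ _ _ _ _ _ (g' t)).
have [s s01 gE] := MVT_segment ler01 (fun x _ => g' x) g_cont.
have -> : (f a - f b) 0 j = dg s.
  by rewrite !mxE; move: gE; rewrite subr0 mulr1 /g scale1r scale0r addr0 [b + _]addrC subrK.
have ins : `|b + s *: (a - b) - y| < d.
  have -> : b + s *: (a - b) - y = s *: (a - y) + (1 - s) *: (b - y).
    by apply/rowP => l; rewrite !mxE; ring.
  move: s01; rewrite in_itv /= => /andP[s0 s1].
  apply: le_lt_trans (ler_normD _ _) _; rewrite !normrZ !ger0_norm ?subr_ge0 //.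
  have [-> |sn0] := eqVneq s 0; first by rewrite mul0r subr0 mul1r add0r.
  have : s * `|a - y| < s * d by rewrite ltr_pM2l // lt0r sn0.
  have : (1 - s) * `|b - y| <= (1 - s) * d by rewrite ler_wpM2l ?subr_ge0 // ltW.
  lra.
set z := b + _ in ins *.
have zd i : `|'D_'e_i f z| < k' by apply: hd; rewrite -ball_normE /= distrC.
rewrite /dg deriveE // -/z {1}(row_sum_delta (a - b)) linear_sum.
apply: le_trans (ler_norm_sum _ _ _) _.
apply: le_trans (_ : \sum_(i < n) k' * `|a - b| <= _).
  apply: ler_sum => i _; rewrite linearZ /= normrM mulrC.
  apply: ler_pM => //; last exact: norm_coord.
  rewrite -deriveE // (_ : 'D_'e_i (fun x => f x 0 j) z = ('D_'e_i f z) 0 j).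
    by apply: le_trans (norm_coord _ _) (ltW (zd i)).
  by rewrite derive_mx ?mxE //; exact: diff_derivable.
rewrite sumr_const card_ord -mulr_natl mulrA ler_wpM2r //.
by rewrite /k' mulrCA ler_piMr ?ltW // ltr_pdivrMr // mul1r ltr_nat.
Qed.

Lemma Ck_scale m (k : R) : Ck m (fun z : V => k *: z).
Proof.
case: m => [|m]; first by move=> x; exact: scaler_continuous.
have D x : is_diff x ( *:%R k : V -> V) ( *:%R k) by exact: is_diff_scaler.
split=> [x|i]; first exact: ex_diff.
rewrite (_ : (fun x => _) = fun=> k *: 'e_i); first exact: Ck_cst.
by apply/funext => x; rewrite deriveE ?diff_val //; exact: ex_diff.
Qed.

End Calculus.

Lemma heis_conj (G : groupType) (u v c : G) j :
  (u * c = c * u)%g -> (u * v = v * c * u)%g -> (u ^+ j * v = v * c ^+ j * u ^+ j)%g.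
Proof.
move=> uc uv; elim: j => [|k IH]; first by rewrite !expg0 mul1g !mulg1.
have uck : (u * c ^+ k = c ^+ k * u)%g by exact: commuteX.
by rewrite !expgS -mulgA IH !mulgA uv -(mulgA (v * c)%g u) uck !mulgA.
Qed.

Section Jacobians.
Local Open Scope classical_set_scope.
Variables (R : realType) (n : nat).
Let V := 'rV[R]_n.
Implicit Types (f g u v c : Diff R n) (x y z : V).

Lemma DiffE f g x : (f * g)%g x = f (g x). Proof. by []. Qed.

Lemma Diff_expE g i x : (g ^+ i)%g x = iter i g x.
Proof. by elim: i => [|i IH]; rewrite ?expg0 // expgS DiffE IH. Qed.

Lemma Diff_differentiable g x : differentiable g x.
Proof. by have [] := @diff_fun_smooth _ _ g 1%N. Qed.

Lemma Diff_continuous g : continuous g.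
Proof. exact: (@diff_fun_smooth _ _ g 0%N). Qed.

Lemma mulmx_jacobian (f : V -> V) x (v : V) : v *m jacobian f x = 'd f x v.
Proof. by rewrite /jacobian mul_rV_lin1. Qed.

(** Jacobians act on row vectors from the right, which reverses the chain rule. *)
Lemma Diff_jacobian_mul f g x :
  jacobian (f * g)%g x = jacobian g x *m jacobian f (g x).
Proof.
have dg := Diff_differentiable g x; have df := Diff_differentiable f (g x).
apply/row_matrixP => i.
rewrite rowE.
rewrite mulmx_jacobian.
rewrite rowE mulmxA.
rewrite mulmx_jacobian.
rewrite mulmx_jacobian.
by rewrite -[RHS]/(('d f (g x) \o 'd g x) 'e_i) -diff_comp.
Qed.

Lemma Diff_jacobian1 x : jacobian (1%g : Diff R n) x = 1%:M.
Proof.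
apply/row_matrixP => i; rewrite !rowE mulmx1 mulmx_jacobian.
by rewrite (_ : (1%g : Diff R n) = id :> (V -> V)) // diff_val.
Qed.

Lemma Diff_jacobian_iter g i x : g x = x ->
  jacobian (g ^+ i)%g x = mx_pow (jacobian g x) i.
Proof.
move=> gx; elim: i => [|i IH]; first by rewrite expg0 Diff_jacobian1.
by rewrite expgSr Diff_jacobian_mul gx IH.
Qed.

(* At a fixed point of g with g ^+ p = 1, the dimension of the fixed space of the
   derivative of g; the definition makes sense, and is continuous, everywhere. *)
Definition fixed_dim p g x : R := p%:R^-1 * \sum_(i < p) \tr (jacobian (g ^+ i)%g x).

Lemma fixed_dimE p g x : g x = x -> fixed_dim p g x = \tr (mx_avg p (jacobian g x)).
Proof.
move=> gx; rewrite /fixed_dim mxtraceZ raddf_sum; congr (_ * _).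
by apply: eq_bigr => i _; rewrite Diff_jacobian_iter.
Qed.

Lemma jacobian_coord g x i j : jacobian g x i j = ('D_'e_i g x) 0 j.
Proof.
rewrite deriveEjacobian -?rowE ?mxE //; exact: Diff_differentiable.
Qed.

Lemma fixed_dim_continuous p g : continuous (fixed_dim p g).
Proof.
have tr (h : Diff R n) : @Ck R n R 0 (fun x => \tr (jacobian h x)).
  rewrite /mxtrace; apply: Ck_sum => i.
  rewrite (_ : (fun x => _) = fun x => ('D_'e_i h x) 0 i); last first.
    by apply/funext => x; rewrite jacobian_coord.
  have Dh : Ck 0 (fun x => 'D_'e_i h x) := (@diff_fun_smooth _ _ h 1%N).2 i.
  exact: (Ck_coord i Dh).
apply: (@CkM R n 0 (fun=> p%:R^-1) (fun x => \sum_(i < p) \tr (jacobian (g ^+ i)%g x))).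
  exact: Ck_cst.
by apply: Ck_sum => i; exact: tr.
Qed.

(** At a scale where [phi] varies by less than 1 on [X] within the radius, the indicator of the
    level of [x] is a 0-cocycle. The case m = 1 of acyclicity writes it as the coboundary of a
    cochain on the empty sequence, that is as a constant. *)
Lemma pro_acyclic_const (A : comNzRingType) (X : set V) (phi : V -> R) :
  pro_acyclic A X -> continuous phi -> (forall x, X x -> exists k : nat, phi x = k%:R) ->
  forall x y, X x -> X y -> phi x = phi y.
Proof.
move=> acX phi_cont phi_nat x y Xx Xy.
have [r' hr'] := acX 1%N (Num.max `|x| `|y|).
have [e e0 he] := uniform_continuity r' phi_cont ltr01.
have [d d0 hd] := hr' e e0.
pose f s : A := if s is [:: z] then (phi z == phi x)%:R else 0.
have [|g hg] := hd f.
  case=> [|a [|b [|c s]]] // _ [sX se] /=.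
  have := se a b; rewrite !inE !eqxx orbT => /(_ isT isT) ab.
  have [Xa ar] := sX a (mem_head _ _).
  have [Xb _] : X b /\ `|b| <= r' by apply: sX; rewrite !inE eqxx orbT.
  have := he a b ar ab.
  have [i ->] := phi_nat a Xa; have [j ->] := phi_nat b Xb.
  rewrite ltr_norml => /andP[ij ji].
  have [lt_ij|lt_ji|->] := ltngtP i j; last by rewrite subr0 subrr.
    by exfalso; move: ij; rewrite ltrNl opprB ltrBlDl natr1 ltr_nat ltnS leqNgt lt_ij.
  by exfalso; move: ji; rewrite ltrBlDl natr1 ltr_nat ltnS leqNgt lt_ji.
have small1 z : X z -> `|z| <= Num.max `|x| `|y| -> small X (Num.max `|x| `|y|) d [:: z].
  move=> Xz zr; split=> [a|a b]; rewrite !inE; first by move/eqP ->.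
  by move=> /eqP -> /eqP ->; rewrite subrr normr0.
have fx := hg [:: x] erefl (small1 x Xx _).
have fy := hg [:: y] erefl (small1 y Xy _).
move: fx fy; rewrite /= eqxx !le_max !lexx orbT => /(_ isT) <- /(_ isT).
by case: eqP => // _ /eqP; rewrite eq_sym oner_eq0.
Qed.

(** The map f = 1 + c + ... + c^(p-1) - p has derivative 0 at [y], hence Lipschitz constant 1/2
    nearby. The sum of the powers is invariant under c, so f (c z) - f z = - p (c z - z), and c z =
    z follows from p > 1/2. *)
Lemma Diff_local_rigid p c y : prime p -> (c ^+ p = 1)%g -> c y = y -> jacobian c y = 1%:M ->
  exists2 d, 0 < d & forall z, `|z - y| < d -> c z = z.
Proof.
move=> p_pr cp cy Jcy.
pose f z : V := \sum_(i < p) (c ^+ i)%g z + (- p%:R) *: z.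
have Cf : Ck 1 f.
  apply: CkD; last exact: Ck_scale.
  by apply: Ck_sum => i; exact: diff_fun_smooth.
have Jpow i : jacobian (c ^+ i)%g y = 1%:M.
  by rewrite Diff_jacobian_iter // Jcy; elim: i => //= i ->; rewrite mulmx1.
have Df i : 'D_'e_i f y = 0.
  have Dpow j : 'D_'e_i (c ^+ j)%g y = 'e_i.
    rewrite deriveEjacobian; last exact: Diff_differentiable.
    by rewrite Jpow mulmx1.
  have dpow j : derivable (c ^+ j)%g y 'e_i.
    by apply: diff_derivable; exact: Diff_differentiable.
  have dsc : is_derive y 'e_i (fun z : V => (- p%:R) *: z) ((- p%:R) *: 'e_i).
    have dd : is_diff y ( *:%R (- p%:R) : V -> V) ( *:%R (- p%:R)) by exact: is_diff_scaler.
    apply: DeriveDef; first by apply: diff_derivable; exact: ex_diff.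
    by rewrite deriveE ?diff_val //; exact: ex_diff.
  have dsum m : is_derive y 'e_i (fun z => \sum_(j < m) (c ^+ j)%g z) (m%:R *: 'e_i).
    elim: m => [|m IH].
      rewrite (_ : (fun z => _) = cst 0); last by apply/funext => z; rewrite big_ord0.
      by rewrite scale0r; exact: is_derive_cst.
    rewrite (_ : (fun z => _) = (fun z => \sum_(j < m) (c ^+ j)%g z) + (c ^+ m)%g); last first.
      by apply/funext => z; rewrite big_ord_recr.
    rewrite -natr1 scalerDl scale1r; apply: is_deriveD.
    by apply: DeriveDef.
  have := is_deriveD (dsum p) dsc => dd.
  by rewrite (@derive_val _ _ _ _ _ _ _ dd) scaleNr subrr.
have k0 : 0 < 1 / 2 :> R by rewrite divr_gt0.
have [d d0 hd] := Ck1_lipschitz Cf Df k0.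
have [d' d'0 hd'] := uniform_continuity (`|y| + d) (@Diff_continuous c) d0.
exists (Num.min d d'); first by rewrite lt_min d0.
move=> z; rewrite lt_min => /andP[zd zd'].
have czd : `|c z - y| < d.
  rewrite -{1}cy; apply: hd' => //.
  rewrite -[z](subrK y); apply: le_trans (ler_normD _ _) _.
  by rewrite addrC lerD2l ltW.
have := hd _ _ czd zd.
have -> : f (c z) - f z = (- p%:R) *: (c z - z).
  rewrite /f opprD addrACA -scalerBr -[RHS]add0r; congr (_ + _).
  rewrite -sumrB; under eq_bigr do rewrite -DiffE -expgSr !Diff_expE.
  rewrite -(big_mkord predT (fun i => iter i.+1 c z - iter i c z)).
  by rewrite (telescope_sumr (fun i => iter i c z)) // -!Diff_expE cp subrr.
rewrite normrZ normrN normr_nat.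
have [->//|cz] := eqVneq (c z) z; have : 0 < `|c z - z| by rewrite normr_gt0 subr_eq0.
move=> h0; rewrite ler_pM2r // => h; exfalso; move: h; clear -p_pr => h.
have : 1 <= p%:R :> R by rewrite ler1n prime_gt0.
by move=> /le_trans/(_ h); lra.
Qed.

Lemma closed_eq_cst (f : V -> V) (a : V) : continuous f -> closed [set z | f z = a].
Proof.
move=> cf; rewrite (_ : mkset _ = (fun z => `|f z - a|) @^-1` [set r | r <= 0]).
  apply: closed_comp; last exact: closed_le.
  move=> z _; apply: (@continuous_comp _ _ _ (fun z => f z - a) (fun z : V => `|z|)).
    by apply: continuousB; [exact: cf | exact: cst_continuous].
  exact: norm_continuous.
by apply/seteqP; split=> z /=; rewrite normr_le0 subr_eq0 => /eqP.
Qed.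

Lemma closed_fixed (f : V -> V) : continuous f -> closed [set z | f z = z].
Proof.
move=> cf; rewrite (_ : mkset _ = [set z | f z - z = 0]).
  by apply: closed_eq_cst => z; apply: continuousB; [exact: cf | exact: cvg_id].
by apply/seteqP; split=> z /= => [->|/eqP]; [exact: subrr | rewrite subr_eq0 => /eqP].
Qed.

(** Fixed points with derivative 1 form a set that is open by [Diff_local_rigid] and closed by
    continuity; it is pulled back to the line through [y] and [z]. *)
Lemma Diff_rigid p c y : prime p -> (c ^+ p = 1)%g -> c y = y -> jacobian c y = 1%:M ->
  c = 1%g.
Proof.
move=> p_pr cp cy Jcy; apply: Diff_inj => z.
pose U := [set z | c z = z /\ jacobian c z = 1%:M].
have openU : open U.
  rewrite openE => x [cx Jcx].
  have [d d0 hd] := Diff_local_rigid p_pr cp cx Jcx.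
  have near_id : \forall w \near x, c w = w.
    by apply/nbhs_ballP; exists d => // w; rewrite -ball_normE /= distrC; exact: hd.
  apply: filterS (near_join near_id) => w cw; split; first exact: nbhs_singleton cw.
  apply/row_matrixP => i; rewrite !rowE mulmx1 -deriveEjacobian; last exact: Diff_differentiable.
  by rewrite (near_eq_derive (g := id)) // derive_id.
have closedU : closed U.
  rewrite (_ : U = [set z | c z = z] `&` \bigcap_(i in [set: 'I_n]) [set z | 'D_'e_i c z = 'e_i]).
    apply: closedI; first exact/closed_fixed/Diff_continuous.
    apply: closed_bigI => i _; apply: closed_eq_cst.
    exact: ((@diff_fun_smooth _ _ c 1%N).2 i).
  apply/seteqP; split=> x [/= cx].
    move=> Jx; split=> [|i _ /=]; first exact: cx.
    by rewrite deriveEjacobian ?Jx ?mulmx1 //; exact: Diff_differentiable.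
  move=> Dx; split; first exact: cx.
  apply/row_matrixP => i; rewrite !rowE mulmx1 -deriveEjacobian.
    exact: (Dx i).
  exact: Diff_differentiable.
pose line (t : R) : V := y + t *: (z - y).
have line_cont : continuous line.
  move=> t; apply: (@continuousD R V R (fun=> y) (fun t : R => t *: (z - y)) t).
    exact: cst_continuous.
  exact: scalel_continuous.
have : connected [set: R] by apply/connected_intervalP.
move=> /(_ (line @^-1` U)) E.
suff : (line @^-1` U) 1 by rewrite /= /U /line /= scale1r addrC subrK => -[].
rewrite E //.
- by exists 0; rewrite /line /= scale0r addr0.
- exists (line @^-1` U); last by rewrite setTI.
  by apply: open_comp => // t _; exact: line_cont.
- exists (line @^-1` U); last by rewrite setTI.
  by apply: closed_comp => // t _; exact: line_cont.
Qed.

Theorem Diff_heisenberg p u v c : prime p -> odd p -> (n < p)%N ->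
  (v ^+ p = 1)%g -> (c ^+ p = 1)%g -> (v * c = c * v)%g -> (u * c = c * u)%g ->
  (u * v = v * c * u)%g -> c = 1%g.
Proof.
move=> p_pr p_odd np vp cp vc uc uv.
have iter_p g : (g ^+ p = 1)%g -> iter p g =1 id by move=> gp x; rewrite -Diff_expE gp.
pose Fv : set V := [set: V] `&` [set x | v x = x].
have acFv : pro_acyclic 'F_p Fv.
  apply: smith p_pr p_odd (@Diff_continuous v) (iter_p v vp) closedT _ _ => //.
  exact: pro_acyclic_setT.
have closedFv : closed Fv by apply: closedI closedT _; exact/closed_fixed/Diff_continuous.
have cFv x : Fv x -> Fv (c x) by move=> [_ /= vx]; split => //=; rewrite -DiffE vc DiffE vx.
have acFA := smith p_pr p_odd (@Diff_continuous c) (iter_p c cp) closedFv cFv acFv.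
(* Acyclicity for m = 0: if there were no common fixed point, the cochain 1 would be closed, but
   every coboundary is 0 on the empty sequence. *)
have [x [vx cx]] : exists x, v x = x /\ c x = x.
  have [r' /(_ 1 ltr01)[d _ /(_ (fun=> 1))]] := acFA 0%N 0.
  move=> nonempty; apply: contrapT => none.
  have [|g hg] := nonempty.
    move=> [|x [|y s]] // _ [sX _]; exfalso; apply: none; exists x.
    by case: (sX x (mem_head _ _)) => -[[_ vx] cx] _.
  have /(hg [::] erefl)/eqP : small (Fv `&` [set x | c x = x]) 0 d [::] by [].
  by rewrite oner_eq0.
have nat_dim y : Fv y -> exists k : nat, fixed_dim p v y = k%:R.
  move=> [_ /= vy]; rewrite fixed_dimE // mxtrace_avg //; first by eexists.
    by rewrite pnatr_eq0 -lt0n prime_gt0.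
  by rewrite -Diff_jacobian_iter // vp Diff_jacobian1.
have dim_const := pro_acyclic_const acFv (@fixed_dim_continuous p v) nat_dim.
apply: (Diff_rigid p_pr cp cx).
have Jcp : mx_pow (jacobian c x) p = 1%:M by rewrite -Diff_jacobian_iter // cp Diff_jacobian1.
have Jvp : mx_pow (jacobian v x) p = 1%:M by rewrite -Diff_jacobian_iter // vp Diff_jacobian1.
have Jcv : jacobian c x *m jacobian v x = jacobian v x *m jacobian c x.
  have J1 : jacobian (v * c)%g x = jacobian c x *m jacobian v x.
    by rewrite Diff_jacobian_mul cx.
  have J2 : jacobian (c * v)%g x = jacobian v x *m jacobian c x.
    rewrite Diff_jacobian_mul vx; reflexivity.
  exact: etrans (esym J1) (etrans (congr1 (fun g : Diff R n => jacobian g x) vc) J2).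
apply: (mx_avg_rigid p_pr np Jcp Jvp Jcv).
move=> j.
have ucj : (u * c ^+ j = c ^+ j * u)%g by exact: commuteX.
have ujv := heis_conj j uc uv.
have cjx : (c ^+ j)%g x = x by rewrite Diff_expE iter_fixed.
(* [u] need not fix [x]. Its power carries [v] near [y] to v c^j near [x], with conjugate
   derivatives, and [x] and [y] both lie on Fix v, where [dim_const] applies. *)
pose y := (u ^- j)%g x.
have ujy : (u ^+ j)%g y = x by rewrite /y -DiffE mulgV.
have vcj : (v * c ^+ j = u ^+ j * v * u ^- j)%g by rewrite ujv mulgK.
have vy : v y = y.
  have : (u ^+ j)%g (v y) = (u ^+ j)%g y.
    by rewrite -DiffE ujv !DiffE ujy cjx.
  by move/(congr1 (u ^- j)%g); rewrite -!DiffE mulVg.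
have -> : jacobian v x *m mx_pow (jacobian c x) j = jacobian (v * c ^+ j)%g x.
  have -> : (v * c ^+ j = c ^+ j * v)%g by exact: commuteX.
  rewrite Diff_jacobian_mul vx (Diff_jacobian_iter j cx); reflexivity.
rewrite vcj !Diff_jacobian_mul -/y vy mulmxA mxtrace_avg_conj; last first.
  by rewrite -Diff_jacobian_mul mulgV Diff_jacobian1.
exact: etrans (esym (fixed_dimE p vy))
  (etrans (dim_const y x (conj I vy) (conj I vx)) (fixed_dimE p vx)).
Qed.
End Jacobians.

(** * Specialization to finite fields *)

Lemma finField_root_extension (F : finFieldType) (g : {poly F}) : (1 < size g)%N ->
  exists (F' : finFieldType) (j : {rmorphism F -> F'}) (z : F'), root (map_poly j g) z.
Proof.
move=> sg; have g0 : g != 0 by rewrite -size_poly_gt0 (ltn_trans _ sg).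
have [L [zs gzs _]] := FinSplittingFieldFor g0.
have : (1 < size (map_poly (in_alg L) g))%N by rewrite size_map_poly.
rewrite (eqp_size gzs) size_prod_XsubC ltnS; case: zs gzs => // z zs gzs _.
exists (FinFieldExtType L), (in_alg L), z.
by rewrite (eqp_root gzs) root_prod_XsubC mem_head.
Qed.

(* A specialization of iota at r: a homomorphism to a finite field that factors
   through the image of iota and does not kill r. *)
Definition specializable (R : comNzRingType) (K : fieldType) (iota : {rmorphism R -> K}) :=
  forall r, iota r != 0 -> exists (F : finFieldType) (phi : {rmorphism R -> F}),
    (forall x, iota x = 0 -> phi x = 0) /\ phi r != 0.

Lemma intr_eq0_pchar (K : fieldType) p (x : int) : p \in [pchar K] ->
  (x%:~R == 0 :> K) = (p %| `|x|)%N.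
Proof.
move=> pK; rewrite {1}[x]intEsign rmorphM /= rmorph_sign mulf_eq0 signr_eq0 /=.
by rewrite -(dvdn_pcharf pK).
Qed.

Lemma specializable_int (K : fieldType) : specializable (intr : {rmorphism int -> K}).
Proof.
move=> r r0.
have [[p pK]|pK] := pselect (exists p, p \in [pchar K]).
  have pF := pchar_Fp (pcharf_prime pK).
  exists 'F_p, (intr : {rmorphism int -> 'F_p}); split => [x /eqP|].
    by rewrite (intr_eq0_pchar x pK) -(intr_eq0_pchar x pF) => /eqP.
  by rewrite (intr_eq0_pchar r pF) -(intr_eq0_pchar r pK).
have K0 (x : int) : x%:~R = 0 :> K -> x = 0.
  move=> /eqP; rewrite {1}[x]intEsign rmorphM rmorph_sign mulf_eq0 signr_eq0 /= => x0.
  apply/eqP; rewrite -absz_eq0; apply: contraT; rewrite -lt0n => xgt0.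
  have [p ppK] := natf0_pchar xgt0 x0.
  by exfalso; apply: pK; exists p.
have [p rp p_pr] := prime_above `|r|.
have pF := pchar_Fp p_pr.
exists 'F_p, (intr : {rmorphism int -> 'F_p}); split => [x /K0 ->|]; first exact: rmorph0.
rewrite (intr_eq0_pchar r pF) gtnNdvd // absz_gt0.
by apply: contraNneq r0 => ->.
Qed.

(** * Specializing one more coefficient y *)

Section PolynomialRing.
Variables (R : comNzRingType) (K : fieldType) (iota : {rmorphism R -> K}) (y : K).
Hypothesis iota_spec : specializable iota.
Let I := map_poly iota.
Implicit Types Q T g h A B : {poly R}.

Lemma size_lift T : (size (I T) <= size T)%N.
Proof. by apply/leq_sizeP => i iT; rewrite coef_map nth_default //; exact: rmorph0. Qed.

(** Without the terms that [iota] kills, degrees over R and over K agree, so the leading coefficient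
    used in pseudo-division survives in K. *)
Lemma normal_lift T : exists2 T', I T' = I T & size T' = size (I T).
Proof.
exists (\poly_(i < size (I T)) T`_i).
  apply/polyP => i; rewrite !coef_map coef_poly; case: ltnP => //= iT.
  by have := nth_default 0 iT; rewrite coef_map /= => ->; exact: rmorph0.
have [IT0|IT0] := eqVneq (I T) 0.
  by apply/eqP; rewrite eqn_leq size_poly IT0 size_poly0.
have sT : (0 < size (I T))%N by rewrite size_poly_gt0.
rewrite -(prednK sT) size_poly_eq //.
apply: contraNneq IT0 => T0; rewrite -lead_coef_eq0 lead_coefE coef_map T0; exact/eqP/rmorph0.
Qed.

(** Used for a minimal polynomial of [y] and for a greatest common divisor: as R is only a ring,
    minimality is measured on images over K. *)
Lemma minimal_lift (P : {poly R} -> Prop) T : P T -> I T != 0 ->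
  (forall T T', I T = I T' -> P T -> P T') ->
  exists g, [/\ P g, I g != 0, size g = size (I g) &
    forall Q, P Q -> (size (I Q) < size g)%N -> I Q = 0].
Proof.
move=> PT IT0 Pext.
have ex : exists m, `[< exists Q, [/\ P Q, I Q != 0 & size (I Q) = m] >].
  by exists (size (I T)); apply/asboolP; exists T.
case: (ex_minnP ex) => m /asboolP[Q [PQ IQ0 sQ]] minm.
have [g IgQ sg] := normal_lift Q.
exists g; split; [exact: Pext PQ|by rewrite IgQ|by rewrite IgQ|].
move=> Q' PQ' ltQ'; apply/eqP; apply: contraTT ltQ' => IQ'0.
by rewrite -leqNgt sg sQ minm //; apply/asboolP; exists Q'.
Qed.

Section Kernel.
Variables (F : comNzRingType) (phi : {rmorphism R -> F}).
Hypothesis kerphi : forall x, iota x = 0 -> phi x = 0.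

Lemma map_poly_ker T T' : I T = I T' -> map_poly phi T = map_poly phi T'.
Proof.
move=> TT'; apply/polyP => i; rewrite !coef_map /=; apply/eqP; rewrite -subr_eq0 -rmorphB.
apply/eqP/kerphi/eqP; rewrite rmorphB subr_eq0 -!coef_map.
exact/eqP/(congr1 (fun q : {poly K} => q`_i) TT').
Qed.
End Kernel.

(** Inductive step of the fact that a nonzero element of a finitely generated domain survives in
    some finite residue field. The element [y] is either transcendental or algebraic over the image
    of [iota]. *)
Lemma specializable_poly :
  specializable (horner_eval y \o map_poly iota : {rmorphism {poly R} -> K}).
Proof.
move=> P0; rewrite /= /horner_eval -/(I P0) => P0y.
have IP0 : I P0 != 0 by apply: contraNneq P0y => ->; rewrite horner0.
have [trans|] := pselect (forall Q, (I Q).[y] = 0 -> I Q = 0).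
  have r0 : iota P0`_(size (I P0)).-1 != 0 by rewrite -coef_map -lead_coefE lead_coef_eq0.
  have [F [phi [ker phir]]] := iota_spec r0.
  pose P1 := map_poly phi P0.
  have P10 : P1 != 0 by apply: contraNneq phir => P10; rewrite -coef_map -/P1 P10 coef0.
  (* A root z of this polynomial satisfies z P1(z) = 1, so P1(z) is nonzero; the factor X makes the
     degree positive even when P1 is constant. *)
  have [|F' [j [z]]] := @finField_root_extension F ('X * P1 - 1).
    rewrite size_polyDl ?size_polyN ?size_poly1 mulrC size_mulX // ltnS size_poly_gt0 //.
  rewrite /root rmorphB rmorphM /= map_polyX rmorph1 !hornerE subr_eq0 => /eqP z1.
  exists F', (horner_eval z \o map_poly (j \o phi)); split.
    move=> Q /= /trans IQ; rewrite /horner_eval (_ : map_poly _ Q = 0) ?horner0 //.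
    have : I Q = I 0 by rewrite IQ /I rmorph0.
    move=> /(map_poly_ker (phi := j \o phi)) ->; rewrite ?rmorph0 // => x /ker /= ->.
    by rewrite rmorph0.
  rewrite /= /horner_eval map_poly_comp -/P1.
  by apply: contra_eq_neq z1 => ->; rewrite mulr0 eq_sym oner_eq0.
move=> /existsNP[Q0 /not_implyP[Q0y /eqP IQ0]].
(* [g] plays the minimal polynomial of [y], and [h] below a gcd of [g] and [P0]. Over K, [h] divides
   [P0], so it does not vanish at [y]; the cofactor of [h] in [g] then does, and has the degree of
   [g] by minimality. Hence [h] is constant: a Bezout relation. *)
have [|g [gy Ig0 sg ming]] := minimal_lift (P := fun Q => (I Q).[y] = 0) Q0y IQ0.
  by move=> T T' ->.
pose J T := exists A B, I T = I (A * g + B * P0).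
have [||h [[A [B hAB]] Ih0 sh minh]] := @minimal_lift J P0 _ IP0.
- by exists 0, 1; rewrite mul0r add0r mul1r.
- by move=> T T' TT' [A [B E]]; exists A, B; rewrite -TT'.
have lead_iota T : size T = size (I T) -> iota (lead_coef T) = lead_coef (I T).
  by move=> sT; rewrite !lead_coefE -sT coef_map.
have h0 : h != 0 by apply: contraNneq Ih0 => ->; rewrite /I rmorph0.
have Jdiv T : J T ->
    exists q, (iota (lead_coef h) ^+ Pdiv.Ring.rscalp T h) *: I T = I q * I h.
  move=> [C [D TCD]]; exists (Pdiv.Ring.rdivp T h).
  have E := Pdiv.ComRing.rdivp_eq h T.
  have IE : (iota (lead_coef h) ^+ Pdiv.Ring.rscalp T h) *: I T =
      I (Pdiv.Ring.rdivp T h) * I h + I (Pdiv.Ring.rmodp T h).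
    by rewrite -rmorphXn /I -map_polyZ E rmorphD rmorphM.
  rewrite IE (minh (Pdiv.Ring.rmodp T h)) ?addr0 //; last first.
    by apply: leq_ltn_trans (size_lift _) _; rewrite Pdiv.CommonRing.ltn_rmodp.
  set s := (lead_coef h ^+ Pdiv.Ring.rscalp T h) in E *.
  exists (s *: C - Pdiv.Ring.rdivp T h * A), (s *: D - Pdiv.Ring.rdivp T h * B).
  rewrite (_ : Pdiv.Ring.rmodp T h = s *: T - Pdiv.Ring.rdivp T h * h); last first.
    by rewrite E addrC addKr.
  rewrite /I rmorphB rmorphM /= -!/(I _) hAB -mul_polyC /I rmorphM /= -/(I T) TCD /I.
  rewrite -!rmorphM -rmorphB; congr (map_poly _ _).
  by rewrite -!mul_polyC; ring.
have le0 : iota (lead_coef h) != 0 by rewrite lead_iota // lead_coef_eq0.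
have lk0 k : iota (lead_coef h) ^+ k != 0 by rewrite expf_neq0.
have [|q Eg] := Jdiv g; first by exists 1, 0; rewrite mul0r addr0 mul1r.
have [|q' EP] := Jdiv P0; first by exists 0, 1; rewrite mul0r add0r mul1r.
have hy : (I h).[y] != 0.
  apply: contraNneq P0y => hy; have /(congr1 (fun P : {poly K} => P.[y])) := EP.
  by move/eqP; rewrite hornerZ hornerM hy mulr0 mulf_eq0 (negPf (lk0 _)).
have qy : (I q).[y] = 0.
  have /(congr1 (fun P : {poly K} => P.[y])) := Eg.
  by move/esym/eqP; rewrite hornerZ gy mulr0 hornerM mulf_eq0 (negPf hy) orbF => /eqP.
have Iq0 : I q != 0.
  by apply: contraNneq Ig0 => Iq0; move/eqP: Eg; rewrite Iq0 mul0r scaler_eq0 (negPf (lk0 _)).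
have sh1 : size h = 1%N.
  have sizeg : size (I g) = (size (I q) + size (I h)).-1.
    by rewrite -size_mul // -Eg size_scale.
  have : (size g <= size (I q))%N.
    by rewrite leqNgt; apply/negP => /(ming _ qy) /eqP; apply/negP.
  have : (0 < size (I h))%N by rewrite size_poly_gt0.
  by move: sizeg; rewrite sg sh; lia.
have hE : h = (h`_0)%:P by apply: size1_polyC; rewrite sh1.
have e0 : iota h`_0 != 0 by rewrite -[h`_0]/(h`_(1.-1)) -sh1 -lead_coefE.
have lg0 : iota (lead_coef g) != 0 by rewrite lead_iota // lead_coef_eq0.
(* The leading coefficient of [g] must survive so that pseudo-division by [g] can be cancelled in
   the finite field, and the constant [h] so that the Bezout relation forces [P0] to be nonzero at a
   root of [g]. *)
have [|F [phi [ker]]] := @iota_spec (lead_coef g * h`_0); first by rewrite rmorphM mulf_neq0.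
rewrite rmorphM mulf_eq0 negb_or => /andP[phig phie].
have g1 : (1 < size g)%N.
  rewrite ltnNge; apply/negP => g1; have Eg0 := size1_polyC g1.
  by move: gy Ig0; rewrite Eg0 /I map_polyC hornerC /= => ->; rewrite eqxx.
have [|F' [j [z rz]]] := @finField_root_extension F (map_poly phi g).
  by rewrite size_map_poly_id0.
pose psi : {rmorphism R -> F'} := j \o phi.
have kerj x : iota x = 0 -> psi x = 0.
  by move=> /ker; rewrite /psi /= => ->; rewrite rmorph0.
have gz : (map_poly psi g).[z] = 0 by rewrite /psi map_poly_comp; exact/eqP.
exists F', (horner_eval z \o map_poly psi); split.
  move=> Q /=; rewrite /horner_eval -/(I Q) => Qy.
  have E := Pdiv.ComRing.rdivp_eq g Q.
  set s := (lead_coef g ^+ Pdiv.Ring.rscalp Q g) in E.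
  have Irm : I (Pdiv.Ring.rmodp Q g) = 0.
    apply: ming; last first.
      apply: leq_ltn_trans (size_lift _) _.
      by rewrite Pdiv.CommonRing.ltn_rmodp -size_poly_gt0 ltnW.
    have /(congr1 (fun T => (I T).[y])) := E.
    rewrite -mul_polyC /I rmorphM rmorphD rmorphM hornerM hornerD hornerM /= -!/(I _).
    by rewrite Qy gy !mulr0 add0r => <-.
  have rm0 : map_poly psi (Pdiv.Ring.rmodp Q g) = 0.
    have /(map_poly_ker kerj) -> : I (Pdiv.Ring.rmodp Q g) = I 0 by rewrite Irm /I rmorph0.
    exact: rmorph0.
  have := congr1 (fun T => (map_poly psi T).[z]) E.
  rewrite -mul_polyC rmorphM rmorphD rmorphM hornerM hornerD hornerM gz mulr0 add0r.
  rewrite /= rm0 horner0.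
  rewrite map_polyC hornerC /s /= !rmorphXn => /eqP.
  rewrite mulf_eq0 expf_eq0 /= fmorph_eq0 (negPf phig) andbF.
  by move/eqP.
rewrite /= /horner_eval; have := map_poly_ker kerj hAB.
rewrite {1}hE map_polyC rmorphD !rmorphM => /(congr1 (fun T : {poly F'} => T.[z])).
rewrite hornerC hornerD !hornerM gz mulr0 add0r => E.
have : psi h`_0 != 0 by rewrite /= fmorph_eq0.
by apply: contraNneq => Pz; rewrite E Pz mulr0.
Qed.
End PolynomialRing.

Lemma specializable_seq (K : fieldType) (s : seq K) :
  exists (R : comNzRingType) (iota : {rmorphism R -> K}),
    specializable iota /\ forall x, x \in s -> exists r, iota r = x.
Proof.
elim: s => [|y s [R [iota [sp lift]]]].
  by exists int, intr; split => //; exact: specializable_int.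
exists {poly R}, (horner_eval y \o map_poly iota); split; first exact: specializable_poly.
move=> x; rewrite in_cons => /orP[/eqP ->|/lift[r <-]].
  by exists 'X; rewrite /= /horner_eval map_polyX hornerX.
by exists r%:P; rewrite /= /horner_eval map_polyC hornerC.
Qed.

(** * Polynomial automorphisms *)

Lemma mx_powE (F : fieldType) n (C : 'M[F]_n.+1) i : mx_pow C i = C ^+ i.
Proof. by elim: i => //= i ->; rewrite exprS. Qed.

(** The last nonzero partial product X (C - z_1) ... (C - z_i) has eigenvectors of [C], or zeros, as
    rows; it is still killed by [E], which commutes with [C]. *)
Lemma eigenmatrix (F : fieldType) n (C E X : 'M[F]_n.+1) (zs : seq F) :
  C * E = E * C -> X * E = 0 -> X != 0 -> X * \prod_(z <- zs) (C - z%:M) = 0 ->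
  exists z Y, [/\ Y != 0, Y * E = 0 & Y * C = z *: Y].
Proof.
move=> CE; elim: zs X => [|z zs IH] X XE X0.
  by rewrite big_nil mulr1 => /eqP; rewrite (negPf X0).
rewrite big_cons mulrA => XP.
have [Xz|Xz] := eqVneq (X * (C - z%:M)) 0.
  exists z, X; split => //; apply/eqP; rewrite -subr_eq0 -[z *: X]mul_mx_scalar -mulrBr.
  exact/eqP.
apply: IH XP => //; rewrite -mulrA mulrBl CE -[z%:M * E]/(z%:M *m E) mul_scalar_mx.
by rewrite mulrBr mulrA XE mul0r -scalerAr XE scaler0 subrr.
Qed.

Lemma mx_heisenberg_split (F : fieldType) n p m (W V C : 'M[F]_n) (zs : seq F) :
  prime p -> p%:R != 0 :> F -> (n < p)%N -> ~~ (p %| m)%N ->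
  'X^p - 1 = \prod_(z <- zs) ('X - z%:P) ->
  mx_pow C p = 1%:M -> W \in unitmx -> V \in unitmx ->
  C *m W = W *m C -> C *m V = V *m C -> W *m V = V *m mx_pow C m *m W ->
  C = 1%:M.
Proof.
case: n W V C => [|n] W V C p_pr p0 np pm Xp Cp Wu Vu CW CV WV.
  by rewrite (flatmx0 C) [RHS]flatmx0.
pose E := mx_avg p C.
have CE : C *m E = E by exact: mx_avg_fixed.
have EC : E *m C = E by rewrite mx_avg_comm ?mx_avg_fixed.
have EE : E *m E = E by exact: (mx_avg_absorb p0 CE).
have [E1|E1] := eqVneq E 1%:M; first by rewrite -[LHS]mulmx1 -E1.
have prodC : \prod_(z <- zs) (C - z%:M) = 0.
  have := congr1 (horner_mx C) Xp; rewrite rmorphB rmorphXn rmorph1 /= horner_mx_X.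
  rewrite -mx_powE Cp subrr rmorph_prod => ->; apply: eq_bigr => z _.
  by rewrite rmorphB /= horner_mx_X horner_mx_C.
(* 1 - E is the projector complementary to the averaging projector [E]. An eigenvector killed by [E]
   cannot have eigenvalue 1, since [E] would fix it. *)
have [||||z [Y [Y0 YE YC]]] := @eigenmatrix F n C E (1 - E) zs.
- by rewrite -[C * E]/(C *m E) CE; exact/esym.
- by rewrite mulrBl mul1r -[E * E]/(E *m E) EE subrr.
- by rewrite subr_eq0 eq_sym.
- by rewrite prodC mulr0.
have Ypow i : Y *m mx_pow C i = z ^+ i *: Y.
  elim: i => [|i IH]; first by rewrite mulmx1 scale1r.
  by rewrite mx_powSr mulmxA IH -scalemxAl -[Y *m C]/(Y * C) YC scalerA exprSr.
have zp : z ^+ p = 1.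
  have /eqP := Ypow p; rewrite Cp mulmx1 -{1}[Y]scale1r -subr_eq0 -scalerBl.
  rewrite scaler_eq0 (negPf Y0) orbF.
  by rewrite subr_eq0 eq_sym => /eqP.
have z1 : z != 1.
  apply: contraNneq Y0 => z1; rewrite -YE -[Y * E]/(Y *m E) /E -scalemxAr mulmx_sumr.
  rewrite (eq_bigr (fun=> Y)) => [|i _]; last by rewrite Ypow z1 expr1n scale1r.
  by rewrite sumr_const card_ord -scaler_nat scalerA mulVf // scale1r.
pose K := kermx (C - z%:M); pose k := \rank K.
have k0 : (0 < k)%N.
  rewrite lt0n mxrank_eq0 -submx0; apply: contraNN Y0 => K0.
  rewrite -submx0 (submx_trans _ K0) //; apply/sub_kermxP.
  by rewrite mulmxBr mul_mx_scalar -[Y *m C]/(Y * C) YC subrr.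
have kn : (k < p)%N by apply: leq_ltn_trans np; exact: rank_leq_row.
pose B := row_base K.
have BC : B *m C = z *: B.
  apply/eqP; rewrite -subr_eq0 -mul_mx_scalar -mulmxBr.
  by apply/eqP/sub_kermxP; rewrite eq_row_base.
have Bpow i : B *m mx_pow C i = z ^+ i *: B.
  elim: i => [|i IH]; first by rewrite mulmx1 scale1r.
  by rewrite mx_powSr mulmxA IH -scalemxAl BC scalerA exprSr.
have restrict M : C *m M = M *m C -> M \in unitmx ->
    exists M' : 'M[F]_k, M' \in unitmx /\ B *m M = M' *m B.
  move=> CM Mu.
  have sub : (B *m M <= B)%MS.
    rewrite eq_row_base; apply/sub_kermxP.
    by rewrite mulmxBr mul_mx_scalar -mulmxA -CM mulmxA BC -scalemxAl subrr.
  have /submxP[M' BM] := sub; exists M'; split => //.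
  rewrite -row_free_unit /row_free eqn_leq rank_leq_row /=.
  apply: leq_trans (mxrankM_maxl M' B); rewrite -BM mxrankMfree ?row_free_unit //.
  by rewrite (eqP (row_base_free K)).
have [W' [W'u BW]] := restrict W CW Wu.
have [V' [V'u BV]] := restrict V CV Vu.
have W'V' : W' *m V' = z ^+ m *: (V' *m W').
  apply: (row_free_inj (row_base_free K)).
  rewrite -/B; transitivity (B *m W *m V).
    by rewrite -(mulmxA W') -BV (mulmxA W') -BW.
  rewrite -(mulmxA B W) WV (mulmxA B) (mulmxA B V) BV -(mulmxA V' B) Bpow -scalemxAr -!scalemxAl.
  by rewrite -(mulmxA V' B) BW (mulmxA V' W').
have zmk : z ^+ (m * k) = 1.
  have := congr1 determinant W'V'; rewrite detZ !det_mulmx [in RHS](mulrC (\det V')).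
  rewrite -{1}[_ * _]mul1r exprM => /(mulIf _) -> //.
  by rewrite mulf_neq0 // -unitfE -unitmxE.
have [d dz dp] := prim_order_exists (prime_gt0 p_pr) zp.
have /(primeP p_pr).2 := dp; case/orP => /eqP dE; rewrite {}dE in dz.
  by exfalso; move/eqP: z1; apply; have := prim_expr_order dz.
have : (p %| m * k)%N by rewrite (prim_order_dvd dz) zmk.
by rewrite Euclid_dvdM // (negPf pm) /= gtnNdvd.
Qed.

Lemma map_mx_pow (F L : fieldType) (f : {rmorphism F -> L}) n (C : 'M[F]_n) i :
  map_mx f (mx_pow C i) = mx_pow (map_mx f C) i.
Proof. by elim: i => [|i IH]; rewrite ?map_mx1 //= map_mxM IH. Qed.

Lemma mx_heisenberg (F : finFieldType) n p m (W V C : 'M[F]_n) :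
  prime p -> p%:R != 0 :> F -> (n < p)%N -> ~~ (p %| m)%N ->
  mx_pow C p = 1%:M -> W \in unitmx -> V \in unitmx ->
  C *m W = W *m C -> C *m V = V *m C -> W *m V = V *m mx_pow C m *m W ->
  C = 1%:M.
Proof.
move=> p_pr p0 np pm Cp Wu Vu CW CV WV.
have monic_Xp (K : fieldType) : ('X^p - 1 : {poly K}) \is monic.
  by rewrite monicXnsubC ?prime_gt0.
have [L [zs Xzs _]] := FinSplittingFieldFor (monic_neq0 (monic_Xp F)).
pose f : {rmorphism F -> L} := in_alg L.
have Xp : 'X^p - 1 = \prod_(z <- zs) ('X - z%:P) :> {poly L}.
  apply/eqP; rewrite -eqp_monic ?monic_Xp ?monic_prod_XsubC //.
  by rewrite -[X in X %= _](_ : map_poly f ('X^p - 1) = _) // rmorphB rmorph1 rmorphXn /= map_polyX.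
apply: (@map_mx_inj _ _ f); rewrite map_mx1.
apply: (mx_heisenberg_split (m := m) (W := map_mx f W) (V := map_mx f V) p_pr _ np pm Xp).
- by rewrite -(rmorph_nat f) fmorph_eq0.
- by rewrite -map_mx_pow Cp map_mx1.
- by rewrite map_unitmx.
- by rewrite map_unitmx.
- by rewrite -!map_mxM CW.
- by rewrite -!map_mxM CV.
- by rewrite -map_mx_pow -!map_mxM WV.
Qed.

(** * Orders of vanishing at the origin and linear parts *)

Section OrderOfVanishing.
Variables (n : nat) (K : fieldType).
Local Notation P := (mpoly.mpoly n K).
Local Notation coef := mpoly.mcoeff.
Local Notation Xv i := (mpoly.mpolyX K (mpoly.mnm1 i)).
Local Notation mdeg := mpoly.mdeg.
Implicit Types (f g r : P) (b c : n.-tuple P) (a d e : nat).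

Definition vanishing d f := forall m, (mdeg m < d)%N -> coef m f = 0.

Lemma vanishing0 d : vanishing d 0.
Proof. by move=> m _; exact: mpoly.mcoeff0. Qed.

Lemma vanishingD d f g : vanishing d f -> vanishing d g -> vanishing d (f + g).
Proof. by move=> vf vg m md; rewrite mpoly.mcoeffD vf // vg // addr0. Qed.

Lemma vanishingB d f g : vanishing d f -> vanishing d g -> vanishing d (f - g).
Proof. by move=> vf vg m md; rewrite mpoly.mcoeffB vf // vg // subr0. Qed.

Lemma vanishingZ d k f : vanishing d f -> vanishing d (k *: f).
Proof. by move=> vf m md; rewrite mpoly.mcoeffZ vf // mulr0. Qed.

Lemma vanishing_sum d (I : Type) (s : seq I) (Q : pred I) (F : I -> P) :
  (forall i, Q i -> vanishing d (F i)) -> vanishing d (\sum_(i <- s | Q i) F i).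
Proof.
move=> vF; elim/big_ind: _ => //; [exact: vanishing0 | exact: vanishingD].
Qed.

Lemma sub_vanishing d e f : (d <= e)%N -> vanishing e f -> vanishing d f.
Proof. by move=> de vf m md; apply: vf; exact: leq_trans md de. Qed.

Lemma vanishingM d e f g : vanishing d f -> vanishing e g -> vanishing (d + e) (f * g).
Proof.
move=> vf vg m md; rewrite mpoly.mcoeffM big1 // => k /eqP mk.
have := mpoly.mdegD k.1 k.2; rewrite -mk => mdE.
have [h|h] := ltnP (mdeg k.1) d; first by rewrite vf // mul0r.
rewrite vg ?mulr0 // -(ltn_add2l d); apply: leq_ltn_trans md.
by apply: (leq_trans (leq_add h (leqnn _))); rewrite -mdE.
Qed.

Lemma vanishingX i : vanishing 1 (Xv i).
Proof.
move=> m; rewrite ltnS leqn0 mpoly.mdeg_eq0 mpoly.mcoeffX => /eqP ->.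
by case: eqP => // /(congr1 mdeg); rewrite mpoly.mdeg1 mpoly.mdeg0.
Qed.

Lemma vanishing_eq0 f : (forall d, vanishing d f) -> f = 0.
Proof. by move=> vf; apply/mpoly.mpolyP => m; rewrite mpoly.mcoeff0 (vf (mdeg m).+1). Qed.

Lemma vanishing_support d f m : vanishing d f -> m \in mpoly.msupp f -> (d <= mdeg m)%N.
Proof.
move=> vf; rewrite mpoly.mcoeff_msupp leqNgt; apply: contraNN => /vf ->.
exact: eqxx.
Qed.

Lemma vanishing_prod b (m : mpoly.multinom n) : (forall i, vanishing 1 (tnth b i)) ->
  vanishing (mdeg m) (\prod_i tnth b i ^+ m i).
Proof.
move=> vb; rewrite mpoly.mdegE; elim/big_ind2: _ => [|d f e g vf vg|i _]; first by move=> m'.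
  exact: vanishingM.
elim: (m i) => [|k IH]; first by move=> m'.
by rewrite exprS -add1n; exact: vanishingM.
Qed.

Lemma vanishing_comp b d f : (forall i, vanishing 1 (tnth b i)) -> vanishing d f ->
  vanishing d (mpoly.comp_mpoly b f).
Proof.
move=> vb vf; rewrite mpoly.comp_mpolyE big_seq; apply: vanishing_sum => m mf.
apply/vanishingZ/(sub_vanishing (vanishing_support vf mf))/vanishing_prod/vb.
Qed.

(** Equality of the homogeneous parts of degree [d]; both orders of vanishing are recorded to make
    the relation multiplicative. *)
Definition tangent d f g := [/\ vanishing d f, vanishing d g & vanishing d.+1 (f - g)].

Lemma tangentM d e f g f' g' : tangent d f g -> tangent e f' g' ->
  tangent (d + e) (f * f') (g * g').
Proof.
move=> [vf vg vfg] [vf' vg' vfg']; split; [exact: vanishingM|exact: vanishingM|].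
have -> : f * f' - g * g' = (f - g) * f' + g * (f' - g') by ring.
by apply: vanishingD; [rewrite -addSn | rewrite -addnS]; exact: vanishingM.
Qed.

Lemma tangent_comp c d f : (forall i, vanishing 2 (tnth c i - Xv i)) -> vanishing d f ->
  vanishing d.+1 (mpoly.comp_mpoly c f - f).
Proof.
move=> vc vf.
have vc1 i : tangent 1 (tnth c i) (Xv i).
  split; [|exact: vanishingX|exact: vc].
  rewrite -(subrK (Xv i) (tnth c i)); apply: vanishingD (vanishingX i).
  exact: sub_vanishing (vc i).
rewrite {2}(mpoly.mpolyE f) mpoly.comp_mpolyE -sumrB big_seq.
apply: vanishing_sum => m mf; rewrite -scalerBr; apply: vanishingZ.
apply: (@sub_vanishing _ (mdeg m).+1); first by rewrite ltnS; exact: vanishing_support mf.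
rewrite [mpoly.mpolyX _ _]mpoly.mpolyXE_id.
suff [] : tangent (mdeg m) (\prod_i tnth c i ^+ m i) (\prod_i Xv i ^+ m i) by [].
have tangent1 : tangent 0 1 1 by split; rewrite ?subrr //; exact: vanishing0.
rewrite mpoly.mdegE; elim/big_ind3: _ => // [d1 f1 g1 d2 f2 g2|i _]; first exact: tangentM.
elim: (m i) => // k IH; rewrite !exprS -add1n; exact: tangentM.
Qed.

(* If c_i = X_i + h_i with all h_i of order d >= 2, the j-th iterate of c is
   X_i + j h_i modulo order d + 1. *)
Lemma tangent_identity_torsion p c : p%:R != 0 :> K ->
  (forall i, vanishing 2 (tnth c i - Xv i)) ->
  (forall i, iter p (mpoly.comp_mpoly c) (Xv i) = Xv i) -> forall i, tnth c i = Xv i.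
Proof.
move=> p0 vc cp i; apply/eqP; rewrite -subr_eq0; apply/eqP/vanishing_eq0 => d.
suff : forall i, vanishing d.+2 (tnth c i - Xv i).
  by move=> /(_ i); apply: sub_vanishing; lia.
elim: d {i} => [//|d IH] i.
pose T := mpoly.comp_mpoly c; pose h := tnth c i - Xv i.
have TX : T (Xv i) = Xv i + h by rewrite /T mpoly.comp_mpolyXU -tnth_nth /h addrC subrK.
have vT d' f : vanishing d' f -> vanishing d' (T f).
  move=> vf; rewrite -(subrK f (T f)); apply: (vanishingD _ vf).
  exact: sub_vanishing (leqnSn d') (tangent_comp vc vf).
have step j : vanishing d.+3 (iter j T (Xv i) - Xv i - j%:R *: h).
  elim: j => [|j IHj]; first by rewrite /= subrr scale0r subr0; exact: vanishing0.
  have E : iter j T (Xv i) = Xv i + j%:R *: h + (iter j T (Xv i) - Xv i - j%:R *: h).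
    by move: (iter _ _ _) (_ *: h) => x y; ring.
  set r := iter j T (Xv i) - Xv i - j%:R *: h in IHj E.
  rewrite iterS E /T mpoly.comp_mpolyD mpoly.comp_mpolyD mpoly.comp_mpolyZ -!/(T _) TX -natr1.
  have -> : Xv i + h + j%:R *: T h + T r - Xv i - (j%:R + 1) *: h = j%:R *: (T h - h) + T r.
    have E' (x y z t u : P) : t + z + x + u - t - (y + z) = x - y + u by ring.
    by rewrite scalerDl scale1r (scalerBr j%:R (T h) h); exact: E'.
  apply: vanishingD; last exact: vT.
  by apply/vanishingZ/tangent_comp/IH.
have := step p; rewrite (cp i) subrr sub0r => /(vanishingZ (- p%:R^-1)).
by rewrite scalerN scaleNr opprK scalerA mulVf // scale1r.
Qed.

Definition linear_part c : 'M[K]_n := \matrix_(i, j) coef (mpoly.mnm1 j) (tnth c i).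

Lemma linear_part_comp b c :
  (forall i, vanishing 1 (tnth b i)) -> (forall i, vanishing 1 (tnth c i)) ->
  linear_part [tuple mpoly.comp_mpoly c (tnth b i) | i < n] = linear_part b *m linear_part c.
Proof.
move=> vb vc; apply/matrixP => i j; rewrite !mxE tnth_mktuple.
pose r := tnth b i - \sum_k coef (mpoly.mnm1 k) (tnth b i) *: Xv k.
have vr : vanishing 2 r.
  move=> m; rewrite ltnS leq_eqVlt ltnS leqn0 => /orP[/mpoly.mdeg1P[l /eqP ->]|m0].
    rewrite /r mpoly.mcoeffB raddf_sum (bigD1 l) //= mpoly.mcoeffZ mpoly.mcoeffXU eqxx mulr1.
    rewrite big1 ?addr0 ?subrr // => k kl.
    by rewrite mpoly.mcoeffZ mpoly.mcoeffXU (negPf kl) mulr0.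
  have : vanishing 1 r.
    apply: vanishingB => //; apply: vanishing_sum => k _; exact/vanishingZ/vanishingX.
  by apply; rewrite (eqP m0).
have -> : tnth b i = \sum_k coef (mpoly.mnm1 k) (tnth b i) *: Xv k + r by rewrite /r addrC subrK.
rewrite mpoly.comp_mpolyD mpoly.mcoeffD [X in _ + X](vanishing_comp vc vr) ?mpoly.mdeg1 // addr0.
rewrite [mpoly.comp_mpoly c (\sum_k _)]raddf_sum raddf_sum /=; apply: eq_bigr => k _ /=.
by rewrite mpoly.comp_mpolyZ mpoly.mcoeffZ mpoly.comp_mpolyXU -tnth_nth !mxE.
Qed.
End OrderOfVanishing.

Lemma card_fixed_prime_power (T : finType) (s : {perm T}) (S : {set T}) p e :
  prime p -> (s ^+ (p ^ e) = 1)%g -> {in S, forall x, s x \in S} -> ~~ (p %| #|S|)%N ->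
  ~~ (p %| #|[set x in S | s x == x]|)%N.
Proof.
move=> p_pr sp sS pS.
have pG : (p.-group <[s]>)%g.
  rewrite /pgroup -/(order s); apply: (@pnat_dvd _ (p ^ e)).
    by rewrite order_dvdn sp.
  by rewrite pnatX pnat_id.
have actsS : [acts <[s]>, on S | 'P]%g.
  by rewrite cycle_subG !inE; apply/fintype.subsetP => x xS; rewrite inE; exact: sS.
have := pgroup_fix_mod pG actsS; rewrite afix_cycle.
have -> : ('Fix_(S | 'P)[s] = [set x in S | s x == x])%g.
  by apply/setP => x; rewrite !inE finset.sub1set inE.
by move=> E; move: pS; rewrite /dvdn E.
Qed.

Lemma card_finField_pchar (F : finFieldType) p : prime p -> p%:R != 0 :> F -> ~~ (p %| #|F|)%N.
Proof.
move=> p_pr p0.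
have [q q_pr qF] := finPcharP F.
rewrite (card_pprimeChar qF) Euclid_dvdX // dvdn_prime2 // negb_and.
by apply/orP; left; apply: contraNneq p0 => ->; rewrite (pcharf0 qF).
Qed.

(** * Automorphisms acting on the points over a finite field *)

Section PointAction.
Variables (n : nat) (F : finFieldType).
Local Notation P := (mpoly.mpoly n F).
Local Notation Xv i := (mpoly.mpolyX F (mpoly.mnm1 i)).
Implicit Types (a b : Aut_affine F n) (f g : polymap F n) (x y : {ffun 'I_n -> F}).

Definition point_map f x : {ffun 'I_n -> F} := [ffun i => mpoly.meval x (tnth f i)].

Lemma point_map_comp f g x : point_map (polymap_comp f g) x = point_map f (point_map g x).
Proof.
apply/ffunP => i; rewrite !ffunE tnth_mktuple mpoly.comp_mpoly_meval.
by apply: mpoly.meval_eq => j; rewrite ffunE.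
Qed.

Lemma point_map_id x : point_map (polymap_id F n) x = x.
Proof. by apply/ffunP => i; rewrite ffunE tnth_mktuple mpoly.mevalXU. Qed.

Definition aut_act a := point_map (val a).1.

Lemma aut_actM a b x : aut_act (a * b)%g x = aut_act a (aut_act b x).
Proof. exact: point_map_comp. Qed.

Lemma aut_act1 x : aut_act 1%g x = x.
Proof. exact: point_map_id. Qed.

Lemma aut_actX a i x : aut_act (a ^+ i)%g x = iter i (aut_act a) x.
Proof. by elim: i => [|i IH]; rewrite ?expg0 ?aut_act1 // expgS aut_actM IH. Qed.

Lemma act_inj a : injective (aut_act a).
Proof. by apply: (can_inj (g := aut_act a^-1%g)) => x; rewrite -aut_actM mulVg aut_act1. Qed.

Definition act_perm a : {perm {ffun 'I_n -> F}} := perm (@act_inj a).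

Lemma act_permX a i x : (act_perm a ^+ i)%g x = aut_act (a ^+ i)%g x.
Proof. by rewrite permX aut_actX; apply: eq_iter => y; rewrite permE. Qed.

Lemma translation_subproof x :
  let f := [tuple Xv i + mpoly.mpolyC n (x i) | i < n] in
  let g := [tuple Xv i - mpoly.mpolyC n (x i) | i < n] in
  (polymap_comp f g == polymap_id F n) && (polymap_comp g f == polymap_id F n).
Proof.
apply/andP; split; apply/eqP/eq_from_tnth => i; rewrite !tnth_mktuple.
  by rewrite mpoly.comp_mpolyD mpoly.comp_mpolyC mpoly.comp_mpolyXU -tnth_nth tnth_mktuple subrK.
by rewrite mpoly.comp_mpolyB mpoly.comp_mpolyC mpoly.comp_mpolyXU -tnth_nth tnth_mktuple addrK.
Qed.

(** Brings a common fixed point to the origin, where [vanishing] and [linear_part] are read. *)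
Definition translation x : Aut_affine F n := exist _ (_, _) (translation_subproof x).

Lemma aut_act_translation x : aut_act (translation x) [ffun=> 0] = x.
Proof.
apply/ffunP => i; rewrite ffunE tnth_mktuple mpoly.mevalD mpoly.mevalC mpoly.mevalXU.
by rewrite ffunE add0r.
Qed.

Lemma vanishing_act0 a i : aut_act a [ffun=> 0] = [ffun=> 0] -> vanishing 1 (tnth (val a).1 i).
Proof.
move=> /ffunP/(_ i); rewrite !ffunE => ai m; rewrite ltnS leqn0 mpoly.mdeg_eq0 => /eqP ->.
rewrite -[RHS]ai {1}(mpoly.mpolyE (tnth _ i)) raddf_sum mpoly.mevalE /=.
apply: eq_bigr => m' _; rewrite mpoly.mcoeffZ mpoly.mcoeffX; congr (_ * _).
have [->|m'0] := eqVneq m' mpoly.mnm0.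
  by rewrite big1 // => j _; rewrite mpoly.mnm0E expr0.
have [j mj] : exists j, m' j != 0%N.
  apply/existsP; apply: contraNT m'0 => /existsPn m'0; apply/eqP/mpoly.mnmP => j.
  by rewrite mpoly.mnm0E; apply/eqP; have := m'0 j; rewrite negbK.
by rewrite (bigD1 j) //= ffunE expr0n (negPf mj) mul0r.
Qed.

Definition jac a := linear_part (val a).1.

Lemma jacM a b : aut_act a [ffun=> 0] = [ffun=> 0] -> aut_act b [ffun=> 0] = [ffun=> 0] ->
  jac (a * b)%g = jac a *m jac b.
Proof. by move=> a0 b0; apply: linear_part_comp => i; exact: vanishing_act0. Qed.

Lemma jac1 : jac 1%g = 1%:M.
Proof.
by apply/matrixP => i j; rewrite !mxE tnth_mktuple mpoly.mcoeffXU.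
Qed.

Lemma Aut_identity_torsion p a : p%:R != 0 :> F -> (a ^+ p = 1)%g ->
  aut_act a [ffun=> 0] = [ffun=> 0] -> jac a = 1%:M -> a = 1%g.
Proof.
move=> p0 ap a0 Ja; apply: Aut_affine_inj; apply: eq_from_tnth => i.
rewrite [RHS]tnth_mktuple; apply: tangent_identity_torsion p0 _ _ i.
  move=> i m; rewrite ltnS leq_eqVlt ltnS leqn0 => /orP[/mpoly.mdeg1P[l /eqP ->]|m0].
    have /matrixP/(_ i l) := Ja; rewrite !mxE mpoly.mcoeffB mpoly.mcoeffXU => ->.
    by rewrite subrr.
  have : vanishing 1 (tnth (val a).1 i - Xv i).
    by apply: vanishingB (@vanishingX n F i); exact: vanishing_act0.
  by apply; rewrite (eqP m0).
move=> i; have iterE k : iter k (mpoly.comp_mpoly (val a).1) (Xv i) = tnth (val (a ^+ k)%g).1 i.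
  elim: k => [|k IH]; first by rewrite tnth_mktuple.
  by rewrite iterS IH expgSr tnth_mktuple.
by rewrite iterE ap tnth_mktuple.
Qed.

Lemma jac_unit a : aut_act a [ffun=> 0] = [ffun=> 0] -> jac a \in unitmx.
Proof.
move=> a0; have aV0 : aut_act a^-1%g [ffun=> 0] = [ffun=> 0].
  by rewrite -[X in aut_act _ X]a0 -aut_actM mulVg aut_act1.
by have := jacM a0 aV0; rewrite mulgV jac1 => /esym/mulmx1_unit[].
Qed.

Lemma jacX a i : aut_act a [ffun=> 0] = [ffun=> 0] -> jac (a ^+ i)%g = mx_pow (jac a) i.
Proof.
move=> a0; elim: i => [|i IH]; first by rewrite expg0 jac1.
by rewrite expgS jacM ?IH // aut_actX; elim: i {IH} => //= i ->.
Qed.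

Theorem Aut_finite_heisenberg p (u v c : Aut_affine F n) : prime p -> p%:R != 0 :> F ->
  (n < p)%N -> (v ^+ p = 1)%g -> (c ^+ p = 1)%g -> (v * c = c * v)%g -> (u * c = c * u)%g ->
  (u * v = v * c * u)%g -> c = 1%g.
Proof.
move=> p_pr p0 np vp cp vc uc uv.
(* [m] is the part prime to p of the order of the permutation of the points induced by [u]; as a
   polynomial automorphism, [u] itself may have infinite order. *)
have [m cpm Nm] := pfactor_coprime p_pr (order_gt0 (act_perm u)).
set e := logn p _ in Nm; pose w := (u ^+ m)%g.
have pm : ~~ (p %| m)%N by rewrite -(prime_coprime _ p_pr).
have wq : (act_perm w ^+ (p ^ e) = 1)%g.
  by apply/permP => x; rewrite act_permX /w -expgM -Nm -act_permX expg_order.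
have pow1 a : (a ^+ p = 1)%g -> (act_perm a ^+ (p ^ 1) = 1)%g.
  by move=> ap; apply/permP => x; rewrite expn1 act_permX ap aut_act1 perm1.
pose fixed a := [set x | act_perm a x == x].
have stable a b : (a * b = b * a)%g -> forall x, x \in fixed a -> act_perm b x \in fixed a.
  by move=> ab x; rewrite !inE !permE -aut_actM ab aut_actM => /eqP ->.
have pT : ~~ (p %| #|[set: {ffun 'I_n -> F}]|)%N.
  rewrite cardsT card_ffun card_ord (Euclid_dvdX _ _ p_pr) negb_and.
  by rewrite (card_finField_pchar p_pr p0).
have pc := card_fixed_prime_power p_pr (pow1 c cp) (fun x _ => finset.in_setT _) pT.
set S1 := [set x in _ | _] in pc.
have S1E x : (x \in S1) = (x \in fixed c) by rewrite !inE.
have pcv : ~~ (p %| #|[set x in S1 | act_perm v x == x]|)%N.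
  apply: card_fixed_prime_power p_pr (pow1 v vp) _ pc => x.
  by rewrite !S1E; apply: stable.
set S2 := [set x in S1 | _] in pcv.
have S2E x : (x \in S2) = (x \in fixed c) && (x \in fixed v) by rewrite inE S1E !inE.
have wv : (w * v = v * c ^+ m * w)%g by exact: heis_conj.
have wc : (w * c = c * w)%g by apply: esym; apply: commuteX; exact: esym.
have fixedE a x : (x \in fixed a) = (aut_act a x == x) by rewrite inE permE.
have : ~~ (p %| #|[set x in S2 | act_perm w x == x]|)%N.
  apply: card_fixed_prime_power p_pr wq _ pcv => x.
  rewrite !S2E => /andP[cx vx]; rewrite (stable _ _ (esym wc) _ cx) andTb; move: cx vx.
  rewrite !fixedE permE => /eqP cx /eqP vx.
  have cmx : aut_act (c ^+ m)%g x = x.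
    by rewrite aut_actX; elim: (m) => [|k IH]; [reflexivity | rewrite iterS IH cx].
  (* Evaluated at a point fixed by [v] and [c], this says that [v] fixes its image under [w]: the
     common fixed points of [v] and [c] are stable under [w]. *)
  have vwc : (v * w * c ^+ m = w * v)%g.
    have wcm : (w * c ^+ m = c ^+ m * w)%g by exact: commuteX.
    by rewrite wv -mulgA wcm mulgA.
  by move: (congr1 (aut_act ^~ x) vwc); rewrite /= !aut_actM cmx vx => ->.
have [->|[x]] := set_0Vmem [set x in S2 | act_perm w x == x].
  by rewrite cards0 dvdn0.
rewrite inE S2E !fixedE permE => /andP[/andP[/eqP cx /eqP vx] /eqP wx] _.
pose t := translation x.
have t0 : aut_act t [ffun=> 0] = x by exact: aut_act_translation.
have conj0 a : aut_act a x = x -> aut_act (a ^ t)%g [ffun=> 0] = [ffun=> 0].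
  move=> ax; rewrite /conjg !aut_actM t0 ax -{1}t0 -aut_actM mulVg; exact: aut_act1.
have [[cx0 vx0] wx0] := (conj0 c cx, conj0 v vx, conj0 w wx).
have Jpow i : jac ((c ^ t) ^+ i)%g = mx_pow (jac (c ^ t)%g) i by exact: jacX.
have ctm0 : aut_act ((c ^ t) ^+ m)%g [ffun=> 0] = [ffun=> 0].
  by rewrite aut_actX; elim: (m) => [|k IH]; [reflexivity | rewrite iterS IH cx0].
have Jcp : mx_pow (jac (c ^ t)%g) p = 1%:M by rewrite -Jpow -conjXg cp conj1g jac1.
have Jcomm a b : aut_act a [ffun=> 0] = [ffun=> 0] -> aut_act b [ffun=> 0] = [ffun=> 0] ->
    (a * b = b * a)%g -> jac a *m jac b = jac b *m jac a.
  move=> a0 b0 ab; exact: etrans (esym (jacM a0 b0)) (etrans (congr1 jac ab) (jacM b0 a0)).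
have conj_comm a b : (a * b = b * a)%g -> (a ^ t * b ^ t = b ^ t * a ^ t)%g.
  by move=> ab; rewrite -!conjMg ab.
have Jcw := Jcomm _ _ cx0 wx0 (conj_comm _ _ (esym wc)).
have Jcv := Jcomm _ _ cx0 vx0 (conj_comm _ _ (esym vc)).
have vcm0 : aut_act ((v ^ t) * (c ^ t) ^+ m)%g [ffun=> 0] = [ffun=> 0].
  by rewrite aut_actM ctm0 vx0.
have wvt : ((w ^ t) * (v ^ t) = (v ^ t) * (c ^ t) ^+ m * (w ^ t))%g.
  by rewrite -(conjXg c t m) -(conjMg w v t) wv !conjMg.
have Jvcm : jac ((v ^ t) * (c ^ t) ^+ m)%g = jac (v ^ t)%g *m mx_pow (jac (c ^ t)%g) m.
  exact: etrans (jacM vx0 ctm0) (congr1 (mulmx (jac (v ^ t)%g)) (Jpow m)).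
have Jwv : jac (w ^ t)%g *m jac (v ^ t)%g =
    jac (v ^ t)%g *m mx_pow (jac (c ^ t)%g) m *m jac (w ^ t)%g.
  exact: etrans (esym (jacM wx0 vx0)) (etrans (congr1 jac wvt)
    (etrans (jacM vcm0 wx0) (congr1 (fun M => M *m jac (w ^ t)%g) Jvcm))).
have Jc : jac (c ^ t)%g = 1%:M.
  exact: (mx_heisenberg p_pr p0 np pm Jcp (jac_unit wx0) (jac_unit vx0) Jcw Jcv Jwv).
have : (c ^ t)%g = 1%g.
  by apply: Aut_identity_torsion p0 _ cx0 Jc; rewrite -conjXg cp conj1g.
by move/(congr1 (fun a => a ^ t^-1)%g); rewrite conjgK conj1g.
Qed.
End PointAction.

(** * Lifting and reducing the coefficients of polynomial maps *)

Section CoefficientMaps.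
Variable n : nat.
Local Notation tup R := (n.-tuple (mpoly.mpoly n R)).

Definition map_polymap (R S : comNzRingType) (f : R -> S) (t : tup R) : tup S :=
  [tuple mpoly.map_mpoly f (tnth t i) | i < n].

Definition tuple_comp (R : comNzRingType) (t s : tup R) : tup R :=
  [tuple mpoly.comp_mpoly s (tnth t i) | i < n].

Definition tuple_id (R : comNzRingType) : tup R := [tuple mpoly.mpolyX R (mpoly.mnm1 i) | i < n].

Lemma map_mpoly_comp_mpoly (R S : comNzRingType) (f : {rmorphism R -> S}) (t : tup R) q :
  mpoly.map_mpoly f (mpoly.comp_mpoly t q) =
  mpoly.comp_mpoly (map_polymap f t) (mpoly.map_mpoly f q).
Proof.
pose w := maxn (mpoly.msize q) (mpoly.msize (mpoly.map_mpoly f q)).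
rewrite (@mpoly.comp_mpolywE _ _ _ q t w) ?leq_maxl //.
rewrite (@mpoly.comp_mpolywE _ _ _ _ _ w) ?leq_maxr //.
rewrite raddf_sum; apply: eq_bigr => m _ /=.
rewrite mpoly.map_mpolyZ mpoly.mcoeff_map_mpoly rmorph_prod; congr (_ *: _).
by apply: eq_bigr => i _; rewrite rmorphXn tnth_mktuple.
Qed.

Lemma map_polymap_comp (R S : comNzRingType) (f : {rmorphism R -> S}) (t s : tup R) :
  map_polymap f (tuple_comp t s) = tuple_comp (map_polymap f t) (map_polymap f s).
Proof.
by apply: eq_from_tnth => i; rewrite !tnth_mktuple map_mpoly_comp_mpoly.
Qed.

Lemma map_polymap_id (R S : comNzRingType) (f : {rmorphism R -> S}) :
  map_polymap f (tuple_id R) = tuple_id S.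
Proof. by apply: eq_from_tnth => i; rewrite !tnth_mktuple mpoly.map_mpolyX. Qed.

Section Specialization.
Variables (R : comNzRingType) (K F : fieldType).
Variables (iota : {rmorphism R -> K}) (phi : {rmorphism R -> F}).
Hypothesis ker : forall x, iota x = 0 -> phi x = 0.

Lemma map_polymap_ker (t s : tup R) : map_polymap iota t = map_polymap iota s ->
  map_polymap phi t = map_polymap phi s.
Proof.
move=> ts; apply: eq_from_tnth => i; apply/mpoly.mpolyP => m.
have := congr1 (fun u => mpoly.mcoeff m (tnth u i)) ts.
rewrite !tnth_mktuple !mpoly.mcoeff_map_mpoly => /eqP; rewrite -subr_eq0 -rmorphB => /eqP/ker.
by rewrite rmorphB => /eqP; rewrite subr_eq0 => /eqP.
Qed.

(** A relation and not a map: the lift [t] is unique only up to the kernel of [iota], and over R it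
    need not be invertible. *)
Definition specializes (a : Aut_affine K n) (a' : Aut_affine F n) :=
  exists t, map_polymap iota t = (val a).1 /\ map_polymap phi t = (val a').1.

Lemma specializes1 : specializes 1%g 1%g.
Proof. by exists (tuple_id R); rewrite !map_polymap_id. Qed.

Lemma specializesM a b a' b' : specializes a a' -> specializes b b' ->
  specializes (a * b)%g (a' * b')%g.
Proof.
move=> [t [ta ta']] [s [sb sb']]; exists (tuple_comp t s).
by rewrite !map_polymap_comp ta ta' sb sb'.
Qed.

Lemma specializesX a a' k : specializes a a' -> specializes (a ^+ k)%g (a' ^+ k)%g.
Proof.
move=> aa'; elim: k => [|k IH]; first by rewrite !expg0; exact: specializes1.
by rewrite !expgS; exact: specializesM.
Qed.

Lemma specializes_uniq a b a' b' : specializes a a' -> specializes b b' -> a = b -> a' = b'.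
Proof.
move=> [t [ta ta']] [s [sb sb']] ab; apply: Aut_affine_inj.
by rewrite -ta' -sb'; apply: map_polymap_ker; rewrite ta sb ab.
Qed.

(** The two lifts are inverse to each other modulo the kernel of [iota], which [phi] kills. *)
Lemma specialize_Aut (a : Aut_affine K n) t1 t2 :
  map_polymap iota t1 = (val a).1 -> map_polymap iota t2 = (val a).2 ->
  exists a' : Aut_affine F n, (val a').1 = map_polymap phi t1.
Proof.
move=> ta1 ta2; have /andP[/eqP a12 /eqP a21] := valP a.
have comp_id s1 s2 : tuple_comp (map_polymap iota s1) (map_polymap iota s2) = tuple_id K ->
    polymap_comp (map_polymap phi s1) (map_polymap phi s2) == polymap_id F n.
  move=> E; apply/eqP; rewrite -[LHS]map_polymap_comp -[RHS](map_polymap_id phi).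
  by apply: map_polymap_ker; rewrite map_polymap_comp map_polymap_id.
have inv : (polymap_comp (map_polymap phi t1) (map_polymap phi t2) == polymap_id F n) &&
    (polymap_comp (map_polymap phi t2) (map_polymap phi t1) == polymap_id F n).
  by apply/andP; split; apply: comp_id; rewrite ta1 ta2; [exact: a12|exact: a21].
by exists (exist _ (map_polymap phi t1, map_polymap phi t2) inv).
Qed.
End Specialization.

Definition coefficients (K : fieldType) (t : tup K) : seq K :=
  flatten [seq [seq mpoly.mcoeff m q | m <- mpoly.msupp q] | q <- t].

Lemma lift_polymap (R : comNzRingType) (K : fieldType) (iota : {rmorphism R -> K}) (t : tup K) :
  (forall x, x \in coefficients t -> exists r, iota r = x) ->
  exists s, map_polymap iota s = t.
Proof.
move=> lift.
have /choice[g hg] : forall x, exists r, x \in coefficients t -> iota r = x.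
  move=> x; have [xt|xt] := boolP (x \in coefficients t); last by exists 0.
  by have [r rx] := lift x xt; exists r.
exists [tuple \sum_(m <- mpoly.msupp (tnth t i))
    g (mpoly.mcoeff m (tnth t i)) *: mpoly.mpolyX R m | i < n].
apply: eq_from_tnth => i; rewrite !tnth_mktuple raddf_sum [RHS]mpoly.mpolyE /=.
rewrite !big_seq; apply: eq_bigr => m mi.
rewrite mpoly.map_mpolyZ mpoly.map_mpolyX hg //.
apply/flatten_mapP; exists (tnth t i); first exact: mem_tnth.
by apply/mapP; exists m.
Qed.

Theorem Aut_heisenberg (K : fieldType) p (u v c : Aut_affine K n) : prime p ->
  p%:R != 0 :> K -> (n < p)%N -> (v ^+ p = 1)%g -> (c ^+ p = 1)%g -> (v * c = c * v)%g ->
  (u * c = c * u)%g -> (u * v = v * c * u)%g -> c = 1%g.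
Proof.
move=> p_pr p0 np vp cp vc uc uv; apply: contrapT => c1.
pose coefs (a : Aut_affine K n) := coefficients (val a).1 ++ coefficients (val a).2.
have [R [iota [sp lift]]] := specializable_seq (coefs u ++ coefs v ++ coefs c).
have lifts (a : Aut_affine K n) : {subset coefs a <= coefs u ++ coefs v ++ coefs c} ->
    exists t1 t2, map_polymap iota t1 = (val a).1 /\ map_polymap iota t2 = (val a).2.
  move=> sub; have [|t1 ht1] := @lift_polymap R K iota (val a).1.
    by move=> x xa; apply/lift/sub; rewrite mem_cat xa.
  have [|t2 ht2] := @lift_polymap R K iota (val a).2.
    by move=> x xa; apply/lift/sub; rewrite mem_cat xa orbT.
  by exists t1, t2; split; [exact: ht1|exact: ht2].
have [u1 [u2 [hu1 hu2]]] :
    exists t1 t2, map_polymap iota t1 = (val u).1 /\ map_polymap iota t2 = (val u).2.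
  by apply: lifts => x xu; rewrite mem_cat xu.
have [v1 [v2 [hv1 hv2]]] :
    exists t1 t2, map_polymap iota t1 = (val v).1 /\ map_polymap iota t2 = (val v).2.
  by apply: lifts => x xv; rewrite mem_cat; apply/orP; right; rewrite mem_cat xv.
have [c1' [c2 [hc1 hc2]]] :
    exists t1 t2, map_polymap iota t1 = (val c).1 /\ map_polymap iota t2 = (val c).2.
  by apply: lifts => x xc; rewrite mem_cat; apply/orP; right; rewrite mem_cat xc orbT.
have [i [m cm]] : exists i m,
    mpoly.mcoeff m (tnth (val c).1 i) != mpoly.mcoeff m (tnth (polymap_id K n) i).
  apply: contrapT => same; apply: c1; apply: Aut_affine_inj; apply: eq_from_tnth => i.
  apply/mpoly.mpolyP => m; apply/eqP; apply: contrapT => /negP cm; apply: same.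
  by exists i, m.
(* That [phi] does not kill this product says at once that the specialized c is not the identity and
   that p is nonzero in the finite field. *)
pose r := (mpoly.mcoeff m (tnth c1' i) - mpoly.mcoeff m (tnth (tuple_id R) i)) * p%:R.
have ir : iota r != 0.
  rewrite rmorphM rmorph_nat; apply: mulf_neq0; last exact: p0.
  rewrite rmorphB subr_eq0.
  have := congr1 (fun t => mpoly.mcoeff m (tnth t i)) hc1.
  have := congr1 (fun t => mpoly.mcoeff m (tnth t i)) (map_polymap_id iota).
  by rewrite ![tnth (map_polymap _ _) _]tnth_mktuple !mpoly.mcoeff_map_mpoly => -> ->.
have [F [phi [ker]]] := sp r ir.
rewrite rmorphM rmorph_nat mulf_eq0 negb_or => /andP[cphi p0F].
have [u' hu'] := specialize_Aut ker hu1 hu2.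
have [v' hv'] := specialize_Aut ker hv1 hv2.
have [c' hc'] := specialize_Aut ker hc1 hc2.
have su : specializes iota phi u u' by exists u1; split; [exact: hu1|exact: esym hu'].
have sv : specializes iota phi v v' by exists v1; split; [exact: hv1|exact: esym hv'].
have sc : specializes iota phi c c' by exists c1'; split; [exact: hc1|exact: esym hc'].
have s1 := @specializes1 R K F iota phi.
have uniq := @specializes_uniq R K F iota phi ker.
have c'1 : c' = 1%g.
  apply: (@Aut_finite_heisenberg n F p u' v' c' p_pr p0F np).
  - exact: uniq (specializesX p sv) s1 vp.
  - exact: uniq (specializesX p sc) s1 cp.
  - exact: uniq (specializesM sv sc) (specializesM sc sv) vc.
  - exact: uniq (specializesM su sc) (specializesM sc su) uc.
  - exact: uniq (specializesM su sv) (specializesM (specializesM sv sc) su) uv.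
move/eqP: cphi; apply; rewrite rmorphB; apply/eqP; rewrite subr_eq0; apply/eqP.
have : map_polymap phi c1' = map_polymap phi (tuple_id R).
  by rewrite -hc' c'1 map_polymap_id.
move/(congr1 (fun t => mpoly.mcoeff m (tnth t i))).
by rewrite ![tnth (map_polymap _ _) _]tnth_mktuple !mpoly.mcoeff_map_mpoly.
Qed.
End CoefficientMaps.

(** * The Heisenberg subgroup *)

Lemma natr_eq0_prime_unique (F : fieldType) p q : prime p -> prime q ->
  p%:R = 0 :> F -> q%:R = 0 :> F -> p = q.
Proof.
move=> p_pr q_pr p0 q0; apply/eqP; apply: contraT; rewrite eq_sym -(dvdn_prime2 q_pr p_pr) => pq.
have : (gcdn p q)%:R = 0 :> F.
  have pF : p \in [pchar F] by rewrite inE p_pr p0 eqxx.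
  apply/eqP; rewrite -(dvdn_pcharf pF) dvdn_gcd dvdnn /=.
  by rewrite (dvdn_pcharf pF) q0.
have /eqP-> : coprime p q by rewrite coprime_sym prime_coprime.
by move/eqP; rewrite oner_eq0.
Qed.

Lemma prime_natr_neq0_above (F : fieldType) : exists m,
  forall p, prime p -> (m < p)%N -> p%:R != 0 :> F.
Proof.
have [[q [q_pr q0]]|none] := pselect (exists q, prime q /\ q%:R = 0 :> F).
  exists q => p p_pr qp; apply/eqP => p0.
  by rewrite (natr_eq0_prime_unique p_pr q_pr p0 q0) ltnn in qp.
by exists 0 => p p_pr _; apply/eqP => p0; apply: none; exists p.
Qed.

(** A root of 1 + X + ... + X^(p-1), whose value at 1 is p. *)
Lemma nontrivial_unity_root (k : closedFieldType) p : (1 < p)%N -> p%:R != 0 :> k ->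
  exists z : k, [/\ z != 0, z != 1 & z ^+ p = 1].
Proof.
move=> p1 p0; have p_gt0 : (0 < p)%N by exact: ltnW.
pose P : {poly k} := \poly_(i < p) 1.
have sP : size P = p by rewrite size_poly_eq // oner_neq0.
have /closed_rootP[z zP] : size P != 1 by rewrite sP neq_ltn p1 orbT.
have hP x : P.[x] = \sum_(i < p) x ^+ i.
  by rewrite horner_poly; apply: eq_bigr => i _; rewrite mul1r.
have zp : z ^+ p = 1.
  by apply/eqP; rewrite -subr_eq0 subrX1 -hP (eqP zP) mulr0.
exists z; split=> //.
  by apply/eqP => z0; move: zp; rewrite z0 expr0n gtn_eqF // => /eqP; rewrite eq_sym oner_eq0.
apply/eqP => z1; case/negP: p0; move: zP; rewrite /root hP z1.
by under eq_bigr do rewrite expr1n; rewrite sumr_const card_ord.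
Qed.

Section HeisenbergSubgroup.
Variable k : fieldType.

Definition unipotent_mx : 'M[int]_2 := \matrix_(i, j) (i <= j)%N%:Z.

Fact unipotent_subproof : \det unipotent_mx == 1.
Proof. by rewrite (expand_det_row _ 0) !big_ord_recl big_ord0 /cofactor !det_mx11 !mxE. Qed.

Definition unipotent : SL2Z := exist _ unipotent_mx unipotent_subproof.

Lemma rho_unipotent (z w : kstar k) : rho unipotent (z, w) = (z * w, w)%g.
Proof.
rewrite /rho; congr (_, _); apply: val_inj; rewrite /= !mxE /=.
  by rewrite !expr1z.
by rewrite expr0z expr1z mul1r.
Qed.

Definition torus_elt (z w : kstar k) : SL2Z_torus k := (1%g, (z, w)).
Definition unipotent_elt : SL2Z_torus k := (unipotent, 1%g).

Lemma torus_eltM z w z' w' : (torus_elt z w * torus_elt z' w' = torus_elt (z * z') (w * w'))%g.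
Proof.
congr (_, _); first exact: mulg1.
by rewrite [(_ * _)%g](_ : _ = ((z, w) : torus k) * rho 1%g (z', w'))%g // rho1.
Qed.

Lemma torus_eltX z w i : (torus_elt z w ^+ i = torus_elt (z ^+ i) (w ^+ i))%g.
Proof.
elim: i => [|i IH]; first by rewrite !expg0.
by rewrite !expgS IH torus_eltM.
Qed.

Lemma unipotent_elt_torus z w :
  (unipotent_elt * torus_elt z w = torus_elt (z * w) w * unipotent_elt)%g.
Proof.
have -> : (unipotent_elt * torus_elt z w = (unipotent * 1, 1 * rho unipotent (z, w)))%g by [].
have -> : (torus_elt (z * w) w * unipotent_elt = (1 * unipotent, (z * w, w) * rho 1 1))%g by [].
by rewrite rho_unipotent rho_one !mulg1 !mul1g.
Qed.

Lemma val_kstarX (z : kstar k) i : val (z ^+ i)%g = val z ^+ i.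
Proof. by elim: i => // i IH; rewrite expgS exprS -IH. Qed.
End HeisenbergSubgroup.

Lemma not_injective_of_heisenberg (k : closedFieldType) (G : groupType) p :
  (1 < p)%N -> p%:R != 0 :> k ->
  (forall u v c : G, (v ^+ p = 1)%g -> (c ^+ p = 1)%g -> (v * c = c * v)%g ->
    (u * c = c * u)%g -> (u * v = v * c * u)%g -> c = 1%g) ->
  ~ exists f : {multiplicative SL2Z_torus k -> G}, injective f.
Proof.
move=> p1 p0 heis [f f_inj]; have [z [z0 z1 zp]] := nontrivial_unity_root p1 p0.
pose zeta : kstar k := exist _ z z0.
have zetap : (zeta ^+ p = 1)%g by apply: val_inj; rewrite val_kstarX.
pose u := unipotent_elt k; pose v := torus_elt 1%g zeta; pose c := torus_elt zeta 1%g.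
have f1 : f 1%g = 1%g by apply: (mulgI (f 1%g)); rewrite -gmulfM !mulg1.
have fX g i : f (g ^+ i)%g = (f g ^+ i)%g.
  by elim: i => [|i IH]; rewrite ?expg0 // !expgS gmulfM IH.
have : f c = 1%g.
  apply: (heis (f u) (f v)).
  - by rewrite -fX torus_eltX zetap expg1n.
  - by rewrite -fX torus_eltX zetap expg1n.
  - by rewrite -!gmulfM !torus_eltM !mulg1 !mul1g.
  - by rewrite -!gmulfM unipotent_elt_torus mulg1.
  - by rewrite -!gmulfM unipotent_elt_torus torus_eltM !mul1g mulg1.
rewrite -f1 => /f_inj/(congr1 (fun g => val g.2.1)) /= /eqP.
by rewrite (negPf z1).
Qed.

Theorem theorem2 (R : realType) (k : closedFieldType) (K : fieldType) (n : nat) :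
  (~ exists f : {multiplicative SL2Z_torus k -> Diff R n}, injective f) /\
  (~ exists f : {multiplicative SL2Z_torus k -> Aut_affine K n}, injective f).
Proof.
have [mk hk] := prime_natr_neq0_above k.
have [mK hK] := prime_natr_neq0_above K.
(* The bound 2 makes p odd; [mk] and [mK] keep p away from the characteristics of [k] and [K]. *)
have [p big p_pr] := prime_above (maxn (maxn mk mK) (maxn n 2)).
have [kp Kp np p2] : [/\ (mk < p)%N, (mK < p)%N, (n < p)%N & (2 < p)%N] by split; lia.
split; apply: (not_injective_of_heisenberg (prime_gt1 p_pr) (hk p p_pr kp)) => u v c.
  by apply: Diff_heisenberg => //; case: (even_prime p_pr) => // p_eq2; rewrite p_eq2 in p2.
by apply: Aut_heisenberg => //; exact: hK.
Qed.
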